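(* Fix $n>k>0$ and suppose that for every choice of distinct real numbers $t_1,\ldots,t_{k(n-k)}$, the intersection $X_{\alpha}F_\bullet(t_1)\cap\cdots\cap X_{\alpha}F_\bullet(t_{k(n-k)})$ with $\alpha=(1,2,\ldots,k-1,k+1)$ is transverse. Then for any $\alpha^1,\ldots,\alpha^s\in\binom{[n]}{k}$ with $|\alpha^1|+\cdots+|\alpha^s|=k(n-k)$ and any distinct real numbers $t_1,\ldots,t_s$, every point of the intersection $X_{\alpha^1}F_\bullet(t_1)\cap\cdots\cap X_{\alpha^s}F_\bullet(t_s)$ is real.
   Context: $\mathrm{Gr}(k,n)$ is the Grassmannian of $k$-planes in $\mathbb{C}^n$. $\binom{[n]}{k}$ is the set of sequences $1\le\alpha_1<\cdots<\alpha_k\le n$ and $|\alpha|=\sum_j(\alpha_j-j)$. For $t\in\mathbb{C}$, $F_i(t)$ is the span of $\gamma(t),\gamma'(t),\ldots,\gamma^{(i-1)}(t)$ where $\gamma(t)=(1,t,\ldots,t^{n-1})$ (the $i$-plane osculating the rational normal curve), and $F_\bullet(t)$ is the flag $F_1(t)\subset\cdots\subset F_n(t)$. For a flag $F_\bullet$, $X_\alpha F_\bullet=\{K: \dim(K\cap F_{n+1-\alpha_j})\ge k+1-j,\ j=1,\ldots,k\}$, a subvariety of codimension $|\alpha|$. *)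

(* Defs.v *)
From HB Require Import structures.
From mathcomp Require Import all_boot all_order all_algebra.
From mathcomp Require Import reals.
From mathcomp Require Import complex.
Set Implicit Arguments. Unset Strict Implicit. Unset Printing Implicit Defensive.
Import Order.TTheory GRing.Theory Num.Theory.
Local Open Scope ring_scope.

(* R : realType is the real numbers, C := R[i] the complex numbers.
   Points of Gr(k, n) are represented by full-rank matrices M : 'M[C]_(k, n)
   (K = row space of M).  Everything below depends only on the row space. *)

(* Osculating flag: F_i(t) = row space of osc i t, whose r-th row
   (r = 0..i-1) is gamma^(r)(t), with gamma(t) = (1, t, ..., t^(n-1)):
   the j-th entry of gamma^(r)(t) is j (j-1) ... (j-r+1) t^(j-r). *)
Definition osc (R : realType) (n i : nat) (t : R) : 'M[R[i]]_(i, n) :=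
  \matrix_(r < i, j < n) ((j ^_ r)%:R * (t%:C) ^+ (j - r))%C.

(* A Schubert index alpha in binom([n],k), written 0-based:
   alpha_(j+1) = a j + 1 for j : 'I_k.  Condition 1 <= alpha_1 < ... < alpha_k <= n. *)
Definition schub_index (k n : nat) (a : 'I_k -> nat) : Prop :=
  (forall i j : 'I_k, (i < j)%N -> (a i < a j)%N) /\ (forall j, (a j < n)%N).

Definition schub_size (k : nat) (a : 'I_k -> nat) : nat := (\sum_(j < k) (a j - j))%N.

(* X_alpha F_bullet(t): dim(K cap F_{n+1-alpha_j}(t)) >= k+1-j, j = 1..k;
   in 0-based form: dim(K cap F_{n - a j}(t)) >= k - j, j = 0..k-1. *)
Definition in_schub (R : realType) (k n : nat) (a : 'I_k -> nat) (t : R)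
    (M : 'M[R[i]]_(k, n)) : Prop :=
  forall j : 'I_k, (k - j <= \rank (M :&: osc n (n - a j) t)%MS)%N.

Definition alpha_div (k : nat) (j : 'I_k) : nat :=
  if val j == k.-1 then k else val j.

(* Directional derivative of the determinant at A in direction H:
   d/de det(A + e H) at e = 0 (a polynomial identity, computed formally). *)
Definition ddet (F : comNzRingType) (N : nat) (A H : 'M[F]_N) : F :=
  (\det (map_mx polyC A + 'X *: map_mx polyC H))`_1.

(* In Gr(k, k+m) (n = k + m) the Schubert divisor X_alpha F(t),
   alpha = (1,...,k-1,k+1), i.e. {K : K cap F_m(t) <> 0}, is the zero set of the
   section M |-> det [M ; osc m t] of O(1).  The intersection of the k*m divisors
   X_alpha F(T i) is transverse iff at every point K = rowspace M of the
   intersection the differentials of these defining equations are linearly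
   independent on the tangent space T_K Gr = Hom(K, C^n/K), i.e. the
   (Jacobian) linear map  X |-> (d/de det[M + e X ; osc m (T i)])_i  from
   'M_(k, k+m) to C^(k*m) is surjective. *)
Definition divisors_transverse (R : realType) (k m : nat) (T : 'I_(k * m) -> R) : Prop :=
  forall M : 'M[R[i]]_(k, k + m), \rank M = k ->
    (forall i, in_schub (alpha_div (k:=k)) (T i) M) ->
    forall v : 'rV[R[i]]_(k * m), exists X : 'M[R[i]]_(k, k + m),
      forall i, ddet (col_mx M (osc (k + m) m (T i))) (col_mx X 0) = v 0 i.

Definition real_point (R : realType) (k n : nat) (M : 'M[R[i]]_(k, n)) : Prop :=
  exists Mr : 'M[R]_(k, n), (map_mx (fun x => x%:C%C) Mr == M)%MS.

(* Main.v *)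
(** The Wronski map sends a [k]-plane [K], the row space of [M], to the polynomial
    [w_M(t) = det [M ; F_m(t)]], of degree at most [k m]. It never vanishes
    identically, so it is proper, and [K] lies in [X_alpha F(t)] only if [t] is a
    root of [w_M] of multiplicity at least [|alpha|]. Hence the points of the given
    intersection lie over a polynomial with [k m] real roots, counted with
    multiplicity, and all of them lie in the big cell, where [w] is a polynomial map
    [C^(k m) -> C^(k m)] with real coefficients. The transversality hypothesis says
    that [w] is etale over the polynomials with distinct real roots. A non-real
    point is excluded in three steps.

    (1) A non-real point over a polynomial with multiple real roots has a non-real
    point nearby, over a polynomial with distinct real roots. Fibres are finite: by
    quantifier elimination the values of a coordinate on a fibre form a finite or
    cofinite set, and properness excludes the second case. The critical values on a
    complex line through a regular value are finite in number for the same reason,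
    so that one can lift a path of the line that avoids them.

    (2) A non-real point over distinct real roots can be followed along any path of
    such root configurations: it cannot become real, since it would merge there with
    its complex conjugate and contradict injectivity of [w] near a regular point.

    (3) For some configuration of roots the whole fibre is real. By induction on the
    dimension [p] of Schubert cells, one finds [p] roots over which all points of all
    [p]-dimensional cells are real and nondegenerate; the next root is taken close to
    infinity, where every point of a [p + 1]-dimensional cell is close to such a
    point of an adjacent cell.

    Compactness is used through limits along an ultrafilter on [nat]. *)

Require Import Defs.
From HB Require Import structures.
From mathcomp Require Import all_boot all_order all_algebra all_fingroup.
From mathcomp Require Import closed_field.
From mathcomp Require Import boolp classical_sets filter.
From mathcomp Require Import reals complex.
From mathcomp Require polyrcf.
From mathcomp Require Import ring lra zify.
Set Implicit Arguments. Unset Strict Implicit. Unset Printing Implicit Defensive.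
Import Order.TTheory GRing.Theory Num.Theory.
Local Open Scope ring_scope.

(** * The Wronski polynomial of a subspace *)

(** No Taylor expansion occurs. The Wronski polynomial is multilinear in the rows of the matrix, so
    [wronski A - wronski B] is exactly [dwronski A B (A - B)], linear in [A - B] with coefficients
    polynomial in [A] and [B]. If two distinct points of a fibre tend to the same limit, their
    difference, rescaled to norm one, converges to a nonzero vector in the kernel of the
    differential there. Local injectivity, stability of regularity and the induction of step (3) all
    rest on this. That induction carries reality and nondegeneracy together, because both are
    deduced in dimension [p + 1] from nondegeneracy in dimension [p]. Transversality says nothing
    over an empty fibre, whereas step (1) moves a point along a line towards a regular one. A real
    point over distinct real roots is therefore constructed separately, by creating sign changes of
    the Wronski polynomial one at a time. Local surjectivity at a regular point comes from
    minimizing the distance to the prescribed polynomial over a small ball: an interior minimum at a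
    regular point must be zero. *)

Definition mix (T : Type) p q (i : 'I_p) (A H B : 'M[T]_(p, q)) : 'M[T]_(p, q) :=
  \matrix_(r, c) if (r < i)%N then A r c else if r == i then H r c else B r c.

Section Wdef.
Variables (F : comNzRingType) (k m : nat).

Definition oscp : 'M[{poly F}]_(m, k + m) :=
  \matrix_(r < m, j < k + m) ((j ^_ r)%:R *: 'X^(j - r)).

(* As a function of [t] this is [det [M ; osc m t]]; up to a constant it is the
   Wronskian of the [k]-space of polynomials of degree [< k + m] dual to [M]. *)
Definition wronski (M : 'M[F]_(k, k + m)) : {poly F} :=
  \det (col_mx (map_mx polyC M) oscp).

(** The sum of the [k] largest column indices. In the Leibniz expansion, a permutation that gives
    the rows of [M] columns of total index [S] contributes in degree [topexp - S]. *)
Definition topexp := (\sum_(r < k) (m + r))%N.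

(** All column indices together have a fixed sum, so the exponent collected from the osculating rows
    is determined by the columns left to the rows of [M]. *)
Lemma perm_exponent (s : 'S_(k + m)) :
  (forall r : 'I_m, r <= s (rshift k r))%N ->
  (\sum_(r < m) (s (rshift k r) - r) + \sum_(r < k) s (lshift m r) = topexp)%N.
Proof.
move=> le_s.
have e1 : (\sum_(r < m) (s (rshift k r) - r) + \sum_(r < m) r
           = \sum_(r < m) s (rshift k r))%N.
  by rewrite -big_split /=; apply: eq_bigr => r _; rewrite subnK.
have e2 : (\sum_(r < k) s (lshift m r) + \sum_(r < m) s (rshift k r)
           = \sum_(i < k + m) i)%N.
  by rewrite [RHS](reindex_inj (@perm_inj _ s)) /= big_split_ord.
have e3 : (\sum_(i < k + m) i = \sum_(r < m) r + topexp)%N.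
  rewrite /topexp -(big_mkord xpredT id) addnC /index_iota subn0 iotaD.
  rewrite big_cat /= add0n -[m in iota m k]addn0 iotaDl big_map; congr addn.
    by rewrite -(big_mkord xpredT id) /index_iota subn0.
  by rewrite -(big_mkord xpredT) /index_iota subn0.
by apply/eqP; rewrite -(eqn_add2r (\sum_(r < m) r)) addnAC e1 addnC e2 e3 addnC.
Qed.

Definition permcoef (M : 'M[F]_(k, k + m)) (s : 'S_(k + m)) : F :=
  (-1) ^+ s * (\prod_(r < k) M r (s (lshift m r))
               * \prod_(r < m) ((s (rshift k r)) ^_ r)%:R).

Lemma wronski_sum_perm (M : 'M[F]_(k, k + m)) :
  wronski M = \sum_(s : 'S_(k + m))
          permcoef M s *: 'X^(topexp - \sum_(r < k) s (lshift m r)).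
Proof.
rewrite /wronski /determinant; apply: eq_bigr => s _.
rewrite big_split_ord /=.
under eq_bigr do rewrite col_mxEu mxE.
under [X in _ * (_ * X)]eq_bigr do rewrite col_mxEd mxE.
rewrite -rmorph_prod /= scaler_prod /permcoef.
have -> : (-1) ^+ s = ((-1) ^+ s)%:P :> {poly F} by rewrite rmorphXn rmorphN1.
rewrite -[RHS]mul_polyC !polyCM -!mulrA; congr (_ * (_ * _)).
have [le_s|/forallPn[r]] := boolP [forall r : 'I_m, r <= s (rshift k r)]%N.
  rewrite -(perm_exponent (fun r => forallP le_s r)) addnK.
  by rewrite prodrXr mul_polyC.
rewrite -ltnNge => lt_s.
by rewrite (bigD1 r) //= ffact_small // !mul0r !scale0r ?mulr0 ?mul0r.
Qed.

(** The falling factorials vanish as soon as some osculating row [r] meets a column smaller than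
    [r]; a nonzero coefficient thus makes the truncated subtractions in the exponents exact. *)
Lemma permcoef_neq0 (M : 'M[F]_(k, k + m)) (s : 'S_(k + m)) :
  permcoef M s != 0 ->
  (forall r : 'I_k, M r (s (lshift m r)) != 0) /\
  (\sum_(r < k) s (lshift m r) <= topexp)%N.
Proof.
move=> nz; split=> [r|].
  by apply: contraNneq nz => Mr0; rewrite /permcoef (bigD1 r) //= Mr0 !mul0r mulr0.
rewrite -(@perm_exponent s) ?leq_addl // => r; rewrite leqNgt.
by apply: contraNN nz => lt_s; rewrite /permcoef [X in _ * (_ * X)](bigD1 r) //= ffact_small // mul0r !mulr0.
Qed.

Definition rowpat (e : 'I_k -> 'I_(k + m)) : 'M[F]_(k, k + m) :=
  \matrix_(i, c) (c == e i)%:R.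

(** The Wronski polynomial of a coordinate subspace is a monomial; evaluation at 1 reads off its
    coefficient. *)
Definition omega (e : 'I_k -> 'I_(k + m)) : F := (wronski (rowpat e)).[1].

Lemma omega_sum e : omega e = \sum_(s : 'S_(k + m)) permcoef (rowpat e) s.
Proof.
rewrite /omega wronski_sum_perm horner_sum; apply: eq_bigr => s _.
by rewrite hornerZ hornerXn expr1n mulr1.
Qed.

Section Degree.
Variables (e : 'I_k -> 'I_(k + m)) (p : nat) (Y : 'M[F]_(k, k + m)).
Hypotheses (pE : (p + \sum_(r < k) e r = topexp)%N)
           (Y0 : forall i (c : 'I_(k + m)), (c < e i)%N -> Y i c = 0).

Lemma size_wronski_le : (size (wronski Y) <= p.+1)%N.
Proof.
rewrite wronski_sum_perm; apply: (leq_trans (size_sum _ _ _)); apply/bigmax_leqP => s _.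
have [->|/permcoef_neq0[nz _]] := eqVneq (permcoef Y s) 0.
  by rewrite scale0r size_poly0.
apply: (leq_trans (size_scale_leq _ _)); rewrite size_polyXn ltnS -pE.
rewrite leq_subLR addnC leq_add2r; apply: leq_sum => r _.
by rewrite leqNgt; apply: contraNN (nz r) => /Y0->.
Qed.

(** A contributing permutation uses in row [r] a column at least [e r]. Degree [p] forces equality
    in every row, which leaves exactly the permutations that define [omega e]. *)
Lemma coef_wronski_top : (wronski Y)`_p = (\prod_(r < k) Y r (e r)) * omega e.
Proof.
rewrite wronski_sum_perm coef_sum omega_sum mulr_sumr; apply: eq_bigr => s _.
rewrite coefZ coefXn.
have [/forallP eq_s|/forallPn[i ne_i]] := boolP [forall r, s (lshift m r) == e r].
  have eqs r : s (lshift m r) = e r by apply/eqP.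
  rewrite (eq_bigr (fun r => nat_of_ord (e r))) => [|r _]; last by rewrite eqs.
  rewrite -pE addnK eqxx mulr1 /permcoef [RHS]mulrCA; congr (_ * _).
  rewrite [X in _ = _ * (X * _)]big1 ?mul1r => [|r _]; last by rewrite mxE eqs eqxx.
  by congr (_ * _); apply: eq_bigr => r _; rewrite eqs.
have -> : permcoef (rowpat e) s = 0.
  rewrite /permcoef (bigD1 i) //= mxE (negPf ne_i) !mul0r mulr0 //.
rewrite mulr0.
have [->|/permcoef_neq0[nz ub]] := eqVneq (permcoef Y s) 0; first by rewrite mul0r.
suff lt_s : (\sum_(r < k) e r < \sum_(r < k) s (lshift m r))%N.
  by rewrite (_ : (p == _) = false) ?mulr0 //; apply/eqP; lia.
have le_s r : (e r <= s (lshift m r))%N.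
  by rewrite leqNgt; apply: contraNN (nz r) => /Y0->.
rewrite (bigD1 i) //= [X in (_ < X)%N](bigD1 i) //= -addSn leq_add //.
  by rewrite ltn_neqAle le_s andbT eq_sym.
by apply: leq_sum => r _.
Qed.
End Degree.

(** The counterpart at 0 of the degree bound: rows ending at the columns [b] bound the exponents
    from below. *)
Lemma wronski_dvd_Xn (b : 'I_k -> nat) (Y : 'M[F]_(k, k + m)) :
  (forall i (c : 'I_(k + m)), (b i < c)%N -> Y i c = 0) ->
  exists q, wronski Y = q * 'X^(topexp - \sum_(r < k) b r).
Proof.
move=> Y0; set B := (topexp - _)%N.
exists (\sum_(s : 'S_(k + m)) permcoef Y s *: 'X^(topexp - \sum_(r < k) s (lshift m r) - B)).
rewrite wronski_sum_perm mulr_suml; apply: eq_bigr => s _.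
have [->|/permcoef_neq0[nz _]] := eqVneq (permcoef Y s) 0; first by rewrite !scale0r mul0r.
rewrite -scalerAl -exprD subnK // /B leq_sub2l //; apply: leq_sum => r _.
by rewrite leqNgt; apply: contraNN (nz r) => /Y0->.
Qed.

Lemma wronski_mulmx (g : 'M[F]_k) (M : 'M[F]_(k, k + m)) : wronski (g *m M) = (\det g)%:P * wronski M.
Proof.
have -> : (\det g)%:P = \det (block_mx (map_mx polyC g) 0 0 (1%:M : 'M_m)).
  by rewrite det_ublock det1 mulr1 -det_map_mx.
by rewrite /wronski -det_mulmx mul_block_col !mul0mx mul1mx addr0 add0r map_mxM.
Qed.

(** A divided difference with base points [A] and [B]; for [A = B] it is the differential of
    [wronski] at [A] in direction [H]. *)
Definition dwronski (A B H : 'M[F]_(k, k + m)) := \sum_(i < k) wronski (mix i A H B).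
End Wdef.

Lemma map_wronski (F F' : comNzRingType) (f : {rmorphism F -> F'}) k m (M : 'M[F]_(k, k + m)) :
  wronski (map_mx f M) = map_poly f (wronski M).
Proof.
rewrite /wronski -det_map_mx map_col_mx -!map_mx_comp; congr (\det (col_mx _ _)).
  by apply/matrixP => i j; rewrite !mxE /= map_polyC.
by apply/matrixP => i j; rewrite !mxE /= map_polyZ map_polyXn rmorph_nat.
Qed.

(** * Multilinear expansion of differences of determinants *)

Section Telescope.
Variable F : comNzRingType.

Lemma map_mix (T T' : Type) (f : T -> T') p q (i : 'I_p) (A H B : 'M[T]_(p, q)) :
  map_mx f (mix i A H B) = mix i (map_mx f A) (map_mx f H) (map_mx f B).
Proof. by apply/matrixP => r c; rewrite !mxE; case: ifP => // _; case: ifP. Qed.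

Lemma det_mix_lin n (i : 'I_n) (A H1 H2 B : 'M[F]_n) (b c : F) :
  \det (mix i A (b *: H1 + c *: H2) B)
    = b * \det (mix i A H1 B) + c * \det (mix i A H2 B).
Proof.
apply: (@determinant_multilinear _ _ _ _ _ i).
- by apply/rowP => j; rewrite !mxE ltnn eqxx.
- by apply/matrixP => r j; rewrite !mxE eq_sym (negPf (neq_lift _ _)).
- by apply/matrixP => r j; rewrite !mxE eq_sym (negPf (neq_lift _ _)).
Qed.

(** The rows of [B] are replaced by those of [A] one at a time; each replacement changes the
    determinant by one summand. *)
Lemma det_sub_telescope n (A B : 'M[F]_n) :
  \det A - \det B = \sum_(i < n) \det (mix i A (A - B) B).
Proof.
pose S j := \det (\matrix_(r, c) if (r < j)%N then A r c else B r c).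
have -> : \det A = S n.
  by congr (\det _); apply/matrixP => r c; rewrite mxE ltn_ord.
have -> : \det B = S 0%N by congr (\det _); apply/matrixP => r c; rewrite mxE.
rewrite -(telescope_sumr S (leq0n n)) big_mkord; apply: eq_bigr => i _.
have -> : A - B = 1 *: A + (-1) *: B by rewrite scale1r scaleN1r.
rewrite det_mix_lin mul1r mulN1r; congr (_ - _); congr (\det _); apply/matrixP => r c; rewrite !mxE.
  by rewrite ltnS leq_eqVlt; case: (r =P i) => [->|/eqP ne]; rewrite ?eqxx ?ltnn // (_ : (val r == val i) = false) //; apply: negPf.
by case: ltnP => // _; case: eqP => // ->.
Qed.

Lemma det_mix_row0 n (i : 'I_n) (A H B : 'M[F]_n) :
  (forall j, H i j = 0) -> \det (mix i A H B) = 0.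
Proof.
move=> H0; rewrite (expand_det_row _ i) big1 // => j _.
by rewrite mxE ltnn eqxx H0 mul0r.
Qed.

Lemma det_mix_trace n (A H : 'M[F]_n) :
  \sum_(i < n) \det (mix i A H A) = \tr (H *m \adj A).
Proof.
rewrite /mxtrace; apply: eq_bigr => i _.
rewrite (expand_det_row _ i) mxE; apply: eq_bigr => j _.
rewrite !mxE ltnn eqxx; congr (_ * (_ * \det _)).
apply/matrixP => r c; rewrite !mxE eq_sym (negPf (neq_lift _ _)).
by case: ifP.
Qed.

End Telescope.

Section Rect.
Variables (F : comNzRingType) (k m : nat).
Implicit Types A B H M : 'M[F]_(k, k + m).
Let O := oscp F k m.
Let P M := map_mx polyC M.

Lemma mix_col_mxu (i : 'I_k) A H B (Z : 'M[{poly F}]_(m, k + m)) :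
  mix (lshift m i) (col_mx (P A) O) (col_mx (P H) Z) (col_mx (P B) O)
    = col_mx (P (mix i A H B)) O.
Proof.
apply/matrixP => r c; rewrite !mxE; case: splitP => j rj; rewrite !mxE.
  rewrite -!val_eqE /= rj; case: ifP => // _.
  by rewrite val_eqE; case: ifP.
rewrite -!val_eqE /= rj; have := ltn_ord i => ?.
by rewrite ltnNge leq_eqVlt ltn_addr // orbT /= (_ : (k + j == i)%N = false) //; lia.
Qed.

Lemma dwronski_det A B H :
  dwronski A B H = \sum_i \det (mix i (col_mx (P A) O) (col_mx (P H) 0) (col_mx (P B) O)).
Proof.
rewrite big_split_ord /= [X in _ = _ + X]big1 ?addr0 => [|i _]; last first.
  by apply: det_mix_row0 => j; rewrite col_mxEd mxE.
by apply: eq_bigr => i _; rewrite mix_col_mxu.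
Qed.

Lemma wronski_sub A B : wronski A - wronski B = dwronski A B (A - B).
Proof.
rewrite /wronski det_sub_telescope dwronski_det; apply: eq_bigr => i _.
by rewrite opp_col_mx add_col_mx subrr; congr (\det (mix i _ (col_mx _ _) _)); rewrite /P map_mxB.
Qed.

Lemma dwronski_trace A H : dwronski A A H = \tr (col_mx (P H) 0 *m \adj (col_mx (P A) O)).
Proof. by rewrite dwronski_det det_mix_trace. Qed.

Lemma wronski_mix_lin (i : 'I_k) A H1 H2 B (b c : F) :
  wronski (mix i A (b *: H1 + c *: H2) B) = b *: wronski (mix i A H1 B) + c *: wronski (mix i A H2 B).
Proof.
rewrite /wronski -!(mix_col_mxu _ _ _ _ 0) /P map_mxD !map_mxZ.
rewrite -!mul_polyC -det_mix_lin; congr (\det (mix _ _ _ _)).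
by rewrite !scale_col_mx add_col_mx !scaler0 addr0.
Qed.

Lemma dwronski_lin A B H1 H2 (b c : F) :
  dwronski A B (b *: H1 + c *: H2) = b *: dwronski A B H1 + c *: dwronski A B H2.
Proof. by rewrite /dwronski !scaler_sumr -big_split; apply: eq_bigr => i _; rewrite wronski_mix_lin. Qed.

Lemma dwronskiZ A B H (c : F) : dwronski A B (c *: H) = c *: dwronski A B H.
Proof. by rewrite -[c *: H]addr0 -[0](scale0r H) dwronski_lin scale0r addr0. Qed.

Lemma dwronskiD A B H1 H2 : dwronski A B (H1 + H2) = dwronski A B H1 + dwronski A B H2.
Proof. by rewrite -[H1]scale1r -[H2]scale1r dwronski_lin !scale1r. Qed.

Lemma dwronskiB A B H1 H2 : dwronski A B (H1 - H2) = dwronski A B H1 - dwronski A B H2.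
Proof. by rewrite -[H1]scale1r -scaleN1r dwronski_lin scaleN1r !scale1r. Qed.

(** Moving along [C *m A] only changes the basis of the row space, which multiplies the Wronski
    polynomial by a determinant whose derivative is the trace. *)
Lemma dwronski_mull A (C : 'M[F]_k) : dwronski A A (C *m A) = \tr C *: wronski A.
Proof.
rewrite dwronski_trace.
have -> : col_mx (P (C *m A)) (0 : 'M_(m, k + m))
          = block_mx (map_mx polyC C) 0 0 (0 : 'M_m) *m col_mx (P A) O.
  by rewrite mul_block_col !mul0mx !addr0 /P map_mxM.
rewrite -mulmxA mul_mx_adj mul_mx_scalar linearZ /= mulrC -mul_polyC mxtrace_block.
by rewrite mxtrace0 addr0 /P /mxtrace rmorph_sum /=; congr (_ * _); apply: eq_bigr => i _; rewrite mxE.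
Qed.
End Rect.

Lemma adj_mulmx_cancel (R : idomainType) n (G A : 'M[R]_n) :
  \det A != 0 -> \adj (G *m A) *m G = \det G *: \adj A.
Proof.
move=> A0.
have : \adj (G *m A) *m (G *m A) *m \adj A = (\det G * \det A) *: \adj A.
  by rewrite mul_adj_mx det_mulmx mul_scalar_mx.
rewrite -!mulmxA mul_mx_adj mulmxA mul_mx_scalar mulrC -scalerA => /matrixP eqA.
by apply/matrixP => i j; apply: (mulfI A0); have := eqA i j; rewrite !mxE.
Qed.

Lemma dwronski_mulmx (R : idomainType) k m (g : 'M[R]_k) (A H : 'M[R]_(k, k + m)) :
  wronski A != 0 -> dwronski (g *m A) (g *m A) (g *m H) = \det g *: dwronski A A H.
Proof.
move=> WA; rewrite !dwronski_trace.
pose G := block_mx (map_mx polyC g) 0 0 (1%:M : 'M_m).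
have dG : \det G = (\det g)%:P by rewrite det_ublock det1 mulr1 -det_map_mx.
have -> : col_mx (map_mx polyC (g *m H)) (0 : 'M_(m, k + m)) = G *m col_mx (map_mx polyC H) 0.
  by rewrite mul_block_col !mul0mx mulmx0 !addr0 map_mxM.
have -> : col_mx (map_mx polyC (g *m A)) (oscp R k m) = G *m col_mx (map_mx polyC A) (oscp R k m).
  by rewrite mul_block_col !mul0mx mul1mx addr0 add0r map_mxM.
rewrite -mulmxA mxtrace_mulC -mulmxA adj_mulmx_cancel // dG.
by rewrite -scalemxAr linearZ /= mul_polyC.
Qed.

(** Jacobi's formula. It connects the Jacobian of the transversality hypothesis with [dwronski].
    Each summand of the telescoped difference carries a factor ['X], and the cofactor left over is
    evaluated at 0. *)
Lemma ddet_trace (F : comNzRingType) n (A H : 'M[F]_n) :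
  (\det (map_mx polyC A + 'X *: map_mx polyC H))`_1 = \tr (H *m \adj A).
Proof.
set A' := map_mx polyC A; set H' := map_mx polyC H.
have := det_sub_telescope (A' + 'X *: H') A'; rewrite addrAC subrr add0r.
have -> : \det A' = (\det A)%:P by rewrite -det_map_mx.
move/(congr1 (fun p : {poly F} => p`_1)); rewrite coefB coefC subr0 => ->.
rewrite coef_sum -det_mix_trace; apply: eq_bigr => i _.
have := det_mix_lin i (A' + 'X *: H') H' H' A' 'X 0.
rewrite scale0r addr0 mul0r addr0 => ->; rewrite coefXM /=.
rewrite -horner_coef0 -[_.[0]]/(horner_eval 0 _) -det_map_mx map_mix; congr (\det (mix _ _ _ _)).
- by apply/matrixP => r c; rewrite !mxE /= /horner_eval hornerD hornerM hornerX mul0r addr0 hornerC.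
- by apply/matrixP => r c; rewrite !mxE /= /horner_eval hornerC.
- by apply/matrixP => r c; rewrite !mxE /= /horner_eval hornerC.
Qed.

(** * Maximal minors and column exchange *)

Definition fupd (I : eqType) T (s : I -> T) i0 c := fun i => if i == i0 then c else s i.

Section Minors.
Variables (F : fieldType) (k n : nat).
Implicit Types (M : 'M[F]_(k, n)) (s : 'I_k -> 'I_n).

Lemma colsub_mulmx p q r (s : 'I_r -> 'I_n) (g : 'M[F]_(p, q)) (M : 'M[F]_(q, n)) :
  colsub s (g *m M) = g *m colsub s M.
Proof. by apply/matrixP => i j; rewrite !mxE; apply: eq_bigr => l _; rewrite mxE. Qed.

(** By this identity an extremal choice of a minor controls all entries of the normalized matrix; it
    yields both echelon forms and bounded frames. *)
Lemma det_colsub_fupd s M i0 c : colsub s M = 1%:M -> \det (colsub (fupd s i0 c) M) = M i0 c.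
Proof.
move=> sM; rewrite (expand_det_col _ i0) (eq_bigr (fun r => M r c * (r == i0)%:R)).
  rewrite (bigD1 i0) //= eqxx mulr1 big1 ?addr0 // => r /negPf->; by rewrite mulr0.
move=> r _; rewrite !mxE /fupd eqxx; congr (_ * _).
transitivity (cofactor (1%:M : 'M[F]_k) r i0).
  congr (_ * \det _); apply/matrixP => i j; rewrite !mxE eq_sym (negPf (neq_lift _ _)).
  by move/matrixP: sM => /(_ (lift r i) (lift i0 j)); rewrite !mxE.
have := congr1 (fun N : 'M_k => N i0 r) (mul_adj_mx (1%:M : 'M[F]_k)).
by rewrite mulmx1 !mxE det1 eq_sym.
Qed.

Lemma full_rank_minor M : \rank M = k -> exists s : {ffun 'I_k -> 'I_n}, \det (colsub s M) != 0.
Proof.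
move=> rM.
have fM : row_full M^T by rewrite /row_full mxrank_tr rM.
exists (fullrankfun fM); rewrite -unitfE -unitmxE -unitmx_tr.
rewrite (_ : _^T = rowsub (fullrankfun fM) M^T) ?fullrowsub_unit //.
by apply/matrixP => i j; rewrite !mxE.
Qed.
End Minors.

(** * Echelon forms and the degree of the Wronski polynomial *)

Lemma natr_ffact_prod (F : comNzRingType) (j r : nat) :
  (j ^_ r)%:R = \prod_(i < r) (j%:R - i%:R) :> F.
Proof.
elim: r => [|r IH]; first by rewrite big_ord0.
rewrite big_ord_recr /= -IH ffactnSr natrM; have [le_rj|lt_jr] := leqP r j.
  by rewrite natrB.
by rewrite ffact_small // !mul0r.
Qed.

(** A left kernel vector of the matrix at 1 encodes, in its last [m] entries, a polynomial [Q] of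
    degree less than [m] in the basis of falling factorials. The columns outside the image of [e]
    say that [Q] vanishes at [m] distinct integers, so [Q = 0]; the columns in the image then kill
    the first [k] entries. *)
Lemma omega_neq0 (F : numFieldType) k m (e : 'I_k -> 'I_(k + m)) : injective e -> omega F e != 0.
Proof.
move=> inj_e; rewrite /omega /wronski -[_.[1]]/(horner_eval 1 _) -det_map_mx.
apply/det0P => -[v v0]; rewrite -[v]hsubmxK map_col_mx mul_row_col => vM.
set v1 := lsubmx v in vM *; set v2 := rsubmx v in vM *.
pose Q : {poly F} := \sum_(r < m) v2 0 r *: \prod_(i < r) ('X - i%:R%:P).
have Qj (j : nat) : Q.[j%:R] = \sum_(r < m) v2 0 r * (j ^_ r)%:R.
  rewrite horner_sum; apply: eq_bigr => r _; rewrite hornerZ horner_prod natr_ffact_prod.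
  by congr (_ * _); apply: eq_bigr => i _; rewrite hornerXsubC.
have vMj (j : 'I_(k + m)) : \sum_(i < k) v1 0 i * (j == e i)%:R + Q.[(j : nat)%:R] = 0.
  have := congr1 (fun N : 'rV_(k + m) => N 0 j) vM; rewrite /= !mxE Qj => h; apply: etrans h.
  congr (_ + _); apply: eq_bigr => i _; rewrite !mxE /= /horner_eval.
    by rewrite hornerC.
  by rewrite hornerZ hornerXn expr1n mulr1.
have Q0 : Q = 0.
  apply/eqP; apply: contraTT isT => Qn0.
  pose rs : seq F := [seq (val j)%:R | j <- enum [predC (mem (codom e))]].
  have : (size rs < size Q)%N.
    apply: max_poly_roots Qn0 _ _.
      apply/allP => x /mapP[j]; rewrite mem_enum inE => je ->.
      apply/rootP; have := vMj j; rewrite big1 ?add0r // => i _.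
      by case: eqP => [jei|]; rewrite ?mulr0 //; move: je; rewrite jei codom_f.
    rewrite map_inj_uniq ?enum_uniq // => i j /eqP; rewrite eqr_nat => /eqP; exact: val_inj.
  rewrite size_map -cardE; have := cardC (mem (codom e)).
  rewrite card_codom // !card_ord => /addnI->; rewrite ltnNge => /negP[].
  apply: (leq_trans (size_sum _ _ _)); apply/bigmax_leqP => r _.
  apply: (leq_trans (size_scale_leq _ _)).
  by rewrite size_prod_XsubC [index_enum _]unlock -enumT size_enum_ord.
have v20 : v2 = 0.
  (* The falling factorials are triangular at 0, 1, 2, ..., with diagonal entries [i!], so the
     coefficients vanish one after another. *)
  suff v2r r : forall i : 'I_m, (i < r)%N -> v2 0 i = 0.
    by apply/rowP => i; rewrite [RHS]mxE (v2r m).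
  elim: r => // r IH i; rewrite ltnS leq_eqVlt => /orP[/eqP ir|]; last exact: IH.
  have := Qj i; rewrite Q0 horner0 (bigD1 i) //= big1 ?addr0 => [/esym/eqP|j ji].
    by rewrite mulf_eq0 ffactnn pnatr_eq0 eqn0Ngt fact_gt0 orbF => /eqP.
  have [lt_ji|le_ij] := ltnP j i; first by rewrite IH ?mul0r -?ir.
  by rewrite ffact_small ?mulr0 // ltn_neqAle le_ij andbT eq_sym.
have v10 : v1 = 0.
  apply/rowP => i; rewrite [RHS]mxE; have := vMj (e i).
  rewrite Q0 horner0 addr0 (bigD1 i) //= eqxx mulr1.
  rewrite big1 ?addr0 // => l li; rewrite (_ : (e i == e l) = false) ?mulr0 //.
  by apply/eqP => /inj_e eil; rewrite eil eqxx in li.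
by case/eqP: v0; rewrite -[v]hsubmxK -/v1 -/v2 v10 v20 row_mx0.
Qed.

(** * Extremal sums of column indices *)

Section SumBounds.
Variables k m : nat.
Implicit Types e : 'I_k -> 'I_(k + m).

(** Since [omega] is nonzero over the rationals, some permutation contributes to it, and the
    exponent of its term is the required bound. *)
Lemma sum_inj_le e : injective e -> (\sum_(r < k) e r <= topexp k m)%N.
Proof.
move=> inj_e; have := omega_neq0 rat inj_e; rewrite omega_sum => nz.
have [s] : exists s, permcoef (rowpat rat e) s != 0.
  apply/existsP; apply: contraNT nz; rewrite negb_exists => /forallP h.
  by rewrite big1 // => s _; apply/eqP; have := h s; rewrite negbK.
move/permcoef_neq0 => [se ub]; rewrite (leq_trans _ ub) //; apply: leq_sum => r _.
by have := se r; rewrite mxE; case: (s _ =P e r) => [->|]; rewrite ?leqnn ?eqxx.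
Qed.

Lemma sum_inj_ge e : injective e -> (\sum_(r < k) r <= \sum_(r < k) e r)%N.
Proof.
move=> inj_e; have le_top := sum_inj_le (inj_comp (@rev_ord_inj _) inj_e).
have sum_rev : (\sum_(r < k) rev_ord (e r) + \sum_(r < k) e r = \sum_(r < k) (k + m).-1)%N.
  by rewrite -big_split; apply: eq_bigr => r _ /=; have := ltn_ord (e r); lia.
have sum_top : (topexp k m + \sum_(r < k) r = \sum_(r < k) (k + m).-1)%N.
  rewrite /topexp [X in (_ + X)%N](reindex_inj rev_ord_inj) -big_split.
  by apply: eq_bigr => r _ /=; have := ltn_ord r; lia.
by rewrite -(leq_add2l (topexp k m)) sum_top -sum_rev leq_add2r.
Qed.

Lemma topexp_lshift : (k * m + \sum_(r < k) r = topexp k m)%N.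
Proof. by rewrite /topexp big_split sum_nat_const card_ord. Qed.

Lemma inj_fupd e i c : injective e -> c \notin codom e -> injective (fupd e i c).
Proof.
move=> inj_e ce j l; rewrite /fupd; case: (j =P i) => [->|ji]; case: (l =P i) => [->|li] //.
- by move=> cE; rewrite cE codom_f in ce.
- by move=> cE; rewrite -cE codom_f in ce.
- exact: inj_e.
Qed.

Lemma sum_fupd e i c : (\sum_(r < k) fupd e i c r + e i = \sum_(r < k) e r + c)%N.
Proof.
rewrite (bigD1 i) // [in RHS](bigD1 i) //= /fupd eqxx.
rewrite (eq_bigr (fun r => nat_of_ord (e r))) => [|r /negPf-> //]; ring.
Qed.

Lemma max_inj_sum e i (c : 'I_(k + m)) : injective e -> (\sum_(r < k) e r)%N = topexp k m ->
  c \notin codom e -> (c <= e i)%N.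
Proof.
move=> inj_e eq_top ce; rewrite leqNgt; apply/negP => lt_c.
by have := sum_inj_le (inj_fupd (i := i) inj_e ce); have := sum_fupd e i c; lia.
Qed.

Lemma min_inj_sum e i : injective e -> (\sum_(r < k) e r = \sum_(r < k) r)%N -> (e i < k)%N.
Proof.
move=> inj_e eq_bot; rewrite ltnNge; apply/negP => le_ke.
have [c ce] : exists c : 'I_k, lshift m c \notin codom e.
  apply/existsP; apply: contraT; rewrite negb_exists => /forallP h.
  have /subset_leq_card : codom (lshift m : 'I_k -> _) \subset [predD1 codom e & e i].
    apply/fintype.subsetP => _ /codomP[c ->]; have := h c; rewrite negbK !inE => ->; rewrite andbT.
    by rewrite -val_eqE /=; have := ltn_ord c; lia.
  rewrite card_codom; last exact: lshift_inj.
  rewrite card_ord => le_k.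
  have := cardD1 (e i) (mem (codom e)); rewrite codom_f card_codom // card_ord.
  by move: le_k; rewrite (eq_card (B := [predD1 mem (codom e) & e i])) //; lia.
have ge_bot := sum_inj_ge (inj_fupd (i := i) inj_e ce).
have lt_c : (lshift m c < k)%N by rewrite /= ltn_ord.
have := sum_fupd e i (lshift m c); lia.
Qed.
End SumBounds.

Section Echelon.
Variables (F : numFieldType) (k m : nat).
Implicit Types (M : 'M[F]_(k, k + m)) (d : 'I_k -> 'I_(k + m)).

(* Reduced echelon form with pivot columns [d], which need not be increasing. *)
Definition echelon d M :=
  colsub d M = 1%:M /\ forall i (c : 'I_(k + m)), (c < d i)%N -> M i c = 0.

Lemma colsub1_inj d M : colsub d M = 1%:M -> injective d.
Proof.
move=> /matrixP dM i j dij; have := dM i j; have := dM i i.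
rewrite !mxE dij eqxx => ->; case: (i =P j) => // _ /eqP; by rewrite oner_eq0.
Qed.

Lemma echelon_entry d M i j : echelon d M -> M i (d j) = (i == j)%:R.
Proof. by case=> /matrixP/(_ i j); rewrite !mxE. Qed.

Lemma echelon_sum d M : echelon d M ->
  (topexp k m - \sum_(r < k) d r + \sum_(r < k) d r = topexp k m)%N.
Proof. by case=> /colsub1_inj inj_d _; rewrite subnK // sum_inj_le. Qed.

Lemma echelon_size d M : echelon d M -> size (wronski M) = (topexp k m - \sum_(r < k) d r).+1.
Proof.
move=> dM; have pE := echelon_sum dM; have [d1 d0] := dM; apply/eqP.
rewrite eqn_leq (size_wronski_le pE d0) ltnNge; apply/negP => /leq_sizeP/(_ _ (leqnn _)).
rewrite (coef_wronski_top pE d0) big1 ?mul1r => [/eqP|r _]; last by rewrite (echelon_entry _ _ dM) eqxx.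
by apply/negP; apply: omega_neq0; apply: colsub1_inj d1.
Qed.

Lemma echelon_lead d M p : echelon d M -> (p + \sum_(r < k) d r = topexp k m)%N ->
  (wronski M)`_p = omega F d.
Proof.
move=> dM pE; have [d1 d0] := dM; rewrite (coef_wronski_top pE d0) big1 ?mul1r // => r _.
by rewrite (echelon_entry _ _ dM) eqxx.
Qed.

Lemma minor_normalize (s : 'I_k -> 'I_(k + m)) M : \det (colsub s M) != 0 ->
  let g := invmx (colsub s M) in g \in unitmx /\ colsub s (g *m M) = 1%:M.
Proof.
move=> s0 g; have su : colsub s M \in unitmx by rewrite unitmxE unitfE.
by rewrite unitmx_inv colsub_mulmx mulVmx.
Qed.

(** The pivots are the columns of a nonvanishing minor of least index sum. A nonzero entry left of a
    pivot would be, by column exchange, a nonvanishing minor of smaller sum. *)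
Lemma exists_echelon M : \rank M = k ->
  exists (d : {ffun 'I_k -> 'I_(k + m)}) g, g \in unitmx /\ echelon d (g *m M).
Proof.
case/full_rank_minor => s0 s00.
case: (arg_minnP (P := fun s : {ffun 'I_k -> 'I_(k + m)} => \det (colsub s M) != 0)
                 (fun s : {ffun 'I_k -> 'I_(k + m)} => \sum_(r < k) s r)%N s00) => d d0 d_min.
have [gu g1] := minor_normalize d0; set g := invmx _ in gu g1.
exists d, g; split=> //; split=> // i c lt_c; apply/eqP; apply: contraTT isT => nz.
have : (\sum_(r < k) d r <= \sum_(r < k) fupd d i c r)%N.
  have := d_min [ffun r => fupd d i c r].
  have -> : (\sum_(r < k) [ffun r0 => fupd d i c r0] r = \sum_(r < k) fupd d i c r)%N.
    by apply: eq_bigr => r _; rewrite ffunE.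
  apply; move: nz; rewrite -(det_colsub_fupd i c g1) colsub_mulmx det_mulmx mulf_eq0 negb_or.
  case/andP=> _; congr (~~ (\det _ == _)); apply/matrixP => r l; by rewrite !mxE ffunE.
by rewrite -(leq_add2r (d i)) sum_fupd leq_add2l leqNgt lt_c.
Qed.

(** Normalizing at a minor of largest modulus makes every entry a quotient of that minor's
    competitors by it. These bounded bases are the compactness of the Grassmannian. *)
Lemma exists_frame M : \rank M = k ->
  exists (s : {ffun 'I_k -> 'I_(k + m)}) g,
    [/\ g \in unitmx, colsub s (g *m M) = 1%:M & forall i c, `|(g *m M) i c| <= 1].
Proof.
case/full_rank_minor => s0 s00.
case: (real_arg_maxP (P := predT) (F := fun s : {ffun 'I_k -> 'I_(k + m)} => `|\det (colsub s M)|)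
         (i0 := s0) isT) => [s _|s _ s_max]; first exact: normr_real.
have d0 : \det (colsub s M) != 0.
  by rewrite -normr_gt0 (lt_le_trans _ (s_max s0 isT)) // normr_gt0.
have [gu g1] := minor_normalize d0; set g := invmx _ in gu g1.
exists s, g; split=> // i c.
rewrite -(det_colsub_fupd i c g1) colsub_mulmx det_mulmx det_inv normrM normfV.
rewrite mulrC ler_pdivrMr ?normr_gt0 // mul1r.
have := s_max [ffun r => fupd s i c r] isT.
by congr (`|\det _| <= _); apply/matrixP => r l; rewrite !mxE ffunE.
Qed.

Lemma wronski_neq0 M : \rank M = k -> wronski M != 0.
Proof.
case/exists_echelon => d [g [gu dM]]; have := echelon_size dM.
by rewrite wronski_mulmx; apply: contra_eqN => /eqP->; rewrite mulr0 size_poly0.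
Qed.
End Echelon.

(** * Quantifier elimination over the complex numbers *)

Section Definable.
Variable F : closedFieldType.
Implicit Types (e : seq F) (f g : seq F -> F) (P Q : seq F -> {poly F}) (S : seq F -> Prop).

Definition term_fun f := exists2 t : GRing.term F, GRing.rterm t & forall e, GRing.eval e t = f e.

Lemma term_cst a : term_fun (fun=> a).
Proof. by exists (GRing.Const a). Qed.

Lemma term_var i : term_fun (fun e => e`_i).
Proof. by exists (GRing.Var _ i). Qed.

Lemma termD f g : term_fun f -> term_fun g -> term_fun (fun e => f e + g e).
Proof. by case=> t rt tf [u ru ug]; exists (GRing.Add t u) => [|e] /=; rewrite ?rt // tf ug. Qed.

Lemma termM f g : term_fun f -> term_fun g -> term_fun (fun e => f e * g e).
Proof. by case=> t rt tf [u ru ug]; exists (GRing.Mul t u) => [|e] /=; rewrite ?rt // tf ug. Qed.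

Lemma eq_term f g : f =1 g -> term_fun f -> term_fun g.
Proof. by move=> fg [t rt tf]; exists t => // e; rewrite tf. Qed.

Lemma term_sum (I : Type) (s : seq I) (h : I -> seq F -> F) :
  (forall i, term_fun (h i)) -> term_fun (fun e => \sum_(i <- s) h i e).
Proof.
move=> th; elim: s => [|i s IH]; first by apply: eq_term (term_cst 0) => e; rewrite big_nil.
by apply: eq_term (termD (th i) IH) => e; rewrite big_cons.
Qed.

Definition poly_fun P := forall i, term_fun (fun e => (P e)`_i).

Lemma eq_poly_fun P Q : P =1 Q -> poly_fun P -> poly_fun Q.
Proof. by move=> PQ tP i; apply: eq_term (tP i) => e; rewrite PQ. Qed.

Lemma poly_cst p : poly_fun (fun=> p).
Proof. by move=> i; apply: term_cst. Qed.

Lemma poly_const f : term_fun f -> poly_fun (fun e => (f e)%:P).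
Proof.
move=> tf [|i]; first by apply: eq_term tf => e; rewrite coefC.
by apply: eq_term (term_cst 0) => e; rewrite coefC.
Qed.

Lemma poly_funD P Q : poly_fun P -> poly_fun Q -> poly_fun (fun e => P e + Q e).
Proof. by move=> tP tQ i; apply: eq_term (termD (tP i) (tQ i)) => e; rewrite coefD. Qed.

Lemma poly_funM P Q : poly_fun P -> poly_fun Q -> poly_fun (fun e => P e * Q e).
Proof.
move=> tP tQ i; apply: eq_term (term_sum _ (fun j : 'I_i.+1 => termM (tP j) (tQ (i - j)%N))) => e.
by rewrite coefM.
Qed.

Lemma poly_sum (I : Type) (s : seq I) (h : I -> seq F -> {poly F}) :
  (forall i, poly_fun (h i)) -> poly_fun (fun e => \sum_(i <- s) h i e).
Proof.
move=> th; elim: s => [|i s IH]; first by apply: eq_poly_fun (poly_cst 0) => e; rewrite big_nil.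
by apply: eq_poly_fun (poly_funD (th i) IH) => e; rewrite big_cons.
Qed.

Lemma poly_prod (I : Type) (s : seq I) (h : I -> seq F -> {poly F}) :
  (forall i, poly_fun (h i)) -> poly_fun (fun e => \prod_(i <- s) h i e).
Proof.
move=> th; elim: s => [|i s IH]; first by apply: eq_poly_fun (poly_cst 1) => e; rewrite big_nil.
by apply: eq_poly_fun (poly_funM (th i) IH) => e; rewrite big_cons.
Qed.

Lemma poly_wronski k m (A : seq F -> 'M[F]_(k, k + m)) :
  (forall i j, term_fun (fun e => A e i j)) -> poly_fun (fun e => wronski (A e)).
Proof.
move=> tA; apply: poly_sum => s; apply: poly_funM; first exact: poly_cst.
apply: poly_prod => i; case: (splitP i) => r ir.
  apply: eq_poly_fun (poly_const (tA r (s i))) => e.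
  by rewrite (_ : i = lshift m r) ?col_mxEu ?mxE //; apply: val_inj.
apply: eq_poly_fun (poly_cst (oscp F k m r (s i))) => e.
by rewrite {2}(_ : i = rshift k r) ?col_mxEd //; apply: val_inj.
Qed.

Lemma poly_dwronski k m (A B H : seq F -> 'M[F]_(k, k + m)) :
  (forall i j, term_fun (fun e => A e i j)) -> (forall i j, term_fun (fun e => B e i j)) ->
  (forall i j, term_fun (fun e => H e i j)) -> poly_fun (fun e => dwronski (A e) (B e) (H e)).
Proof.
move=> tA tB tH; apply: poly_sum => i; apply: poly_wronski => r c.
apply: (@eq_term (fun e => if (r < i)%N then A e r c else if r == i then H e r c else B e r c)).
  by move=> e; rewrite mxE.
by case: (r < i)%N => //; case: (r == i).
Qed.

Definition definable S := exists2 f : GRing.formula F, GRing.rformula f & forall e, GRing.holds e f <-> S e.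

Lemma eq_definable S S' : (forall e, S e <-> S' e) -> definable S -> definable S'.
Proof. by move=> SS' [f rf fS]; exists f => // e; rewrite fS. Qed.

Lemma definable_eq0 f : term_fun f -> definable (fun e => f e = 0).
Proof.
case=> t rt tf; exists (GRing.Equal t (GRing.Const 0)) => /= [|e]; first by rewrite rt.
by rewrite tf.
Qed.

Lemma definable_and S S' : definable S -> definable S' -> definable (fun e => S e /\ S' e).
Proof.
case=> f rf fS [g rg gS]; exists (GRing.And f g) => /= [|e]; first by rewrite rf.
by rewrite fS gS.
Qed.

Lemma definable_not S : definable S -> definable (fun e => ~ S e).
Proof. by case=> f rf fS; exists (GRing.Not f) => //= e; rewrite fS. Qed.

Lemma definable_forall n (S : nat -> seq F -> Prop) :
  (forall i, definable (S i)) -> definable (fun e => forall i, (i < n)%N -> S i e).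
Proof.
move=> dS; elim: n => [|n IH]; first by exists (GRing.Bool true).
apply: eq_definable (definable_and IH (dS n)) => e; split.
  by move=> [h1 h2] i; rewrite ltnS leq_eqVlt => /orP[/eqP->|/h1].
by move=> h; split=> [i lt_i|]; apply: h => //; apply: ltnW.
Qed.

(** The uniform degree bound makes the polynomial identity a finite conjunction of equations. *)
Lemma definable_poly_eq0 n P : poly_fun P -> (forall e, size (P e) <= n)%N ->
  definable (fun e => P e = 0).
Proof.
move=> tP szP; apply: eq_definable (definable_forall n (fun i => definable_eq0 (tP i))) => e.
split=> [h|-> i _]; last by rewrite coef0.
apply/polyP => i; rewrite coef0; have [/h//|le_n] := ltnP i n.
by rewrite nth_default // (leq_trans (szP e)).
Qed.

Lemma term_poly (t : GRing.term F) : GRing.rterm t ->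
  exists p : {poly F}, forall x, GRing.eval [:: x] t = p.[x].
Proof.
elim: t => //=.
- move=> [|n] _; first by exists 'X => x; rewrite hornerX.
  by exists 0 => x; rewrite horner0; case: n.
- by move=> a _; exists a%:P => x; rewrite hornerC.
- by move=> n _; exists n%:R%:P => x; rewrite hornerC.
- by move=> t IHt u IHu /andP[/IHt[p tp] /IHu[q uq]]; exists (p + q) => x; rewrite tp uq hornerD.
- by move=> t IHt /IHt[p tp]; exists (- p) => x; rewrite tp hornerN.
- by move=> t IHt n /IHt[p tp]; exists (p *+ n) => x; rewrite tp hornerMn.
- by move=> t IHt u IHu /andP[/IHt[p tp] /IHu[q uq]]; exists (p * q) => x; rewrite tp uq hornerM.
- by move=> t IHt n /IHt[p tp]; exists (p ^+ n) => x; rewrite tp horner_exp.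
Qed.

(** In one variable an equation between terms either holds identically or fails off the roots of a
    nonzero polynomial; connectives multiply these exceptional polynomials. *)
Lemma qf_generic (f : GRing.formula F) : GRing.qf_form f && GRing.rformula f ->
  exists p : {poly F}, exists b : bool, p != 0 /\
    forall x, p.[x] != 0 -> GRing.qf_eval [:: x] f = b.
Proof.
elim: f => //=.
- by move=> b _; exists 1, b; split; first exact: oner_neq0.
- move=> t u /andP[rt ru]; have [p tp] := term_poly rt; have [q uq] := term_poly ru.
  have [pq|pq] := eqVneq p q.
    by exists 1, true; split=> [|x _]; rewrite ?oner_neq0 // tp uq pq eqxx.
  exists (p - q), false; split=> [|x]; first by rewrite subr_eq0.
  by rewrite hornerD hornerN subr_eq0 -tp -uq => /negPf.
- move=> f IHf g IHg /andP[/andP[qf qg] /andP[rf rg]].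
  have [p [b [p0 pP]]] := IHf (introT andP (conj qf rf)).
  have [q [c [q0 qP]]] := IHg (introT andP (conj qg rg)).
  exists (p * q), (b && c); split=> [|x]; first exact: mulf_neq0.
  by rewrite hornerM mulf_eq0 negb_or => /andP[/pP-> /qP->].
- move=> f IHf g IHg /andP[/andP[qf qg] /andP[rf rg]].
  have [p [b [p0 pP]]] := IHf (introT andP (conj qf rf)).
  have [q [c [q0 qP]]] := IHg (introT andP (conj qg rg)).
  exists (p * q), (b || c); split=> [|x]; first exact: mulf_neq0.
  by rewrite hornerM mulf_eq0 negb_or => /andP[/pP-> /qP->].
- move=> f IHf g IHg /andP[/andP[qf qg] /andP[rf rg]].
  have [p [b [p0 pP]]] := IHf (introT andP (conj qf rf)).
  have [q [c [q0 qP]]] := IHg (introT andP (conj qg rg)).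
  exists (p * q), (b ==> c); split=> [|x]; first exact: mulf_neq0.
  by rewrite hornerM mulf_eq0 negb_or => /andP[/pP-> /qP->].
- move=> f IHf /IHf[p [b [p0 pP]]].
  by exists p, (~~ b); split=> // x /pP->.
Qed.

(* By quantifier elimination, the values of one coordinate on a definable set
   form a finite or a cofinite set. *)
Lemma definable_generic n (S : (nat -> F) -> Prop) :
  (forall v v', (forall i, (i <= n)%N -> v i = v' i) -> S v -> S v') ->
  definable (fun e => S (nth 0 e)) ->
  exists p : {poly F}, exists b : bool, p != 0 /\
    forall x, p.[x] != 0 -> ((exists2 v, v 0%N = x & S v) <-> b).
Proof.
(* Variable 0 stays free, and the variables 1 to [n] are quantified. *)
move=> S_dep [f rf fS]; pose g := foldr GRing.Exists f (iota 1 n).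
have rg : GRing.rformula g by rewrite /g; elim: (iota 1 n).
pose F_closed := @solve_monicpoly F.
have wf := @ClosedFieldQE.wf_ex_elim F.
have ok := @ClosedFieldQE.holds_ex_elim F F_closed.
have [p [b [p0 pP]]] := qf_generic (GRing.quantifier_elim_wf wf rg).
exists p, b; split=> // x /pP <-.
have holdsP := GRing.quantifier_elim_rformP wf ok [:: x] rg.
split=> [[v vx Sv]|/holdsP/GRing.foldExistsP[e e0 /fS Se]].
  apply/holdsP/GRing.foldExistsP; exists (mkseq v n.+1) => [i|].
    rewrite inE /= mem_iota; case: i => [|i]; first by rewrite nth_mkseq.
    rewrite /= add1n ltnS -leqNgt => le_n; by rewrite !nth_default // size_map size_iota.
  by apply/fS; apply: S_dep Sv => i le_in; rewrite nth_mkseq.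
exists (nth 0 e) => //; rewrite -(e0 0%N) //.
by rewrite inE /= mem_iota.
Qed.
End Definable.

(** * Limits along an ultrafilter *)

Section Ultra.
Variables (U : set_system nat) (UU : UltraFilter U).

Lemma ultra_not (P : nat -> Prop) : ~ U P -> U (fun q => ~ P q).
Proof. by move=> nP; have [//|] := in_ultra_setVsetC P UU. Qed.

Lemma ultra_ex (P : nat -> Prop) : U P -> exists q, P q.
Proof. exact: filter_ex. Qed.

Lemma ultra_absurd (P : nat -> Prop) : U P -> U (fun q => ~ P q) -> False.
Proof. by move=> UP UnP; have [q []] := ultra_ex (filterI UP UnP). Qed.

Lemma ultra_or (P Q : nat -> Prop) : U (fun q => P q \/ Q q) -> U P \/ U Q.
Proof.
move=> UPQ; have [|/ultra_not nP] := pselect (U P); first by left.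
by right; apply: filterS (filterI UPQ nP) => q [[]].
Qed.

(** This takes the place of passing to a subsequence on which a finite choice is constant. *)
Lemma ultra_fin (I : finType) (P : I -> nat -> Prop) :
  U (fun q => exists i, P i q) -> exists i, U (P i).
Proof.
move=> UP; apply: contrapT => nP.
have : U (fun q => forall i, i \in enum I -> ~ P i q).
  elim: (enum I) => [|i s IH]; first exact: filterE.
  have /ultra_not ni : ~ U (P i) by move=> UPi; apply: nP; exists i.
  by apply: filterS (filterI ni IH) => q [nPi nPs] j; rewrite inE => /orP[/eqP->|/nPs].
move=> nall; have [q [[i Pi] /(_ i)]] := ultra_ex (filterI UP nall).
by rewrite mem_enum => /(_ isT).
Qed.

Lemma ultra_all (I : finType) (P : I -> nat -> Prop) :
  (forall i, U (P i)) -> U (fun q => forall i, P i q).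
Proof.
move=> UP; apply: contrapT => /ultra_not nP.
have [i UnP] : exists i, U (fun q => ~ P i q).
  by apply: ultra_fin; apply: filterS nP => q /existsNP.
exact: ultra_absurd (UP i) UnP.
Qed.

Section Cv.
Variable R : realType.
Local Notation C := R[i].
Implicit Types (u v : nat -> C) (l a b : C).

(** In the order of [R[i]], [0 < e] makes [e] a positive real. *)
Definition ucv u l := forall e : C, 0 < e -> U (fun q => `|u q - l| < e).

Lemma ucv_cst a : ucv (fun=> a) a.
Proof. by move=> e e0; apply: filterE => q; rewrite subrr normr0. Qed.

Lemma ucv_eqU u v l : U (fun q => u q = v q) -> ucv u l -> ucv v l.
Proof. by move=> uv ul e /ul; apply: filterS2 uv => q ->. Qed.

Lemma ucvD u v a b : ucv u a -> ucv v b -> ucv (fun q => u q + v q) (a + b).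
Proof.
move=> ua vb e e0; have e2 : 0 < e / 2%:R by rewrite divr_gt0.
apply: filterS2 (ua _ e2) (vb _ e2) => q uq vq.
rewrite opprD addrACA (le_lt_trans (ler_normD _ _)) //.
by rewrite -[X in _ < X](divfK (_ : 2%:R != 0)) ?pnatr_eq0 // mulr_natr mulr2n ltrD.
Qed.

Lemma ucv_bounded u a : ucv u a -> U (fun q => `|u q| < `|a| + 1).
Proof.
move=> ua; apply: filterS (ua 1 ltr01) => q uq.
by rewrite -[u q](subrK a) addrC (le_lt_trans (ler_normD _ _)) // ltrD2l.
Qed.

Lemma ucv0M u v (B : C) : 0 < B -> ucv u 0 -> U (fun q => `|v q| <= B) ->
  ucv (fun q => u q * v q) 0.
Proof.
move=> B0 u0 vB e e0; apply: filterS2 (u0 _ (divr_gt0 e0 B0)) vB => q.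
rewrite !subr0 normrM ltr_pdivlMr // => uq vq.
by rewrite (le_lt_trans _ uq) // ler_wpM2l.
Qed.

Lemma ucv_squeeze0 u v : (forall q, 0 <= v q) -> (forall q, v q <= u q) -> ucv u 0 -> ucv v 0.
Proof.
move=> v0 vu u0 e /u0; apply: filterS => q; rewrite !subr0 (ger0_norm (v0 q)).
by rewrite ger0_norm ?(le_trans (v0 q)) //; apply: le_lt_trans.
Qed.

Lemma ucvN u a : ucv u a -> ucv (fun q => - u q) (- a).
Proof. by move=> ua e /ua; apply: filterS => q; rewrite -opprD normrN. Qed.

Lemma ucv_sub0 u a : ucv u a -> ucv (fun q => u q - a) 0.
Proof. by move=> ua e /ua; apply: filterS => q; rewrite subr0. Qed.

Lemma sub0_ucv u a : ucv (fun q => u q - a) 0 -> ucv u a.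
Proof. by move=> ua e /ua; apply: filterS => q; rewrite subr0. Qed.

Lemma ucvM u v a b : ucv u a -> ucv v b -> ucv (fun q => u q * v q) (a * b).
Proof.
move=> ua vb; apply: sub0_ucv.
have B0 (c : C) : 0 < `|c| + 1 by rewrite ltr_wpDl.
have vB : U (fun q => `|v q| <= `|b| + 1) by apply: filterS (ucv_bounded vb) => q /ltW.
have aB : U (fun _ => `|a| <= `|a| + 1) by apply: filterE => _; rewrite lerDl.
have h1 := ucv0M (B0 b) (ucv_sub0 ua) vB.
have h2 := ucv0M (B0 a) (ucv_sub0 vb) aB.
have := ucvD h1 h2; rewrite addr0; apply: ucv_eqU; apply: filterE => q; ring.
Qed.

Lemma ucvB u v a b : ucv u a -> ucv v b -> ucv (fun q => u q - v q) (a - b).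
Proof. by move=> ua /ucvN; apply: ucvD. Qed.

Lemma ucv_uniq u a b : ucv u a -> ucv u b -> a = b.
Proof.
move=> ua ub; apply/eqP; rewrite -subr_eq0 -normr_eq0; apply: contraT => ab.
have e0 : 0 < `|a - b| / 2%:R by rewrite divr_gt0 // lt_def ab normr_ge0.
have [q [qa qb]] := ultra_ex (filterI (ua _ e0) (ub _ e0)).
have : `|a - b| < `|a - b|.
  rewrite -[X in _ < X](divfK (_ : 2%:R != 0)) ?pnatr_eq0 // mulr_natr mulr2n.
  have {1}-> : a - b = - (u q - a) + (u q - b) by ring.
  by rewrite (le_lt_trans (ler_normD _ _)) // normrN ltrD.
by rewrite ltxx.
Qed.

Lemma ucv_le u a (B : C) : ucv u a -> U (fun q => `|u q| <= B) -> `|a| <= B.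
Proof.
move=> ua uB; have [q0 B0] := ultra_ex uB.
have Br : B \is Num.real by rewrite ger0_real // (le_trans _ B0).
rewrite real_leNgt ?normr_real //; apply/negP => lt_B.
have e0 : 0 < `|a| - B by rewrite subr_gt0.
have [q [qB qa]] := ultra_ex (filterI uB (ua _ e0)).
suff : `|a| < `|a| by rewrite ltxx.
rewrite -[X in _ < X](subrK B) -{1}[a](subrK (u q)) (le_lt_trans (ler_normD _ _)) //.
by rewrite ltr_leD // distrC.
Qed.

Lemma ucv_conj u a : ucv u a -> ucv (fun q => conjc (u q)) (conjc a).
Proof. by move=> ua e /ua; apply: filterS => q; rewrite -rmorphB /= normcJ. Qed.

Lemma ucv_sum (I : finType) (f : I -> nat -> C) (l : I -> C) :
  (forall i, ucv (f i) (l i)) -> ucv (fun q => \sum_i f i q) (\sum_i l i).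
Proof.
move=> fl; elim: (index_enum I) => [|i s IH].
  by rewrite big_nil; apply: ucv_eqU (ucv_cst 0); apply: filterE => q; rewrite big_nil.
rewrite big_cons; apply: ucv_eqU (ucvD (fl i) IH).
by apply: filterE => q; rewrite big_cons.
Qed.

Lemma ucv_prod (I : finType) (f : I -> nat -> C) (l : I -> C) :
  (forall i, ucv (f i) (l i)) -> ucv (fun q => \prod_i f i q) (\prod_i l i).
Proof.
move=> fl; elim: (index_enum I) => [|i s IH].
  by rewrite big_nil; apply: ucv_eqU (ucv_cst 1); apply: filterE => q; rewrite big_nil.
rewrite big_cons; apply: ucv_eqU (ucvM (fl i) IH).
by apply: filterE => q; rewrite big_cons.
Qed.

Lemma ucv_neq0 u a : ucv u a -> a != 0 -> U (fun q => u q != 0).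
Proof.
move=> ua a0; have e0 : 0 < `|a| by rewrite normr_gt0.
apply: filterS (ua _ e0) => q; apply: contraTneq => ->.
by rewrite sub0r normrN ltxx.
Qed.

Lemma ucvV u a : ucv u a -> a != 0 -> ucv (fun q => (u q)^-1) a^-1.
Proof.
move=> ua a0; apply: sub0_ucv.
have e0 : 0 < `|a| / 2%:R by rewrite divr_gt0 ?normr_gt0.
have bnd : U (fun q => `|- ((u q)^-1 * a^-1)| <= 2%:R / (`|a| * `|a|)).
  apply: filterS (filterI (ua _ e0) (ucv_neq0 ua a0)) => q [uq u0].
  rewrite normrN normrM !normfV invfM mulrA ler_pM2r ?invr_gt0 ?normr_gt0 //.
  rewrite -[X in X <= _]mul1r ler_pdivrMr ?normr_gt0 // mulrAC ler_pdivlMr ?normr_gt0 // mul1r.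
  have : `|a| - `|u q| < `|a| / 2%:R.
    by rewrite (le_lt_trans _ uq) // distrC lerB_dist.
  rewrite ltrBlDr -ltrBlDl => /ltW; rewrite -[X in X - _](divfK (_ : 2%:R != 0)) ?pnatr_eq0 //.
  by rewrite mulr_natr mulr2n addrK ler_pdivrMr // mulrC.
have B0 : 0 < 2%:R / (`|a| * `|a|) :> C by rewrite divr_gt0 // mulr_gt0 ?normr_gt0.
apply: ucv_eqU (ucv0M B0 (ucv_sub0 ua) bnd).
apply: filterS (ucv_neq0 ua a0) => q u0; field; by rewrite u0 a0.
Qed.

(** The limit is the supremum of the numbers that lie below [x q] for [U]-almost all [q]. *)
Lemma ultra_real_lim (x : nat -> R) (B : R) : U (fun q => `|x q| <= B) ->
  exists l : R, forall e : R, 0 < e -> U (fun q => `|x q - l| < e).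
Proof.
move=> xB; pose E : set R := fun y => U (fun q => y <= x q).
have hsE : has_sup E.
  split; first by exists (- B); apply: filterS xB => q; rewrite ler_norml => /andP[].
  exists B => y Ey; have [q [yq]] := ultra_ex (filterI Ey xB).
  by rewrite ler_norml => /andP[_]; apply: le_trans.
exists (sup E) => e e0.
have U1 : U (fun q => sup E - e < x q).
  have [y Ey lty] := sup_adherent e0 hsE.
  by apply: filterS Ey => q; apply: lt_le_trans.
have U2 : U (fun q => ~ (sup E + e / 2%:R <= x q)).
  apply: ultra_not => h.
  have := sup_upper_bound hsE (h : E (sup E + e / 2%:R)).
  by rewrite leNgt => /negP; apply; rewrite ltrDl divr_gt0.
apply: filterS2 U1 U2 => q lt1 /negP; rewrite -ltNge => lt2.
rewrite ltr_norml; apply/andP; split; first by rewrite ltrBrDl.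
by rewrite ltrBlDl (lt_trans lt2) // ltrD2l ltr_pdivrMr // ltr_pMr // (ltr_nat _ 1 2).
Qed.

Lemma ultra_lim u (B : C) : U (fun q => `|u q| <= B) -> exists l, ucv u l.
Proof.
move=> uB; have [q0 B0] := ultra_ex uB.
have BE : B = (complex.Re B)%:C%C by rewrite RRe_real // ger0_real // (le_trans _ B0).
have reB : U (fun q => `|complex.Re (u q)| <= complex.Re B).
  apply: filterS uB => q; rewrite BE -lecR; apply: le_trans; exact: normc_ge_Re.
have imB : U (fun q => `|complex.Im (u q)| <= complex.Re B).
  apply: filterS uB => q; rewrite BE -lecR; apply: le_trans.
  have := normc_ge_Re (u q * 'i%C); rewrite ReiNIm normrN normrM.
  by rewrite (_ : `|'i%C| = 1 :> C) ?mulr1 // normc_def /= expr0n expr1n /= add0r sqrtr1.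
have [a ha] := ultra_real_lim reB; have [b hb] := ultra_real_lim imB.
exists (a +i* b)%C => e e0.
have eE : e = (complex.Re e)%:C%C by rewrite RRe_real // ger0_real // ltW.
have e20 : 0 < complex.Re e / 2%:R by rewrite divr_gt0 // -ltcR -eE.
apply: filterS2 (ha _ e20) (hb _ e20) => q qa qb.
have -> : u q - (a +i* b)%C = (complex.Re (u q) - a)%:C%C + 'i%C * (complex.Im (u q) - b)%:C%C.
  by rewrite [u q in LHS]complexE [(a +i* b)%C]complexE /= !rmorphB /=; ring.
rewrite (le_lt_trans (ler_normD _ _)) // normrM.
rewrite (_ : `|'i%C| = 1 :> C); last by rewrite normc_def /= expr0n expr1n /= add0r sqrtr1.
rewrite mul1r !normc_def /= !expr0n /= !addr0 !sqrtr_sqr -rmorphD eE ltcR.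
by rewrite [X in _ < X](splitr (complex.Re e)) ltrD.
Qed.

Definition mcv p q (A : nat -> 'M[C]_(p, q)) (L : 'M[C]_(p, q)) :=
  forall i j, ucv (fun x => A x i j) (L i j).

Definition pcv (P : nat -> {poly C}) (p : {poly C}) := forall i, ucv (fun x => (P x)`_i) p`_i.

Lemma pcv_eqU P Q p : U (fun q => P q = Q q) -> pcv P p -> pcv Q p.
Proof. by move=> PQ Pp i; apply: ucv_eqU (Pp i); apply: filterS PQ => q ->. Qed.

Lemma pcv_uniq P p q : pcv P p -> pcv P q -> p = q.
Proof. by move=> Pp Pq; apply/polyP => i; apply: ucv_uniq (Pp i) (Pq i). Qed.

Lemma pcv_cst p : pcv (fun=> p) p.
Proof. by move=> i; apply: ucv_cst. Qed.

Lemma pcvC u a : ucv u a -> pcv (fun q => (u q)%:P) a%:P.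
Proof.
move=> ua i; rewrite coefC; have [->|i0] := eqVneq i 0%N.
  by apply: ucv_eqU ua; apply: filterE => q; rewrite coefC.
by apply: ucv_eqU (ucv_cst 0); apply: filterE => q; rewrite coefC (negPf i0).
Qed.

Lemma pcvD P Q p q : pcv P p -> pcv Q q -> pcv (fun x => P x + Q x) (p + q).
Proof.
by move=> Pp Qq i; rewrite coefD; apply: ucv_eqU (ucvD (Pp i) (Qq i)); apply: filterE => x; rewrite coefD.
Qed.

Lemma pcvM P Q p q : pcv P p -> pcv Q q -> pcv (fun x => P x * Q x) (p * q).
Proof.
move=> Pp Qq i; rewrite coefM.
apply: (ucv_eqU (u := fun x => \sum_(j < i.+1) (P x)`_j * (Q x)`_(i - j))).
  by apply: filterE => x; rewrite coefM.
by apply: ucv_sum => j; apply: ucvM.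
Qed.

Lemma pcv_sum (I : finType) (f : I -> nat -> {poly C}) (l : I -> {poly C}) :
  (forall i, pcv (f i) (l i)) -> pcv (fun q => \sum_i f i q) (\sum_i l i).
Proof.
move=> fl; elim: (index_enum I) => [|i s IH].
  by rewrite big_nil; apply: pcv_eqU (pcv_cst 0); apply: filterE => q; rewrite big_nil.
rewrite big_cons; apply: pcv_eqU (pcvD (fl i) IH).
by apply: filterE => q; rewrite big_cons.
Qed.

Lemma pcv_prod (I : finType) (f : I -> nat -> {poly C}) (l : I -> {poly C}) :
  (forall i, pcv (f i) (l i)) -> pcv (fun q => \prod_i f i q) (\prod_i l i).
Proof.
move=> fl; elim: (index_enum I) => [|i s IH].
  by rewrite big_nil; apply: pcv_eqU (pcv_cst 1); apply: filterE => q; rewrite big_nil.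
rewrite big_cons; apply: pcv_eqU (pcvM (fl i) IH).
by apply: filterE => q; rewrite big_cons.
Qed.

Lemma ucv_det n (A : nat -> 'M[C]_n) L : mcv A L -> ucv (fun q => \det (A q)) (\det L).
Proof.
move=> AL; apply: ucv_sum => s; apply: ucvM; first exact: ucv_cst.
by apply: ucv_prod => i; apply: AL.
Qed.

Lemma pcv_det n (A : nat -> 'M[{poly C}]_n) (L : 'M[{poly C}]_n) :
  (forall i j, pcv (fun x => A x i j) (L i j)) -> pcv (fun q => \det (A q)) (\det L).
Proof.
move=> AL; apply: pcv_sum => s; apply: pcvM; first exact: pcv_cst.
by apply: pcv_prod => i; apply: AL.
Qed.

Lemma mcv_eqU p q (A B : nat -> 'M[C]_(p, q)) L : U (fun x => A x = B x) -> mcv A L -> mcv B L.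
Proof. by move=> AB AL i j; apply: ucv_eqU (AL i j); apply: filterS AB => x ->. Qed.

Lemma mcv_cst p q (A : 'M[C]_(p, q)) : mcv (fun=> A) A.
Proof. by move=> i j; apply: ucv_cst. Qed.

Lemma mcv_uniq p q (A : nat -> 'M[C]_(p, q)) L L' : mcv A L -> mcv A L' -> L = L'.
Proof. by move=> AL AL'; apply/matrixP => i j; apply: ucv_uniq (AL i j) (AL' i j). Qed.

Lemma mcvD p q (A B : nat -> 'M[C]_(p, q)) L L' :
  mcv A L -> mcv B L' -> mcv (fun x => A x + B x) (L + L').
Proof.
by move=> AL BL i j; rewrite mxE; apply: ucv_eqU (ucvD (AL i j) (BL i j)); apply: filterE => x; rewrite mxE.
Qed.

Lemma mcvZ p q (u : nat -> C) a (A : nat -> 'M[C]_(p, q)) L :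
  ucv u a -> mcv A L -> mcv (fun x => u x *: A x) (a *: L).
Proof.
by move=> ua AL i j; rewrite mxE; apply: ucv_eqU (ucvM ua (AL i j)); apply: filterE => x; rewrite mxE.
Qed.

Lemma mcvM p q r (A : nat -> 'M[C]_(p, q)) (B : nat -> 'M[C]_(q, r)) L L' :
  mcv A L -> mcv B L' -> mcv (fun x => A x *m B x) (L *m L').
Proof.
move=> AL BL i j; rewrite mxE.
apply: (ucv_eqU (u := fun x => \sum_l A x i l * B x l j)); first by apply: filterE => x; rewrite mxE.
by apply: ucv_sum => l; apply: ucvM.
Qed.

Lemma mcv_colsub p q r (s : 'I_r -> 'I_q) (A : nat -> 'M[C]_(p, q)) L :
  mcv A L -> mcv (fun x => colsub s (A x)) (colsub s L).
Proof.
by move=> AL i j; rewrite mxE; apply: ucv_eqU (AL i (s j)); apply: filterE => x; rewrite mxE.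
Qed.

Lemma mcv_conj p q (A : nat -> 'M[C]_(p, q)) L :
  mcv A L -> mcv (fun x => map_mx (@conjc R) (A x)) (map_mx (@conjc R) L).
Proof.
by move=> AL i j; rewrite mxE; apply: ucv_eqU (ucv_conj (AL i j)); apply: filterE => x; rewrite mxE.
Qed.

Lemma mcv_inv n (A : nat -> 'M[C]_n) L : mcv A L -> \det L != 0 ->
  mcv (fun x => invmx (A x)) (invmx L).
Proof.
move=> AL L0.
have UA : U (fun x => \det (A x) != 0) := ucv_neq0 (ucv_det AL) L0.
have adjcv : mcv (fun x => \adj (A x)) (\adj L).
  move=> i j; rewrite mxE; apply: (ucv_eqU (u := fun x => cofactor (A x) j i)).
    by apply: filterE => x; rewrite mxE.
  apply: ucvM; first exact: ucv_cst.
  apply: ucv_det => r c; rewrite !mxE; apply: ucv_eqU (AL _ _).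
  by apply: filterE => x; rewrite !mxE.
have := mcvZ (ucvV (ucv_det AL) L0) adjcv.
rewrite {2}/invmx unitmxE unitfE L0 => h; apply: mcv_eqU h.
by apply: filterS UA => x x0; rewrite /invmx unitmxE unitfE x0.
Qed.

Lemma mcv_bounded p q (A : nat -> 'M[C]_(p, q)) (B : C) :
  U (fun x => forall i j, `|A x i j| <= B) -> exists L, mcv A L.
Proof.
move=> AB; have h i j : exists l, ucv (fun x => A x i j) l.
  by apply: (ultra_lim (B := B)); apply: filterS AB => x.
have [f fP] := choice (fun ij : 'I_p * 'I_q => h ij.1 ij.2).
by exists (\matrix_(i, j) f (i, j)) => i j; rewrite mxE; apply: (fP (i, j)).
Qed.

Lemma mcv_mix p q (i : 'I_p) (A H B : nat -> 'M[C]_(p, q)) A' H' B' :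
  mcv A A' -> mcv H H' -> mcv B B' -> mcv (fun x => mix i (A x) (H x) (B x)) (mix i A' H' B').
Proof.
move=> AA HH BB r c; rewrite mxE.
apply: (ucv_eqU (u := fun x => if (r < i)%N then A x r c else if r == i then H x r c else B x r c)).
  by apply: filterE => x; rewrite mxE.
by case: ifP => // _; case: ifP.
Qed.

Lemma pcv_wronski k m (A : nat -> 'M[C]_(k, k + m)) L : mcv A L -> pcv (fun x => wronski (A x)) (wronski L).
Proof.
move=> AL; apply: pcv_det => i j.
apply: (pcv_eqU (P := fun x => match split i with inl r => (A x r j)%:P | inr r => oscp C k m r j end)).
  by apply: filterE => x; rewrite [RHS]mxE; case: (split i) => r //; rewrite [RHS]mxE.
rewrite mxE; case: (split i) => r; first by rewrite mxE; apply: pcvC.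
exact: pcv_cst.
Qed.

Lemma pcv_dwronski k m (A B H : nat -> 'M[C]_(k, k + m)) A' B' H' :
  mcv A A' -> mcv B B' -> mcv H H' -> pcv (fun x => dwronski (A x) (B x) (H x)) (dwronski A' B' H').
Proof. by move=> AA BB HH; apply: pcv_sum => i; apply/pcv_wronski/mcv_mix. Qed.

End Cv.
End Ultra.

(** * A fibre of the Wronski map that is entirely real *)

Section Tangent.
Variables (F : numFieldType) (k m : nat).
Implicit Types (M X : 'M[F]_(k, k + m)) (d : 'I_k -> 'I_(k + m)).

(* Tangent directions at [M] to the Schubert cell with pivots [d]. *)
Definition tangent d X :=
  forall i (c : 'I_(k + m)), (c < d i)%N \/ c \in codom d -> X i c = 0.

Definition nondegenerate d M := forall X, tangent d X -> dwronski M M X = 0 -> X = 0.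

Lemma mix_diag (i : 'I_k) M X r c : mix i M X M r c = if r == i then X r c else M r c.
Proof. by rewrite mxE; case: ltngtP => [lt|lt|/val_inj->]; rewrite ?eqxx // -?val_eqE /= ?ltn_eqF ?gtn_eqF. Qed.

Lemma coef_dwronski_tangent d M X p (i : 'I_k) : echelon d M -> (p + \sum_(r < k) d r = topexp k m)%N ->
  (forall c : 'I_(k + m), (c <= d i)%N -> X i c = 0) ->
  (size (wronski (mix i M X M)) <= p.+1)%N /\ (wronski (mix i M X M))`_p = 0.
Proof.
move=> dM pE Xi; have [_ M0] := dM.
have mix0 r (c : 'I_(k + m)) : (c < d r)%N -> mix i M X M r c = 0.
  by rewrite mix_diag; case: eqP => [->|_] lt_c; [apply: Xi; rewrite ltnW | apply: M0].
split; first exact: size_wronski_le pE mix0.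
by rewrite (coef_wronski_top pE mix0) (bigD1 i) //= mix_diag eqxx Xi // !mul0r.
Qed.

(** Here [M] lies in the cell of [d'], of dimension [p], and [X] may leave it into the adjacent cell
    of [d], of dimension [p + 1]. The coefficient of degree [p + 1] isolates the transversal entry
    [X j (d j)] and kills it, as [wronski M] has degree [p]. Then the coefficient of degree [p]
    kills [nu], and what remains of [X] is tangent to the cell of [d'], where nondegeneracy
    applies. *)
Lemma degree_kernel d d' j M X (nu : F) :
  echelon d' M -> nondegenerate d' M ->
  injective d -> (forall i, i != j -> d i = d' i) -> (d j).+1 = d' j :> nat ->
  (forall i (c : 'I_(k + m)), (c < d i)%N \/ c \in codom d' -> X i c = 0) ->
  dwronski M M X = nu *: wronski M -> X = 0 /\ nu = 0.
Proof.
move=> dM nd inj_d dd' dj X0 eqL; have [d1 M0] := dM; have pE := echelon_sum dM.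
set p := (topexp k m - _)%N in pE; have Wlead := echelon_lead dM pE.
have le_dd' i : (d i <= d' i)%N.
  by have [->|/dd'->] := eqVneq i j; rewrite // -dj.
have pE1 : (p.+1 + \sum_(r < k) d r = topexp k m)%N.
  rewrite -pE (bigD1 j) // [in RHS](bigD1 j) //= -dj.
  rewrite (eq_bigr (fun r => nat_of_ord (d' r))) => [|r /dd'-> //]; lia.
have Xd' i l : X i (d' l) = 0 by apply: X0; right; apply: codom_f.
have Xle i (c : 'I_(k + m)) : i != j -> (c <= d' i)%N -> X i c = 0.
  move=> ij; rewrite leq_eqVlt => /orP[/eqP/val_inj->//|lt_c].
  by apply: X0; left; rewrite dd'.
have Wp1 : (wronski M)`_p.+1 = 0 by rewrite nth_default // (echelon_size dM).
have Xj : X j (d j) = 0.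
  have := congr1 (fun q : {poly F} => q`_p.+1) eqL.
  rewrite coefZ Wp1 mulr0 coef_sum (bigD1 j) //= big1 ?addr0 => [|i ij]; last first.
    by rewrite nth_default //; case: (coef_dwronski_tangent dM pE (Xle i ^~ ij)).
  rewrite (coef_wronski_top pE1) => [/eqP|r c lt_c].
    rewrite mulf_eq0 (negPf (omega_neq0 _ inj_d)) orbF (bigD1 j) //= mix_diag eqxx.
    rewrite big1 ?mulr1 => [/eqP//|r rj]; rewrite mix_diag (negPf rj) dd' //.
    by rewrite (echelon_entry _ _ dM) eqxx.
  rewrite mix_diag; case: eqP => _; first by apply: X0; left.
  by apply: M0; apply: leq_trans lt_c (le_dd' r).
have Xle' i (c : 'I_(k + m)) : (c <= d' i)%N -> X i c = 0.
  have [->|ij] := eqVneq i j; last exact: Xle.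
  rewrite leq_eqVlt => /orP[/eqP/val_inj->//|]; rewrite -dj ltnS leq_eqVlt => /orP[/eqP/val_inj->//|lt_c].
  by apply: X0; left.
have nu0 : nu = 0.
  have := congr1 (fun q : {poly F} => q`_p) eqL.
  rewrite coefZ Wlead coef_sum big1 => [/esym/eqP|i _].
    by rewrite mulf_eq0 (negPf (omega_neq0 _ (colsub1_inj d1))) orbF => /eqP.
  by case: (coef_dwronski_tangent dM pE (Xle' i)).
split=> //; apply: nd; last by rewrite eqL nu0 scale0r.
by move=> i c [lt_c|/codomP[l ->]]; [apply: Xle'; apply: ltnW | apply: Xd'].
Qed.

Lemma echelon_comp_perm d M (s : 'S_k) : echelon d M -> echelon (d \o s) (row_perm s M).
Proof.
move=> dM; split=> [|i c lt_c]; last by rewrite mxE; case: dM => _; apply.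
by apply/matrixP => i j; rewrite !mxE (echelon_entry _ _ dM) (inj_eq perm_inj).
Qed.

Lemma echelon_rank d M : echelon d M -> \rank M = k.
Proof.
move=> [d1 _]; apply/eqP; rewrite eqn_leq rank_leq_row.
have : \rank (colsub d M) = k by rewrite d1 mxrank1.
rewrite -[M in colsub d M]mulmx1 colsub_mulmx => rk.
by rewrite -{1}rk mxrankM_maxl.
Qed.
End Tangent.

Lemma sum_succ (I : finType) (f g : I -> nat) : (forall i, f i <= g i)%N ->
  (\sum_i g i = (\sum_i f i).+1)%N ->
  exists j, g j = (f j).+1 /\ forall i, i != j -> g i = f i.
Proof.
move=> le_fg eqS.
have [j lt_j] : exists j, (f j < g j)%N.
  apply/existsP; apply: contraT; rewrite negb_exists => /forallP h.
  have : (\sum_i g i <= \sum_i f i)%N by apply: leq_sum => i _; rewrite leqNgt.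
  by rewrite eqS ltnn.
exists j; move: eqS; rewrite (bigD1 j) // [in RHS](bigD1 j) //=.
set G := (\sum_(i | _) g i)%N; set E := (\sum_(i | _) f i)%N => eqS.
have le_EG : (E <= G)%N by apply: leq_sum.
have eqEG : E = G by apply/eqP; lia.
split; first lia.
move=> i ij; apply/eqP; rewrite eqn_leq le_fg andbT leqNgt; apply/negP => lt_i.
suff : (E < G)%N by rewrite eqEG ltnn.
rewrite /E /G (bigD1 i) // [X in (_ < X)%N](bigD1 i) //= -addSn leq_add //.
by apply: leq_sum.
Qed.

Section Normalize.
Variables (U : set_system nat) (UU : UltraFilter U) (R : realType).
Local Notation C := R[i].

Lemma ucv_norm (u : nat -> C) a : ucv U u a -> ucv U (fun q => `|u q|) `|a|.
Proof.
move=> ua e e0; apply: filterS (ua e e0) => q; apply: le_lt_trans.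
exact: ler_dist_dist.
Qed.

(** Division by the sum of the moduli keeps the vectors on a compact set that avoids the origin. *)
Lemma ultra_normalize (I : finType) (v : I -> nat -> C) : U (fun q => exists i, v i q != 0) ->
  exists (rho : nat -> C) (l : I -> C),
    [/\ U (fun q => rho q != 0), forall i, ucv U (fun q => (rho q)^-1 * v i q) (l i)
      & exists i, l i != 0].
Proof.
move=> nz; pose rho q := \sum_i `|v i q|.
have rho0 q : 0 <= rho q by apply: sumr_ge0.
have rnz : U (fun q => rho q != 0).
  apply: filterS nz => q [i vi]; rewrite psumr_eq0 //; apply/allPn; exists i; first exact: mem_index_enum.
  by rewrite normr_eq0.
have bnd i : U (fun q => `|(rho q)^-1 * v i q| <= 1).
  apply: filterS rnz => q r0; rewrite normrM normfV (ger0_norm (rho0 q)).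
  rewrite mulrC ler_pdivrMr ?lt_def ?r0 ?rho0 // mul1r /rho (bigD1 i) //= lerDl.
  exact: sumr_ge0.
have [l lP] := choice (fun i => ultra_lim UU (bnd i)).
exists rho, l; split=> //; apply/existsP; apply: contraT; rewrite negb_exists => /forallP l0.
have c1 : ucv U (fun q => \sum_i `|(rho q)^-1 * v i q|) (\sum_i `|l i|).
  by apply: ucv_sum => i; apply: ucv_norm.
have c2 : ucv U (fun q => \sum_i `|(rho q)^-1 * v i q|) 1.
  apply: ucv_eqU (ucv_cst UU 1); apply: filterS rnz => q r0.
  under eq_bigr do rewrite normrM normfV (ger0_norm (rho0 q)).
  by rewrite -mulr_sumr mulVf.
have := ucv_uniq UU c1 c2; rewrite big1 => [/esym/eqP|i _]; first by rewrite oner_eq0.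
by apply/eqP; have := l0 i; rewrite negbK normr_eq0.
Qed.

Variables k m : nat.
Implicit Types (d : 'I_k -> 'I_(k + m)).

(** The pair [(X, nu)] is normalized jointly, since [nu] has no bound in terms of [X] beforehand.
    Its limit is a nonzero solution of the linear system excluded by [degree_kernel]. *)
Lemma no_degenerate_sequence d d' j (M : 'M[C]_(k, k + m)) (a b X : nat -> 'M[C]_(k, k + m))
    (nu : nat -> C) :
  echelon d' M -> nondegenerate d' M ->
  injective d -> (forall i, i != j -> d i = d' i) -> (d j).+1 = d' j :> nat ->
  mcv U a M -> mcv U b M ->
  U (fun q => [/\ forall i (c : 'I_(k + m)), (c < d i)%N \/ c \in codom d' -> X q i c = 0,
              X q != 0 & dwronski (a q) (b q) (X q) = nu q *: wronski (b q)]) ->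
  False.
Proof.
move=> dM nd inj_d dd' dj aM bM bad.
pose v (o : option ('I_k * 'I_(k + m))) q := if o is Some ij then X q ij.1 ij.2 else nu q.
have [|rho [l [r0 lP [o lo]]]] := @ultra_normalize _ v.
  apply: filterS bad => q [_ /eqP Xq _]; apply: contrapT => h; apply: Xq.
  apply/matrixP => i c; rewrite mxE; apply/eqP; apply: contrapT => /negP nz.
  by apply: h; exists (Some (i, c)).
pose X' := \matrix_(i, c) l (Some (i, c)).
have X'cv : mcv U (fun q => (rho q)^-1 *: X q) X'.
  move=> i c; rewrite mxE; apply: ucv_eqU (lP (Some (i, c))).
  by apply: filterE => q; rewrite mxE.
have eqL : dwronski M M X' = l None *: wronski M.
  apply: (pcv_uniq UU (pcv_dwronski UU aM bM X'cv)).
  have := pcvM UU (pcvC UU (lP None)) (pcv_wronski UU bM); rewrite mul_polyC.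
  apply: pcv_eqU; apply: filterS bad => q [_ _ eqq].
  by rewrite mul_polyC dwronskiZ eqq scalerA.
have X'0 i (c : 'I_(k + m)) : (c < d i)%N \/ c \in codom d' -> X' i c = 0.
  move=> ic; apply: ucv_uniq (X'cv i c) _ => //; apply: ucv_eqU (ucv_cst UU 0).
  by apply: filterS bad => q [X0 _ _]; rewrite mxE X0 ?mulr0.
have [/matrixP Xz nuz] := degree_kernel dM nd inj_d dd' dj X'0 eqL.
by case: o lo => [[i c]|]; rewrite ?nuz ?eqxx //; have := Xz i c; rewrite !mxE => ->; rewrite eqxx.
Qed.
End Normalize.

Lemma exists_ultra : exists2 U : set_system nat, UltraFilter U & forall N, U (fun q => (N <= q)%N).
Proof.
have [U [UU sub]] := ultraFilterLemma eventually_filter.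
by exists U => // N; apply: sub; exists N.
Qed.

(** * Change of normal form between adjacent cells *)

Section PivotShift.
Variables (F : numFieldType) (k m : nat) (d d' : 'I_k -> 'I_(k + m)) (j : 'I_k).
Variable M : 'M[F]_(k, k + m).
Hypotheses (dM : echelon d M) (inj_d' : injective d').
Hypotheses (dd' : forall i, i != j -> d i = d' i) (dj : (d j).+1 = d' j :> nat).
Let T := colsub d' M.

Lemma shift_entry i l : l != j -> T i l = (i == l)%:R.
Proof. by move=> lj; rewrite mxE -dd' // (echelon_entry _ _ dM). Qed.

Lemma shift_upper i : T i j != 0 -> i != j -> (d i < d j)%N.
Proof.
rewrite mxE => nz ij; rewrite ltn_neqAle; apply/andP; split.
  by apply: contra_neq ij => /val_inj; apply: (colsub1_inj dM.1).
have : (d i <= d' j)%N by rewrite leqNgt; apply: contraNN nz => lt_c; rewrite dM.2.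
rewrite leq_eqVlt => /orP[|]; last by rewrite -dj ltnS.
by rewrite dd' // => /eqP/val_inj/inj_d' eij; rewrite eij eqxx in ij.
Qed.

Lemma shift_det : \det T = T j j.
Proof.
rewrite [RHS]mxE -(det_colsub_fupd j (d' j) dM.1); congr (\det _).
by apply/matrixP => r c; rewrite !mxE /fupd; case: eqP => [->//|/eqP/dd'->].
Qed.

(** Outside column [j] the matrix [T] is the identity, and column [j] is nonzero only in row [j] and
    in rows with an earlier pivot. Passing to the [d']-normal form therefore adds to a row only
    multiples of a row that starts later, which preserves the support conditions of the cell of
    [d]. *)
Lemma shift_support (X Y : 'M[F]_(k, k + m)) : T \in unitmx -> T *m Y = X ->
  (forall i (c : 'I_(k + m)), (c < d i)%N -> X i c = 0) ->
  forall i (c : 'I_(k + m)), (c < d i)%N -> Y i c = 0.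
Proof.
rewrite unitmxE unitfE shift_det => Tjj eqX X0.
have Yj (c : 'I_(k + m)) : (c < d j)%N -> Y j c = 0.
  move=> lt_c; have := X0 j c lt_c; rewrite -eqX mxE (bigD1 j) //= big1 => [|l lj].
    by rewrite addr0 => /eqP; rewrite mulf_eq0 (negPf Tjj) => /eqP.
  by rewrite shift_entry // eq_sym (negPf lj) mul0r.
move=> i c lt_c; have [ij|ij] := eqVneq i j; first by rewrite ij Yj // -ij.
have := X0 i c lt_c; rewrite -eqX mxE (bigD1 i) //= (bigD1 j) 1?eq_sym //= big1 => [|l /andP[li lj]].
  rewrite shift_entry // eqxx mul1r addr0.
  have [->|/shift_upper/(_ ij) lt_d] := eqVneq (T i j) 0; first by rewrite mul0r addr0.
  by rewrite Yj ?mulr0 ?addr0 // (ltn_trans lt_c).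
by rewrite shift_entry // eq_sym (negPf li) mul0r.
Qed.
End PivotShift.

Section Step.
Variables (R : realType) (k m : nat).
Local Notation C := R[i].
Local Notation cj := (map_mx (@conjc R)).
Implicit Types (d : 'I_k -> 'I_(k + m)) (t : nat -> R) (M : 'M[C]_(k, k + m)).

Definition rootpoly (p : nat) t : {poly C} := \prod_(i < p) ('X - (t i)%:C%C%:P).

Lemma rootpoly_monic p t : rootpoly p t \is monic.
Proof. exact: monic_prod_XsubC. Qed.

Lemma size_rootpoly p t : size (rootpoly p t) = p.+1.
Proof. by rewrite size_prod_XsubC [index_enum _]unlock -enumT size_enum_ord. Qed.

Lemma lead_rootpoly p t : (rootpoly p t)`_p = 1.
Proof. by have /monicP := rootpoly_monic p t; rewrite /lead_coef size_rootpoly. Qed.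

Lemma conj_rootpoly p t : map_poly (@conjc R) (rootpoly p t) = rootpoly p t.
Proof.
rewrite rmorph_prod; apply: eq_bigr => i _.
rewrite rmorphB /= map_polyX map_polyC; congr (_ - _%:P); exact: conjc_real.
Qed.

Lemma eq_rootpoly p t t' : (forall i, (i < p)%N -> t i = t' i) -> rootpoly p t = rootpoly p t'.
Proof. by move=> tt'; apply: eq_bigr => i _; rewrite tt'. Qed.

Lemma rootpolyS p t : rootpoly p.+1 t = rootpoly p t * ('X - (t p)%:C%C%:P).
Proof. by rewrite /rootpoly big_ord_recr. Qed.

(* The equation [p + \sum d = topexp] says that the cell with pivots [d] has dimension [p]. *)
Definition all_real p t := forall d, injective d -> (p + \sum_(r < k) d r = topexp k m)%N ->
  forall M, echelon d M -> wronski M = omega C d *: rootpoly p t ->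
  cj M = M /\ nondegenerate d M.

Section Ultra.
Variables (U : set_system nat) (UU : UltraFilter U).

(** Sequential compactness of the Grassmannian. The normalized minor is the same for [U]-almost all
    [q], so it is still the identity in the limit, which keeps full rank. *)
Lemma frame_limit (M : nat -> 'M[C]_(k, k + m)) : (forall q, \rank (M q) = k) ->
  exists (g : nat -> 'M[C]_k) (B : 'M[C]_(k, k + m)),
    [/\ forall q, g q \in unitmx, mcv U (fun q => g q *m M q) B & \rank B = k].
Proof.
move=> rM; have [s sP] := choice (fun q => exists_frame (rM q)).
have [g gP] := choice sP.
have [s0 s0P] : exists s0, U (fun q => s q = s0).
  by apply: ultra_fin; apply: filterE => q; exists (s q).
have [B BP] : exists B, mcv U (fun q => g q *m M q) B.
  by apply: (mcv_bounded UU (B := 1)); apply: filterE => q; case: (gP q).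
exists g, B; split=> //; first by move=> q; case: (gP q).
have B1 : colsub s0 B = 1%:M.
  apply: (mcv_uniq UU (mcv_colsub UU s0 BP)).
  apply: mcv_eqU (mcv_cst UU _); apply: filterS s0P => q sq.
  by case: (gP q) => _ <- _; rewrite sq.
apply/eqP; rewrite eqn_leq rank_leq_row -{1}(mxrank1 C k) -B1.
by rewrite -[B in colsub _ B]mulmx1 colsub_mulmx mxrankM_maxl.
Qed.
End Ultra.

(** With a maximal pivot sum every other column precedes all pivots, so the cell is a single
    coordinate subspace without tangent directions. *)
Lemma all_real0 t : all_real 0 t.
Proof.
move=> d inj_d; rewrite add0n => topE M dM _.
have M01 i c : M i c = (c == d i)%:R.
  have [->|/eqP cd] := (c =P d i); first by rewrite (echelon_entry _ _ dM) !eqxx.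
  have [/codomP[l cE]|nc] := boolP (c \in codom d).
    rewrite cE (echelon_entry _ _ dM); case: eqP => // il; by rewrite cE il eqxx in cd.
  have := max_inj_sum i inj_d topE nc.
  rewrite leq_eqVlt => /orP[/eqP/val_inj cE|/dM.2//]; by rewrite cE eqxx in cd.
split; first by apply/matrixP => i c; rewrite !mxE M01 rmorph_nat.
move=> X tX _; apply/matrixP => i c; rewrite [RHS]mxE; apply: tX.
have [|nc] := boolP (c \in codom d); [by right|left].
have := max_inj_sum i inj_d topE nc; rewrite leq_eqVlt => /orP[/eqP/val_inj cE|//].
by rewrite cE codom_f in nc.
Qed.

Lemma unit_perm n (T : 'M[C]_n) : T \in unitmx -> exists s : 'S_n, forall i, T i (s i) != 0.
Proof.
rewrite unitmxE unitfE => T0; apply: contrapT => nex; move/negP: T0; apply; apply/eqP.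
apply: big1 => s _; have [i Ti] : exists i, T i (s i) = 0.
  apply: contrapT => h; apply: nex; exists s => i; apply/negP => /eqP Ti; apply: h; by exists i.
by rewrite (bigD1 i) //= Ti mul0r mulr0.
Qed.

Lemma sub_conj_entry p n (N : 'M[C]_(p, n)) i c : (N - cj N) i c = N i c - conjc (N i c).
Proof. by rewrite !mxE. Qed.

Lemma invmx_mull (E T : 'M[C]_k) n (N : 'M[C]_(k, n)) : E *m T \in unitmx ->
  invmx (E *m T) *m (E *m N) = invmx T *m N.
Proof.
move=> ETu; have Tu : T \in unitmx by move: ETu; rewrite unitmx_mul => /andP[].
by rewrite -{1}[N](mulKVmx Tu) (mulmxA E) (mulmxA (invmx _)) mulVmx // mul1mx.
Qed.

(** * Points of a cell when one root tends to infinity *)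

Section Sequence.
Variables (U : set_system nat) (UU : UltraFilter U) (Uoo : forall N, U (fun q => (N <= q)%N)).
Variables (p : nat) (t : nat -> R) (tau : nat -> R) (d : 'I_k -> 'I_(k + m)).
Variable M : nat -> 'M[C]_(k, k + m).
Hypotheses (tau_gt : forall q, q%:R < tau q) (inj_d : injective d).
Hypotheses (pE : (p.+1 + \sum_(r < k) d r = topexp k m)%N) (dM : forall q, echelon d (M q)).
Hypothesis WM : forall q, wronski (M q) = omega C d *: (rootpoly p t * ('X - (tau q)%:C%C%:P)).

Let tau0 q : (tau q)%:C%C != 0 :> C.
Proof. by rewrite fmorph_eq0 gt_eqF // (le_lt_trans _ (tau_gt q)). Qed.

Lemma ucv_inv_tau : ucv U (fun q => (tau q)%:C%C^-1 : C) 0.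
Proof.
move=> e e0; have eE : e = (complex.Re e)%:C%C by rewrite RRe_real // ger0_real // ltW.
have re0 : 0 < complex.Re e by rewrite -ltcR -eE.
apply: filterS (Uoo (Num.truncn (complex.Re e)^-1).+1) => q le_q.
rewrite subr0 normfV normc_def /= expr0n /= addr0 sqrtr_sqr ger0_norm; last first.
  by rewrite ltW // (le_lt_trans _ (tau_gt q)).
rewrite eE -fmorphV ltcR -[X in _ < X]invrK ltf_pV2 ?posrE ?invr_gt0 //; last first.
  by rewrite (le_lt_trans _ (tau_gt q)).
rewrite (lt_trans _ (tau_gt q)) // (lt_le_trans (truncnS_gt _)) // ler_nat.
by [].
Qed.

(** As the root [tau] goes to infinity, the Wronski polynomial loses one degree, so the limit
    subspace lies in a cell of dimension [p]. Its pivots dominate those of [d] and exceed them by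
    one in total, hence a single pivot has moved by one column. *)
Lemma pivot_shift_limit : exists d' j (M' : 'M[C]_(k, k + m)),
  [/\ echelon d' M', (forall i, i != j -> d i = d' i) /\ (d j).+1 = d' j :> nat,
      (p + \sum_(r < k) d' r = topexp k m)%N /\ wronski M' = omega C d' *: rootpoly p t,
      U (fun q => colsub d' (M q) \in unitmx)
    & mcv U (fun q => invmx (colsub d' (M q)) *m M q) M'].
Proof.
have [g [B [gu gM rB]]] := frame_limit UU (fun q => echelon_rank (dM q)).
pose P := rootpoly p t.
(* The factor ['X - tau] is written as [- tau] times [1 - 'X / tau], which tends to 1; [sg] collects
   the scalars, and its limit is read off in degree [p]. *)
pose sg q := - (\det (g q) * omega C d * (tau q)%:C%C).
pose P1 q := P * (1 - ((tau q)%:C%C^-1)%:P * 'X).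
have Wg q : wronski (g q *m M q) = sg q *: P1 q.
  rewrite wronski_mulmx WM -!mul_polyC /sg /P1 -/P !polyCN !polyCM.
  have tt : (tau q)%:C%C%:P * ((tau q)%:C%C^-1)%:P = 1 :> {poly C} by rewrite -polyCM mulfV.
  rewrite (_ : 'X - _ = - (tau q)%:C%C%:P * (1 - ((tau q)%:C%C^-1)%:P * 'X)); first by ring.
  by rewrite mulrBr mulr1 !mulNr mulrA tt mul1r opprK addrC.
have P1cv : pcv U P1 P.
  rewrite -[P]mulr1 -[1 in X in pcv _ _ X]subr0 -[X in 1 - X](mul0r 'X) -[X in 1 - X * _]polyC0.
  apply: pcvM; first exact: pcv_cst.
  have h := pcvM UU (pcvC UU ucv_inv_tau) (pcv_cst UU 'X).
  have := pcvD UU (pcv_cst UU 1) (pcvM UU (pcv_cst UU (-1)) h).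
  rewrite !mulN1r; apply: pcv_eqU; apply: filterE => q; by rewrite mulN1r.
have c1 : ucv U (fun q => (P1 q)`_p) 1 by have := P1cv p; rewrite lead_rootpoly.
have WB := pcv_wronski UU gM.
have sgcv : ucv U sg (wronski B)`_p.
  have := ucvM UU (WB p) (ucvV UU c1 (oner_neq0 _)); rewrite invr1 mulr1.
  apply: ucv_eqU; apply: filterS (ucv_neq0 UU c1 (oner_neq0 _)) => q nz.
  by rewrite Wg coefZ mulfK.
have WBE : wronski B = (wronski B)`_p *: P.
  apply: (pcv_uniq UU WB); rewrite -mul_polyC.
  by apply: pcv_eqU (pcvM UU (pcvC UU sgcv) P1cv); apply: filterE => q; rewrite mul_polyC Wg.
have [d1 [h [hu dB]]] := exists_echelon rB.
have pE1 : (p + \sum_(r < k) d1 r = topexp k m)%N.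
  rewrite -(echelon_sum dB); congr (_ + _)%N; apply: succn_inj.
  rewrite -(echelon_size dB) wronski_mulmx WBE -(size_rootpoly p t) -/P -[_ *: P]mul_polyC mulrA -polyCM.
  rewrite mul_polyC size_scale //; apply: contraTneq (wronski_neq0 (echelon_rank dB)) => z.
  by rewrite wronski_mulmx WBE -mul_polyC mulrA -polyCM z mul0r eqxx.
have hgM : mcv U (fun q => h *m (g q *m M q)) (h *m B) := mcvM UU (mcv_cst UU h) gM.
have U1 : U (fun q => colsub d1 (M q) \in unitmx).
  have dcv := ucv_det UU (mcv_colsub UU d1 hgM); rewrite dB.1 det1 in dcv.
  apply: filterS (ucv_neq0 UU dcv (oner_neq0 _)) => q.
  rewrite -unitfE -unitmxE !colsub_mulmx !unitmx_mul; by case/and3P.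
(* The rows of the limit's echelon form come in no particular order. A nonzero term of the
   determinant of [M q0] in the columns [d1] matches them with the rows of [M q0], so that each new
   pivot is at least the old one. *)
have [q0 Tu0] := ultra_ex UU U1; have [s sP] := unit_perm Tu0.
pose d' := d1 \o s; pose M' := row_perm s (h *m B).
have dM' : echelon d' M' := echelon_comp_perm s dB.
have le_d i : (d i <= d' i)%N.
  by rewrite leqNgt; apply: contraNN (sP i) => lt_c; rewrite mxE (dM q0).2.
have sumd' : (\sum_(r < k) d' r = \sum_(r < k) d1 r)%N.
  by rewrite [RHS](reindex_inj (@perm_inj _ s)).
have [|j [dj dd']] := sum_succ le_d; first by apply/eqP; rewrite sumd' -(eqn_add2l p) pE1 addnS -addSn pE.
have pE' : (p + \sum_(r < k) d' r = topexp k m)%N by rewrite sumd'.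
exists d', j, M'; split=> //.
- by split=> // i /dd' /esym/val_inj.
- split=> //; have WM' : wronski M' = (\det (perm_mx s) * \det h * (wronski B)`_p) *: P.
    by rewrite /M' row_permE !wronski_mulmx {1}WBE -!mul_polyC !polyCM !mulrA.
  have := echelon_lead dM' pE'; rewrite WM' coefZ lead_rootpoly mulr1 => ->//.
- apply: filterS U1 => q; rewrite (_ : colsub d' (M q) = col_perm s (colsub d1 (M q))).
    by rewrite col_permE unitmx_mul unitmx_perm andbT.
  by apply/matrixP => r c; rewrite !mxE.
have h'gM : mcv U (fun q => perm_mx s *m (h *m (g q *m M q))) M'.
  by rewrite /M' row_permE; apply: mcvM; first exact: mcv_cst.
have d'1 := dM'.1; have d'cv := mcv_colsub UU d' h'gM; rewrite d'1 in d'cv.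
have icv := mcv_inv UU d'cv; rewrite det1 invmx1 in icv.
have := mcvM UU (icv (oner_neq0 _)) h'gM; rewrite mul1mx; apply: mcv_eqU.
have U1' : U (fun q => colsub d' (perm_mx s *m (h *m (g q *m M q))) \in unitmx).
  have dcv := ucv_det UU d'cv; rewrite det1 in dcv.
  by apply: filterS (ucv_neq0 UU dcv (oner_neq0 _)) => q; rewrite -unitfE -unitmxE.
apply: filterS U1' => q; rewrite !colsub_mulmx !mulmxA => ETu.
by rewrite -[RHS](invmx_mull _ ETu) !mulmxA.
Qed.

(** In the normal form of [d'], both [A q] and its conjugate tend to the real point [M'], and their
    Wronski polynomials are proportional because the roots are real. Their difference is then a
    solution excluded by [no_degenerate_sequence]. *)
Lemma no_nonreal_sequence : all_real p t -> U (fun q => cj (M q) <> M q) -> False.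
Proof.
move=> real_t nonreal.
have [d' [j [M' [dM' [dd' dj] [pE' WM'] Tu Acv]]]] := pivot_shift_limit.
have inj_d' := colsub1_inj dM'.1.
have [M'real nd] := real_t _ inj_d' pE' _ dM' WM'.
pose A q := invmx (colsub d' (M q)) *m M q.
have Bcv : mcv U (fun q => cj (A q)) M' by rewrite -M'real; apply: mcv_conj.
pose mu q := \det (invmx (colsub d' (M q))) * omega C d.
pose P q := rootpoly p t * ('X - (tau q)%:C%C%:P).
have WA q : wronski (A q) = mu q *: P q by rewrite wronski_mulmx WM -!mul_polyC polyCM mulrA.
have WB q : wronski (cj (A q)) = conjc (mu q) *: P q.
  rewrite map_wronski WA map_polyZ; congr (_ *: _); rewrite /P rmorphM; congr (_ * _).
    exact: conj_rootpoly.
  by rewrite rmorphB /= map_polyX map_polyC; congr (_ - _%:P); apply: conjc_real.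
apply: (no_degenerate_sequence UU dM' nd inj_d dd' dj Acv Bcv
  (X := fun q => A q - cj (A q)) (nu := fun q => (mu q - conjc (mu q)) / conjc (mu q))).
apply: filterS2 nonreal Tu => q nr Tq; split.
- have AE : colsub d' (A q) = 1%:M by rewrite colsub_mulmx mulVmx.
  have A0 : forall i (c : 'I_(k + m)), (c < d i)%N -> A q i c = 0.
    exact: (shift_support (dM q) inj_d' dd' dj (Y := A q) Tq (mulKVmx Tq (M q)) (dM q).2).
  move=> i c [lt_c|/codomP[l ->]]; rewrite sub_conj_entry; first by rewrite A0 // conjc0 subr0.
  move/matrixP/(_ i l): AE; rewrite mxE => ->; by rewrite mxE conjc_nat subrr.
(* The [d]-columns of [A q] form the inverse of the change of basis; if [A q] is real, so are that
   matrix and [M q]. *)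
- rewrite subr_eq0; apply/eqP => AA; apply: nr.
  have dA : colsub d (A q) = invmx (colsub d' (M q)) by rewrite colsub_mulmx (dM q).1 mulmx1.
  have TT : cj (colsub d' (M q)) = colsub d' (M q).
    apply: (can_inj (@invmxK _ _)); rewrite -map_invmx -dA map_mxsub -AA //.
  by rewrite -[M q](mulKVmx Tq) map_mxM TT -/(A q) -AA.
- rewrite -wronski_sub WA WB scalerA divfK ?scalerBl //.
  rewrite conjc_eq0 mulf_neq0 ?omega_neq0 // -unitfE -unitmxE unitmx_inv //.
Qed.

(** A kernel vector at [M q] is transported to [A q] and corrected by a change-of-basis direction so
    that it vanishes in the columns [d']. The correction contributes a multiple of [wronski (A q)],
    which accounts for [nu]. *)
Lemma no_degenerate_limit : all_real p t -> U (fun q => ~ nondegenerate d (M q)) -> False.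
Proof.
move=> real_t deg.
have [d' [j [M' [dM' [dd' dj] [pE' WM'] Tu Acv]]]] := pivot_shift_limit.
have inj_d' := colsub1_inj dM'.1.
have [M'real nd] := real_t _ inj_d' pE' _ dM' WM'.
have hX q : exists X : 'M[C]_(k, k + m), ~ nondegenerate d (M q) ->
    [/\ tangent d X, dwronski (M q) (M q) X = 0 & X <> 0].
  have [ndq|nnd] := pselect (nondegenerate d (M q)); first by exists 0.
  by move: (nnd) => /existsNP[X] /not_implyP[tX /not_implyP[LX X0]]; exists X.
have [X XP] := choice hX.
pose g q := invmx (colsub d' (M q)); pose A q := g q *m M q.
pose Z q := g q *m X q - colsub d' (g q *m X q) *m A q.
apply: (no_degenerate_sequence UU dM' nd inj_d dd' dj Acv Acv
  (X := Z) (nu := fun q => - \tr (colsub d' (g q *m X q)))).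
apply: filterS2 deg Tu => q /XP[tX LX X0] Tq.
have AE : colsub d' (A q) = 1%:M by rewrite colsub_mulmx mulVmx.
have A0 : forall i (c : 'I_(k + m)), (c < d i)%N -> A q i c = 0.
  exact: (shift_support (dM q) inj_d' dd' dj (Y := A q) Tq (mulKVmx Tq (M q)) (dM q).2).
have Y0 : forall i (c : 'I_(k + m)), (c < d i)%N -> (g q *m X q) i c = 0 := shift_support (dM q) inj_d' dd' dj (Y := g q *m X q) Tq (mulKVmx Tq (X q)) (fun i c lt => tX i c (or_introl lt)).
split.
- move=> i c [lt_c|/codomP[l ->]]; last first.
    have : colsub d' (Z q) = 0.
      rewrite /Z (_ : colsub d' (_ - _) = colsub d' (g q *m X q) - colsub d' (colsub d' (g q *m X q) *m A q)).
        by rewrite [X in _ - X]colsub_mulmx AE mulmx1 subrr.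
      by apply/matrixP => r s; rewrite !mxE.
    by move/matrixP/(_ i l); rewrite !mxE.
  rewrite /Z mxE Y0 // add0r mxE mxE big1 ?oppr0 // => l _.
  have [lt_cl|le_lc] := ltnP c (d l); first by rewrite [A q l c]A0 ?mulr0.
  rewrite mxE Y0 ?mul0r //.
  (* It remains to see [d' l < d i], knowing [d l < d i]. For [l = j] the pivot has moved up by one,
     and equality would contradict injectivity of [d']. *)
  have lt_li := leq_ltn_trans le_lc lt_c.
  have [lj|lj] := eqVneq l j; last by rewrite -dd'.
  rewrite lj -dj ltn_neqAle; rewrite lj in lt_li; rewrite lt_li andbT dj.
  have ij : i != j by apply: contraTneq lt_li => ->; rewrite ltnn.
  by rewrite dd' //; apply: contraNneq ij => /val_inj/inj_d'->.
- apply/eqP => Z0; apply: X0.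
  have XE : X q = colsub d' (M q) *m (colsub d' (g q *m X q)) *m g q *m M q.
    rewrite -!mulmxA -[X q in LHS](mulKVmx Tq); congr (_ *m _).
    by apply/eqP; rewrite -subr_eq0; apply/eqP.
  have : colsub d (X q) = 0.
    by apply/matrixP => i l; rewrite !mxE tX //; right; apply: codom_f.
  rewrite {1}XE colsub_mulmx (dM q).1 mulmx1 => E0.
  by rewrite XE E0 mul0mx.
- rewrite dwronskiB dwronski_mull dwronski_mulmx; last by rewrite wronski_neq0 // (echelon_rank (dM q)).
  by rewrite LX scaler0 sub0r scaleNr.
Qed.
End Sequence.

Lemma all_real_step p t : all_real p t ->
  exists2 tau, (forall i, (i < p)%N -> t i < tau) &
    all_real p.+1 (fun i => if (i < p)%N then t i else tau).
Proof.
move=> real_t; apply: contrapT => nex.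
(* [tau0] exceeds all earlier roots, and adding [q] sends the new root to infinity. *)
pose tau0 := \sum_(i < p) `|t i| + 1; pose tau (q : nat) := tau0 + q%:R.
have t_lt q i : (i < p)%N -> t i < tau q.
  move=> lt_i; rewrite /tau /tau0 -addrA (le_lt_trans (ler_norm _)) //.
  rewrite (bigD1 (Ordinal lt_i)) //= -addrA ltrDl ltr_wpDl ?sumr_ge0 //.
  by rewrite ltr_pwDl // ler0n.
have tau_gt (q : nat) : q%:R < tau q.
  by rewrite /tau ltrDr ltr_wpDl ?sumr_ge0.
pose t' q := fun i => if (i < p)%N then t i else tau q.
have rootE q : rootpoly p.+1 (t' q) = rootpoly p t * ('X - (tau q)%:C%C%:P).
  rewrite rootpolyS /t' ltnn; congr (_ * _); apply: eq_rootpoly => i lt_i; by rewrite lt_i.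
have bad q : exists dM : {ffun 'I_k -> 'I_(k + m)} * 'M[C]_(k, k + m),
    [/\ injective dM.1, (p.+1 + \sum_(r < k) dM.1 r = topexp k m)%N, echelon dM.1 dM.2,
        wronski dM.2 = omega C dM.1 *: rootpoly p.+1 (t' q)
      & cj dM.2 <> dM.2 \/ ~ nondegenerate dM.1 dM.2].
  have : ~ all_real p.+1 (t' q) by move=> h; apply: nex; exists (tau q) => // i; apply: t_lt.
  move=> /existsNP[d /not_implyP[inj_d /not_implyP[pE /existsNP[M /not_implyP[dM /not_implyP[WM nP]]]]]].
  have dE : [ffun i => d i] =1 d by move=> i; rewrite ffunE.
  have dEE : ([ffun i => d i] : _ -> _) = d by apply: funext.
  exists ([ffun i => d i], M) => /=; rewrite dEE; split=> //.
  by move: nP => /not_andP.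
have [f fP] := choice bad.
have [U UU Uoo] := exists_ultra.
have [d dP] : exists d : {ffun 'I_k -> 'I_(k + m)}, U (fun q => (f q).1 = d).
  by apply: ultra_fin; apply: filterE => q; exists (f q).1.
(* Reindexing makes the pivots equal to [d] at every index, not just almost everywhere, while the
   new root still tends to infinity. *)
have hr (N : nat) : exists q, (N <= q)%N /\ (f q).1 = d.
  exact: (ultra_ex UU (filterI (Uoo N) dP)).
have [r rP] := choice hr.
pose M q := (f (r q)).2.
have rd q : (f (r q)).1 = d by case: (rP q).
have tau_r q : q%:R < tau (r q).
  by apply: le_lt_trans (tau_gt _); rewrite ler_nat; case: (rP q).
have inj_d : injective d by case: (fP (r 0%N)); rewrite rd.
have pE : (p.+1 + \sum_(i < k) d i = topexp k m)%N by case: (fP (r 0%N)); rewrite rd.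
have dM q : echelon d (M q) by case: (fP (r q)); rewrite rd.
have WM q : wronski (M q) = omega C d *: (rootpoly p t * ('X - (tau (r q))%:C%C%:P)).
  by case: (fP (r q)); rewrite rd rootE.
have nP q : cj (M q) <> M q \/ ~ nondegenerate d (M q) by case: (fP (r q)); rewrite rd.
have [nr|nd] : U (fun q => cj (M q) <> M q) \/ U (fun q => ~ nondegenerate d (M q)).
  by apply: ultra_or; apply: filterE.
- exact: (no_nonreal_sequence UU Uoo tau_r inj_d pE dM WM real_t nr).
- exact: (no_degenerate_limit UU Uoo tau_r inj_d pE dM WM real_t nd).
Qed.

Lemma exists_all_real p :
  exists2 t, all_real p t & forall i j, (i < j)%N -> (j < p)%N -> t i < t j.
Proof.
elim: p => [|p [t real_t incr_t]]; first by exists (fun=> 0) => //; apply: all_real0.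
have [tau lt_tau real_t'] := all_real_step real_t.
exists (fun i => if (i < p)%N then t i else tau) => // i j lt_ij; rewrite ltnS => le_jp.
rewrite (leq_trans lt_ij le_jp); case: ltnP => [lt_jp|_]; first exact: incr_t.
by apply: lt_tau; apply: leq_trans le_jp.
Qed.
End Step.

(** * The Wronski map on the big cell *)

Section Chart.
Variables (R : realType) (k m : nat).
Local Notation C := R[i].
Local Notation cj := (map_mx (@conjc R)).
Implicit Types (Z H : 'M[C]_(k, m)).
Let N := (k * m)%N.

Definition chart Z : 'M[C]_(k, k + m) := row_mx 1%:M Z.
Definition wr Z : {poly C} := wronski (chart Z).
Definition dwr Z Z' H : {poly C} := dwronski (chart Z) (chart Z') (row_mx 0 H).
Definition regular Z := forall H, dwr Z Z H = 0 -> H = 0.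
Definition topcoef : C := omega C (lshift m : 'I_k -> 'I_(k + m)).

Lemma topcoef_neq0 : topcoef != 0.
Proof. exact/omega_neq0/lshift_inj. Qed.

Lemma chart_lt Z (i : 'I_k) (c : 'I_(k + m)) : (c < i)%N -> chart Z i c = 0.
Proof.
move=> lt_c; have lt_ck : (c < k)%N by apply: ltn_trans lt_c (ltn_ord i).
rewrite (_ : c = lshift m (Ordinal lt_ck)); last exact: val_inj.
by rewrite row_mxEl mxE -val_eqE /= gtn_eqF.
Qed.

Lemma echelon_chart Z : echelon (lshift m : 'I_k -> 'I_(k + m)) (chart Z).
Proof.
split=> [|i c]; last exact: chart_lt.
by apply/matrixP => i j; rewrite mxE row_mxEl.
Qed.

Lemma rank_chart Z : \rank (chart Z) = k.
Proof. exact: echelon_rank (echelon_chart Z). Qed.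

Lemma size_wr Z : size (wr Z) = N.+1.
Proof. by rewrite (echelon_size (echelon_chart Z)) -topexp_lshift addnK. Qed.

Lemma lead_wr Z : (wr Z)`_N = topcoef.
Proof. exact: echelon_lead (echelon_chart Z) (topexp_lshift k m). Qed.

Lemma wr_sub Z Z' : wr Z - wr Z' = dwr Z Z' (Z - Z').
Proof. by rewrite /wr wronski_sub /dwr; congr (dwronski _ _ _); rewrite opp_row_mx add_row_mx subrr. Qed.

(** The coefficient of degree [N] of [wr] is constant, so its differential maps the [N]-dimensional
    chart into the [N]-dimensional space of polynomials of degree less than [N]. This is why
    injectivity at a regular point gives surjectivity. *)
Lemma size_dwr Z Z' H : (size (dwr Z Z' H) <= N)%N.
Proof.
apply: (leq_trans (size_sum _ _ _)); apply/bigmax_leqP => i _.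
have mix0 r (c : 'I_(k + m)) : (c < lshift m r)%N -> mix i (chart Z) (row_mx 0 H) (chart Z') r c = 0.
  move=> lt_c; rewrite mxE; case: ifP => _; first exact: chart_lt.
  case: ifP => _; last exact: chart_lt.
  have lt_ck : (c < k)%N by apply: ltn_trans lt_c (ltn_ord r).
  by rewrite (_ : c = lshift m (Ordinal lt_ck)) ?row_mxEl ?mxE //; apply: val_inj.
have pE := topexp_lshift k m.
have := size_wronski_le (e := lshift m) pE mix0; rewrite leq_eqVlt => /orP[/eqP szE|]; last by rewrite ltnS.
have lead0 : lead_coef (wronski (mix i (chart Z) (row_mx 0 H) (chart Z'))) = 0.
  rewrite /lead_coef szE /= (coef_wronski_top (e := lshift m) pE mix0) (bigD1 i) //=.
  by rewrite mxE ltnn eqxx row_mxEl mxE !mul0r.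
by move/eqP: lead0; rewrite lead_coef_eq0 => /eqP->; rewrite size_poly0.
Qed.

Lemma dwr_lin Z Z' H1 H2 (b c : C) : dwr Z Z' (b *: H1 + c *: H2) = b *: dwr Z Z' H1 + c *: dwr Z Z' H2.
Proof.
by rewrite /dwr -dwronski_lin; congr dwronski; rewrite !scale_row_mx add_row_mx !scaler0 addr0.
Qed.

Lemma dwrZ Z Z' H (c : C) : dwr Z Z' (c *: H) = c *: dwr Z Z' H.
Proof. by rewrite -[c *: H]addr0 -[0](scale0r H) dwr_lin scale0r addr0. Qed.

Lemma conj_chart Z : cj (chart Z) = chart (cj Z).
Proof. by rewrite /chart map_row_mx map_mx1. Qed.

Lemma conj_wr Z : wr (cj Z) = map_poly (@conjc R) (wr Z).
Proof. by rewrite /wr -conj_chart map_wronski. Qed.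

Lemma regular_surj Z (v : {poly C}) : regular Z -> (size v <= N)%N -> exists H, dwr Z Z H = v.
Proof.
move=> rZ szv.
pose f (h : 'rV[C]_N) : 'rV[C]_N := poly_rV (dwr Z Z (vec_mx h)).
have f_lin : linear f.
  move=> a h1 h2; have := dwr_lin Z Z (vec_mx h1) (vec_mx h2) a 1; rewrite !scale1r => E.
  rewrite /f -linearP -E; congr (poly_rV (dwr _ _ _)); exact: linearP.
pose fL := GRing.isLinear.Build _ _ _ _ f f_lin.
pose A := lin1_mx (HB.pack f fL : {linear _ -> _}).
have fA h : h *m A = f h by rewrite mul_rV_lin1.
have Au : A \in unitmx.
  rewrite -row_free_unit -kermx_eq0; apply/eqP/row_matrixP => i; rewrite row0.
  have : row i (kermx A) *m A = 0 by rewrite -row_mul mulmx_ker row0.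
  rewrite fA /f => /(congr1 rVpoly); rewrite linear0 poly_rV_K ?size_dwr // => /rZ h0.
  by rewrite -[row i _]vec_mxK h0 linear0.
exists (vec_mx (poly_rV v *m invmx A)).
apply: (can_inj (g := fun x => x)) => //.
have := fA (poly_rV v *m invmx A); rewrite mulmxKV // /f => /(congr1 rVpoly).
by rewrite !poly_rV_K ?size_dwr.
Qed.

Section Ultra.
Variables (U : set_system nat) (UU : UltraFilter U).

Lemma mcv_chart (z : nat -> 'M[C]_(k, m)) Z : mcv U z Z -> mcv U (fun q => chart (z q)) (chart Z).
Proof.
move=> zZ i j; rewrite mxE; case E : (split j) => [c|c].
  by apply: ucv_eqU (ucv_cst UU _); apply: filterE => q; rewrite [RHS]mxE E.
by apply: ucv_eqU (zZ i c); apply: filterE => q; rewrite [RHS]mxE E.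
Qed.

Lemma mcv_row0 (z : nat -> 'M[C]_(k, m)) Z :
  mcv U z Z -> mcv U (fun q => row_mx 0 (z q) : 'M[C]_(k, k + m)) (row_mx 0 Z).
Proof.
move=> zZ i j; rewrite mxE; case E : (split j) => [c|c].
  by apply: ucv_eqU (ucv_cst UU _); apply: filterE => q; rewrite [RHS]mxE E.
by apply: ucv_eqU (zZ i c); apply: filterE => q; rewrite [RHS]mxE E.
Qed.

Lemma pcv_wr z Z : mcv U z Z -> pcv U (fun q => wr (z q)) (wr Z).
Proof. move=> zZ; exact: (pcv_wronski UU (mcv_chart zZ)). Qed.

Lemma pcv_dwr a b h A B H : mcv U a A -> mcv U b B -> mcv U h H ->
  pcv U (fun q => dwr (a q) (b q) (h q)) (dwr A B H).
Proof. by move=> aA bB hH; apply: (pcv_dwronski UU (mcv_chart aA) (mcv_chart bB) (mcv_row0 hH)). Qed.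

(* Compactness of the Grassmannian, together with the fact that [wronski] never
   vanishes identically, makes [wr] a proper map. *)
Lemma wr_proper (z : nat -> 'M[C]_(k, m)) w : pcv U (fun q => wr (z q)) w ->
  exists2 Z, mcv U z Z & wr Z = w.
Proof.
move=> zw; have [g [B [gu gB rB]]] := frame_limit UU (fun q => rank_chart (z q)).
have lE q : lsubmx (g q *m chart (z q)) = g q.
  by rewrite mul_mx_row mulmx1 row_mxKl.
have gcv : mcv U g (lsubmx B).
  move=> i j; rewrite mxE; apply: ucv_eqU (gB i (lshift m j)); apply: filterE => q.
  by rewrite -{2}(lE q) [RHS]mxE.
have WB : wronski B = (\det (lsubmx B)) *: w.
  apply: (pcv_uniq UU (pcv_wronski UU gB)); rewrite -mul_polyC.
  apply: pcv_eqU (pcvM UU (pcvC UU (ucv_det UU gcv)) zw).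
  by apply: filterE => q; rewrite wronski_mulmx.
have det0 : \det (lsubmx B) != 0.
  by apply: contraTneq (wronski_neq0 rB) => d0; rewrite WB d0 scale0r eqxx.
have zcv := mcvM UU (mcv_inv UU gcv det0) gB.
set B' := invmx _ *m B in zcv.
have zZ : mcv U z (rsubmx B').
  move=> i j; rewrite mxE; apply: ucv_eqU (zcv i (rshift k j)); apply: filterE => q.
  by rewrite mulKmx // row_mxEr.
exists (rsubmx B') => //; exact: (pcv_uniq UU (pcv_wr zZ) zw).
Qed.

Lemma singular_limit (a b h : nat -> 'M[C]_(k, m)) Z : mcv U a Z -> mcv U b Z ->
  U (fun q => h q != 0 /\ dwr (a q) (b q) (h q) = 0) -> ~ regular Z.
Proof.
move=> aZ bZ hP rZ.
pose v (ij : 'I_k * 'I_m) q := h q ij.1 ij.2.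
have [|rho [l [r0 lP [o lo]]]] := @ultra_normalize _ UU _ _ v.
  apply: filterS hP => q [/eqP hq _]; apply: contrapT => nex; apply: hq.
  apply/matrixP => i c; rewrite mxE; apply/eqP; apply: contrapT => /negP nz.
  by apply: nex; exists (i, c).
pose H := \matrix_(i, c) l (i, c).
have Hcv : mcv U (fun q => (rho q)^-1 *: h q) H.
  move=> i c; rewrite mxE; apply: ucv_eqU (lP (i, c)).
  by apply: filterE => q; rewrite mxE.
have H0 : H = 0.
  apply/rZ/(pcv_uniq UU (pcv_dwr aZ bZ Hcv)); apply: pcv_eqU (pcv_cst UU 0).
  by apply: filterS hP => q [_ h0]; rewrite dwrZ h0 scaler0.
case: o lo => i c; have /matrixP/(_ i c) := H0; rewrite !mxE => ->.
by rewrite eqxx.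
Qed.

(** If the values agree, [a q - b q] lies in the kernel of the divided difference at [(a q, b q)],
    which degenerates at [Z] only if [Z] is singular. *)
Lemma local_inj_limit (a b : nat -> 'M[C]_(k, m)) Z : mcv U a Z -> mcv U b Z -> regular Z ->
  U (fun q => wr (a q) = wr (b q)) -> U (fun q => a q = b q).
Proof.
move=> aZ bZ rZ eqw; apply: contrapT => /(ultra_not UU) ne.
apply: (singular_limit aZ bZ (h := fun q => a q - b q)) rZ.
apply: filterS2 eqw ne => q eqw /eqP ne; rewrite -wr_sub eqw subrr.
by rewrite subr_eq0.
Qed.

Lemma regular_limit (a : nat -> 'M[C]_(k, m)) Z : mcv U a Z -> regular Z -> U (fun q => regular (a q)).
Proof.
move=> aZ rZ; apply: contrapT => /(ultra_not UU) nr.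
have hex q : exists H, ~ regular (a q) -> H != 0 /\ dwr (a q) (a q) H = 0.
  have [r|nra] := pselect (regular (a q)); first by exists 0.
  by move: (nra) => /existsNP[H /not_implyP[H0 /eqP Hn]]; exists H.
have [h hP] := choice hex.
by apply: (singular_limit aZ aZ (h := h)) rZ; apply: filterS nr => q; apply: hP.
Qed.

Lemma minimizer (K : 'M[C]_(k, m) -> Prop) (f : 'M[C]_(k, m) -> C) Z0 : K Z0 ->
  (forall Z, 0 <= f Z) ->
  (forall z : nat -> 'M[C]_(k, m), (forall q, K (z q)) -> exists2 Z, mcv U z Z & K Z) ->
  (forall z Z, mcv U z Z -> ucv U (fun q => f (z q)) (f Z)) ->
  (forall N, U (fun q => (N <= q)%N)) ->
  exists2 Z, K Z & forall Z', K Z' -> f Z <= f Z'.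
Proof.
move=> K0 f0 Kcpt fcont Uoo.
pose E : set R := fun y => exists2 Z, K Z & complex.Re (f Z) = y.
have fE Z : f Z = (complex.Re (f Z))%:C%C by rewrite RRe_real // ger0_real.
have f0' Z : 0 <= complex.Re (f Z) by rewrite -ler0c -fE.
have infE : has_inf E.
  split; first by exists (complex.Re (f Z0)), Z0.
  by exists 0 => y [Z _ <-].
have seqz (q : nat) : exists Z, K Z /\ complex.Re (f Z) < inf E + q.+1%:R^-1.
  have e0 : 0 < (q.+1%:R)^-1 :> R by rewrite invr_gt0 ltr0n.
  have [y [Z KZ <-] lty] := inf_adherent e0 infE.
  by exists Z.
have [z zP] := choice seqz.
have [Z zZ KZ] := Kcpt z (fun q => proj1 (zP q)).
exists Z => // Z' KZ'; rewrite fE [f Z']fE lecR.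
have le_inf : inf E <= complex.Re (f Z') by apply: ge_inf; [case: infE|exists Z'].
apply: le_trans le_inf; rewrite leNgt; apply/negP => lt_inf.
pose d := complex.Re (f Z) - inf E; have d0 : 0 < d by rewrite subr_gt0.
have d2 : 0 < (d / 2%:R)%:C%C :> C by rewrite -[X in X < _]/((0 : R)%:C%C) ltcR divr_gt0.
have U1 := fcont _ _ zZ _ d2.
have U2 := Uoo (Num.truncn (d / 2%:R)^-1).+1.
have [q [qa qb]] := ultra_ex UU (filterI U1 U2).
have lt1 := proj2 (zP q).
have lt2 : q.+1%:R^-1 < d / 2%:R.
  rewrite -[X in _ < X]invrK ltf_pV2 ?posrE ?invr_gt0 ?divr_gt0 ?ltr0n //.
  by rewrite (lt_le_trans (truncnS_gt _)) // ler_nat ltnW.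
have lt3 : complex.Re (f Z) - complex.Re (f (z q)) < d / 2%:R.
  rewrite -ltcR (le_lt_trans _ qa) //.
  have -> : f (z q) - f Z = (complex.Re (f (z q)) - complex.Re (f Z))%:C%C.
    by rewrite rmorphB /= -!fE.
  by rewrite normc_def /= expr0n /= addr0 sqrtr_sqr lecR distrC ler_norm.
suff : complex.Re (f Z) < complex.Re (f Z) by rewrite ltxx.
rewrite -{1}[complex.Re (f Z)](subrK (complex.Re (f (z q)))) (lt_trans (ltrD lt3 lt1)) //.
by rewrite addrCA -ltrBrDl -/d [X in _ < X]splitr ltrD2l.
Qed.
End Ultra.
End Chart.

(** * Definable families of pairs of matrices *)

Section Encode.
Variables (F : closedFieldType) (k m : nat).
Let n := #|{: 'I_k * 'I_m}|.

(** Variable 0 is kept for the parameter, hence the successor; offset 0 holds the point and offset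
    [n] the direction. *)
Definition mx_of (o : nat) (v : nat -> F) : 'M[F]_(k, m) :=
  \matrix_(i, j) v (o + enum_rank (i, j)).+1.

Lemma mx_of_surj x (Z H : 'M[F]_(k, m)) :
  exists v, [/\ v 0%N = x, mx_of 0 v = Z & mx_of n v = H].
Proof.
pose val_of (A : 'M[F]_(k, m)) l := if insub l is Some r then A (enum_val (r : 'I_n)).1 (enum_val r).2 else 0.
have val_rank A i j : val_of A (enum_rank (i, j)) = A i j by rewrite /val_of valK enum_rankK.
exists (fun l => if l is l'.+1 then if (l' < n)%N then val_of Z l' else val_of H (l' - n)%N else x).
split=> //; apply/matrixP => i j; rewrite mxE.
  by rewrite add0n ltn_ord val_rank.
by rewrite ltnNge leq_addr /= addKn val_rank.
Qed.

Lemma mx_of_dep o v v' : (forall i, (i <= o + n)%N -> v i = v' i) -> mx_of o v = mx_of o v'.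
Proof.
move=> vv'; apply/matrixP => i j; rewrite !mxE vv' //.
by rewrite -addnS leq_add2l ltn_ord.
Qed.

Lemma term_mx_of o i j : term_fun (fun e : seq F => mx_of o (nth 0 e) i j).
Proof. by apply: eq_term (term_var _ (o + enum_rank (i, j)).+1) => e; rewrite mxE. Qed.

Lemma mx_of_eq0 o v : mx_of o v = 0 <-> (forall l, (l < n)%N -> v (o + l).+1 = 0).
Proof.
split=> [/matrixP v0 l lt_l|v0]; last by apply/matrixP => i j; rewrite !mxE v0.
have := v0 (enum_val (Ordinal lt_l)).1 (enum_val (Ordinal lt_l)).2.
by rewrite !mxE -surjective_pairing enum_valK.
Qed.

Lemma definable_mx_neq0 o : definable (fun e : seq F => mx_of o (nth 0 e) <> 0).
Proof.
apply: definable_not; apply: (@eq_definable _ (fun e => forall l, (l < n)%N -> e`_(o + l).+1 = 0)).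
  by move=> e; rewrite mx_of_eq0.
by apply: definable_forall => l; apply/definable_eq0/term_var.
Qed.

Lemma generic_exists (S : F -> 'M[F]_(k, m) -> 'M[F]_(k, m) -> Prop) :
  definable (fun e => S e`_0 (mx_of 0 (nth 0 e)) (mx_of n (nth 0 e))) ->
  exists p : {poly F}, exists b : bool, p != 0 /\
    forall x, p.[x] != 0 -> ((exists Z H, S x Z H) <-> b).
Proof.
move=> dS.
have [|p [b [p0 pP]]] := @definable_generic F (n + n)
    (fun v => S (v 0%N) (mx_of 0 v) (mx_of n v)) _ dS.
  move=> v v' vv'; rewrite (vv' 0%N) // (@mx_of_dep n v v') // (@mx_of_dep 0 v v') // => i le_i.
  by apply: vv'; apply: leq_trans le_i _; rewrite add0n leq_addr.
exists p, b; split=> // x /pP <-; split=> [[Z [H SZH]]|[v <- Sv]].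
  by have [v [v0 vZ vH]] := mx_of_surj x Z H; exists v; rewrite // vZ vH v0.
by exists (mx_of 0 v), (mx_of n v).
Qed.
End Encode.

Section ChartSets.
Variables (R : realType) (k m : nat).
Local Notation C := R[i].
Let n := #|{: 'I_k * 'I_m}|.
Implicit Types (Z H : 'M[C]_(k, m)) (A B : seq C -> 'M[C]_(k, m)).

Lemma term_row_mx (B0 : 'M[C]_(k, k)) A : (forall i j, term_fun (fun e => A e i j)) ->
  forall i j, term_fun (fun e => (row_mx B0 (A e) : 'M[C]_(k, k + m)) i j).
Proof.
move=> tA i j; case E : (split j) => [c|c].
  by apply: eq_term (term_cst (B0 i c)) => e; rewrite mxE E.
by apply: eq_term (tA i c) => e; rewrite mxE E.
Qed.

Lemma poly_wr A : (forall i j, term_fun (fun e => A e i j)) -> poly_fun (fun e => wr (A e)).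
Proof. by move=> tA; apply: poly_wronski; apply: term_row_mx. Qed.

Lemma poly_dwr A B (H : seq C -> 'M[C]_(k, m)) : (forall i j, term_fun (fun e => A e i j)) ->
  (forall i j, term_fun (fun e => B e i j)) -> (forall i j, term_fun (fun e => H e i j)) ->
  poly_fun (fun e => dwr (A e) (B e) (H e)).
Proof. by move=> tA tB tH; apply: poly_dwronski; apply: term_row_mx. Qed.

Lemma poly_funB (F : closedFieldType) (P Q : seq F -> {poly F}) :
  poly_fun P -> poly_fun Q -> poly_fun (fun e => P e - Q e).
Proof.
move=> tP tQ; apply: eq_poly_fun (poly_funD tP (poly_funM (poly_cst (-1)) tQ)) => e.
by rewrite mulN1r.
Qed.

Let Zof (e : seq C) : 'M[C]_(k, m) := mx_of k m 0 (nth 0 e).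
Let Hof (e : seq C) : 'M[C]_(k, m) := mx_of k m n (nth 0 e).

Lemma definable_wr_eq (P : seq C -> {poly C}) b : poly_fun P -> (forall e, size (P e) <= b)%N ->
  definable (fun e => wr (Zof e) = P e).
Proof.
move=> tP szP; apply: (@eq_definable _ (fun e => wr (Zof e) - P e = 0)) => [e|].
  by split=> [/eqP|->]; rewrite ?subrr // subr_eq0 => /eqP.
apply: (@definable_poly_eq0 _ (maxn (k * m).+1 b)) => [|e].
  by apply: poly_funB tP; apply: poly_wr => ? ?; apply: term_mx_of.
rewrite (leq_trans (size_polyD _ _)) // size_polyN size_wr.
by rewrite geq_max leq_maxl leq_max szP orbT.
Qed.

Lemma definable_singular A : (forall i j, term_fun (fun e => A e i j)) ->
  definable (fun e => Hof e <> 0 /\ dwr (A e) (A e) (Hof e) = 0).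
Proof.
move=> tA; apply: definable_and; first exact: definable_mx_neq0.
apply: (@definable_poly_eq0 _ (k * m)) => [|e]; last exact: size_dwr.
by apply: poly_dwr => // ? ?; apply: term_mx_of.
Qed.

Lemma fiber_generic (w : {poly C}) (i : 'I_k) (j : 'I_m) :
  exists p : {poly C}, exists b : bool, p != 0 /\
    forall x, p.[x] != 0 -> ((exists Z, wr Z = w /\ Z i j = x) <-> b).
Proof.
have dS1 := definable_wr_eq (poly_cst w) (fun=> leqnn _).
have dS2 : definable (fun e => Zof e i j = e`_0).
  apply: (@eq_definable _ (fun e => Zof e i j + (-1) * e`_0 = 0)) => [e|].
    by rewrite mulN1r; split=> [/eqP|->]; rewrite ?subrr // subr_eq0 => /eqP.
  apply/definable_eq0/termD; first exact: term_mx_of.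
  exact: termM (term_cst _) (term_var _ _).
have [p [b [p0 pP]]] := @generic_exists C k m (fun x Z _ => wr Z = w /\ Z i j = x) (definable_and dS1 dS2).
exists p, b; split=> // x /pP <-; split=> [[Z ?]|[Z [_ ?]]]; first by exists Z, 0.
by exists Z.
Qed.

Lemma line_singular_generic Z0 Z1 :
  exists p : {poly C}, exists b : bool, p != 0 /\
    forall x, p.[x] != 0 -> (~ regular (Z0 + x *: (Z1 - Z0)) <-> b).
Proof.
have tL i j : term_fun (fun e : seq C => (Z0 + e`_0 *: (Z1 - Z0)) i j).
  apply: eq_term (termD (term_cst (Z0 i j)) (termM (term_var _ 0%N) (term_cst ((Z1 - Z0) i j)))) => e.
  by rewrite [RHS]mxE [in RHS]mxE.
have [p [b [p0 pP]]] := @generic_exists C k m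
    (fun x _ H => H <> 0 /\ dwr (Z0 + x *: (Z1 - Z0)) (Z0 + x *: (Z1 - Z0)) H = 0)
    (definable_singular tL).
exists p, b; split=> // x /pP <-; split=> [/existsNP[H /not_implyP[H0 Hn]]|[_ [H [Hn H0]]] rx].
  by exists 0, H.
exact/Hn/rx.
Qed.

Lemma critical_generic (w w' : {poly C}) :
  exists p : {poly C}, exists b : bool, p != 0 /\
    forall x, p.[x] != 0 -> ((exists Z, ~ regular Z /\ wr Z = w + x *: w') <-> b).
Proof.
have dS1 := definable_singular (fun (i : 'I_k) (j : 'I_m) => term_mx_of C 0 i j).
have dS2 : definable (fun e => wr (Zof e) = w + e`_0 *: w').
  apply: (@definable_wr_eq _ (maxn (size w) (size w'))) => [|e].
    apply: (@eq_poly_fun _ (fun e => w + (e`_0)%:P * w')) => [e|]; first by rewrite mul_polyC.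
    by apply: poly_funD (poly_cst _) _; apply: poly_funM (poly_cst _); apply/poly_const/term_var.
  rewrite (leq_trans (size_polyD _ _)) // geq_max leq_maxl /=.
  by rewrite (leq_trans (size_scale_leq _ _)) // leq_maxr.
have [p [b [p0 pP]]] := @generic_exists C k m
    (fun x Z H => (H <> 0 /\ dwr Z Z H = 0) /\ wr Z = w + x *: w') (definable_and dS1 dS2).
exists p, b; split=> // x /pP <-; split=> [[Z [nr eqw]]|[Z [H [[Hn H0] eqw]]]].
  by move: nr => /existsNP[H /not_implyP[H0 Hn]]; exists Z, H.
by exists Z; split=> // rZ; apply/Hn/rZ.
Qed.
End ChartSets.

(** * Local surjectivity and lifting of paths *)

Section Local.
Variables (R : realType) (k m : nat).
Local Notation C := R[i].
Implicit Types (Z H : 'M[C]_(k, m)) (w : {poly C}).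
Let N := (k * m)%N.
Variables (U : set_system nat) (UU : UltraFilter U) (Uoo : forall N, U (fun q => (N <= q)%N)).

Definition inv_succ (q : nat) : C := (q.+1%:R)^-1.

Lemma inv_succ_gt0 q : 0 < inv_succ q.
Proof. by rewrite invr_gt0 ltr0n. Qed.

Lemma inv_succ_le1 q : inv_succ q <= 1.
Proof. by rewrite invf_le1 ?ltr0n // ler1n. Qed.

Lemma inv_succ_lt (e : C) : 0 < e -> U (fun q => inv_succ q < e).
Proof.
move=> e0; have eE : e = (complex.Re e)%:C%C by rewrite RRe_real // ger0_real // ltW.
have re0 : 0 < complex.Re e by rewrite -ltcR -eE.
apply: filterS (Uoo (Num.truncn (complex.Re e)^-1).+1) => q le_q.
rewrite eE /inv_succ -(rmorph_nat (real_complex R)) -fmorphV ltcR.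
rewrite -[X in _ < X]invrK ltf_pV2 ?posrE ?invr_gt0 ?ltr0n //.
by rewrite (lt_le_trans (truncnS_gt _)) // ler_nat ltnW.
Qed.

Lemma ucv_inv_succ : ucv U inv_succ 0.
Proof.
move=> e /inv_succ_lt; apply: filterS => q.
by rewrite subr0 ger0_norm // ltW // inv_succ_gt0.
Qed.

Lemma ucv_of_inv_succ (u : nat -> C) l : U (fun q => `|u q - l| <= inv_succ q) -> ucv U u l.
Proof. by move=> ul e /inv_succ_lt; apply: filterS2 ul => q; apply: le_lt_trans. Qed.

Lemma isolated Z : regular Z -> exists2 r : C, 0 < r &
  forall Z', (forall i j, `|Z' i j - Z i j| <= r) -> wr Z' = wr Z -> Z' = Z.
Proof.
move=> rZ; apply: contrapT => nex.
have bad q : exists Z', [/\ forall i j, `|Z' i j - Z i j| <= inv_succ q, wr Z' = wr Z & Z' <> Z].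
  apply: contrapT => nb; apply: nex; exists (inv_succ q); first exact: inv_succ_gt0.
  by move=> Z' Z'Z wE; apply: contrapT => ne; apply: nb; exists Z'.
have [a aP] := choice bad.
have aZ : mcv U a Z.
  by move=> i j; apply: ucv_of_inv_succ; apply: filterE => q; case: (aP q).
have := local_inj_limit UU aZ (mcv_cst UU Z) rZ.
have eqw : U (fun q => wr (a q) = wr Z) by apply: filterE => q; case: (aP q).
by move=> /(_ eqw)/(ultra_ex UU)[q]; case: (aP q).
Qed.

Lemma size_sub_wr_trans w Z Z' : (size (w - wr Z)%R <= N)%N -> (size (w - wr Z')%R <= N)%N.
Proof.
move=> szw; rewrite -[w](subrK (wr Z)) -addrA (leq_trans (size_polyD _ _)) // geq_max.
by rewrite szw andTb (wr_sub Z Z') size_dwr.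
Qed.

(** Only the coefficients below degree [N] are compared, since the top one is constant on the
    chart. *)
Definition wdist w Z : C := \sum_(i < N) `|(wr Z)`_i - w`_i|.

Lemma wdist_ge0 w Z : 0 <= wdist w Z.
Proof. exact: sumr_ge0. Qed.

Lemma wdist_eq0 w Z : (size (w - wr Z)%R <= N)%N -> wdist w Z = 0 -> wr Z = w.
Proof.
move=> szw /eqP; rewrite psumr_eq0 // => /allP d0.
apply/esym/eqP; rewrite -subr_eq0; apply/eqP/polyP => i; rewrite coef0.
have [lt_i|le_i] := ltnP i N; last by rewrite nth_default // (leq_trans szw).
have := d0 (Ordinal lt_i) (mem_index_enum _); rewrite normr_eq0 /= coefB subr_eq0 => /eqP->.
by rewrite subrr.
Qed.

Lemma ucv_wdist w (z : nat -> 'M[C]_(k, m)) Z : mcv U z Z -> ucv U (fun q => wdist w (z q)) (wdist w Z).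
Proof.
move=> zZ; apply: (ucv_sum UU) => i; apply: ucv_norm; apply: (ucvB UU); last exact: ucv_cst.
exact: (pcv_wr UU zZ).
Qed.

(** A Newton direction [v] solves the linearized equation at [z]. A step of length [e] along it
    multiplies the distance by [1 - e] up to an error [e * eta] with [eta] tending to 0, so a
    positive distance at an interior minimum could be decreased. *)
Lemma descent w Z z (r : C) : 0 < r -> regular z -> (size (w - wr z)%R <= N)%N ->
  (forall i j, `|z i j - Z i j| < r) ->
  (forall z' : 'M[C]_(k, m), (forall i j, `|z' i j - Z i j| <= r) -> wdist w z <= wdist w z') ->
  wr z = w.
Proof.
move=> r0 rz szw zr zmin; apply: (wdist_eq0 szw); apply/eqP; apply: contraT => d0.
have dpos : 0 < wdist w z by rewrite lt_def d0 wdist_ge0.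
have [v vE] := regular_surj rz szw.
pose zn n := z + inv_succ n *: v.
have zncv : mcv U zn z.
  have := mcvD UU (mcv_cst UU z) (mcvZ UU ucv_inv_succ (mcv_cst UU v)).
  by rewrite scale0r addr0.
pose eta n := \sum_(i < N) `|(dwr (zn n) z v)`_i - (w - wr z)`_i|.
have eta0 : ucv U eta 0.
  have -> : 0 = \sum_(i < N) `|(dwr z z v)`_i - (w - wr z)`_i|.
    by rewrite big1 // => i _; rewrite vE subrr normr0.
  apply: (ucv_sum UU) => i; apply: ucv_norm; apply: (ucvB UU); last exact: ucv_cst.
  exact: (pcv_dwr UU zncv (mcv_cst UU z) (mcv_cst UU v)).
have in_ball : U (fun n => forall i j, `|zn n i j - Z i j| <= r).
  have h ij : U (fun n => `|zn n ij.1 ij.2 - Z ij.1 ij.2| <= r).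
    have e0 : 0 < r - `|z ij.1 ij.2 - Z ij.1 ij.2| by rewrite subr_gt0.
    apply: filterS (zncv ij.1 ij.2 _ e0) => n /ltW; rewrite lerBrDr; apply: le_trans.
    by rewrite -{1}[zn n _ _](subrK (z ij.1 ij.2)) -addrA ler_normD.
  by apply: filterS (ultra_all UU (fun ij : 'I_k * 'I_m => h ij)) => n hn i j; apply: (hn (i, j)).
have [n [lt_eta ballz]] := ultra_ex UU (filterI (eta0 _ dpos) in_ball).
have eta_lt : eta n < wdist w z.
  by move: lt_eta; rewrite subr0 ger0_norm // sumr_ge0.
suff lt_z : wdist w (zn n) < wdist w z by have := le_lt_trans (zmin _ ballz) lt_z; rewrite ltxx.
have e0 := inv_succ_gt0 n; have e1 := inv_succ_le1 n.
have step i : (wr (zn n))`_i - w`_i =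
    (1 - inv_succ n) * ((wr z)`_i - w`_i) + inv_succ n * ((dwr (zn n) z v)`_i - (w - wr z)`_i).
  have := congr1 (fun p : {poly C} => p`_i) (wr_sub (zn n) z).
  rewrite {2}/zn addrAC subrr add0r dwrZ coefB coefZ => E.
  have -> : (wr (zn n))`_i = (wr z)`_i + inv_succ n * (dwr (zn n) z v)`_i by rewrite -E addrCA subrr addr0.
  rewrite coefB; ring.
apply: (@le_lt_trans _ _ ((1 - inv_succ n) * wdist w z + inv_succ n * eta n)).
  rewrite /wdist /eta !mulr_sumr -big_split /=; apply: ler_sum => i _.
  rewrite step (le_trans (ler_normD _ _)) // !normrM.
  by rewrite (ger0_norm (_ : 0 <= 1 - inv_succ n)) ?subr_ge0 // (ger0_norm (ltW e0)).
by rewrite mulrBl mul1r -addrA gtrDl addrC subr_lt0 ltr_pM2l.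
Qed.

(** For targets tending to [wr Z], the minimizers of the distance on a small closed ball tend to a
    point of the fibre of [Z] in that ball, hence to [Z], which is isolated. They are eventually
    interior and regular, and [descent] makes them solutions. *)
Lemma local_surj Z (r : C) : regular Z -> 0 < r -> exists2 dl : C, 0 < dl &
  forall w, (size (w - wr Z)%R <= N)%N -> (forall i, (i < N)%N -> `|w`_i - (wr Z)`_i| < dl) ->
  exists Z', (forall i j, `|Z' i j - Z i j| < r) /\ wr Z' = w.
Proof.
move=> rZ r0; have [r1 r10 iso] := isolated rZ.
(* A positive number below both radii. *)
pose r' := (r^-1 + r1^-1)^-1.
have r'0 : 0 < r' by rewrite invr_gt0 addr_gt0 ?invr_gt0.
have r'r : r' <= r by rewrite -[X in _ <= X]invrK lef_pV2 ?posrE ?addr_gt0 ?invr_gt0 // lerDl invr_ge0 ltW.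
have r'r1 : r' <= r1 by rewrite -[X in _ <= X]invrK lef_pV2 ?posrE ?addr_gt0 ?invr_gt0 // lerDr invr_ge0 ltW.
apply: contrapT => nex.
have bad q : exists w, [/\ (size (w - wr Z)%R <= N)%N,
    forall i, (i < N)%N -> `|w`_i - (wr Z)`_i| < inv_succ q &
    ~ exists Z', (forall i j, `|Z' i j - Z i j| < r) /\ wr Z' = w].
  apply: contrapT => nb; apply: nex; exists (inv_succ q); first exact: inv_succ_gt0.
  by move=> w szw wclose; apply: contrapT => ne; apply: nb; exists w.
have [w wP] := choice bad.
pose K (z : 'M[C]_(k, m)) := forall i j, `|z i j - Z i j| <= r'.
have KZ : K Z by move=> i j; rewrite subrr normr0 ltW.
have Kcpt (z : nat -> 'M[C]_(k, m)) : (forall q, K (z q)) -> exists2 Z', mcv U z Z' & K Z'.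
  move=> Kz; have [|L zL] := @mcv_bounded _ UU _ _ _ z (\sum_i \sum_j `|Z i j| + r').
    apply: filterE => q i j; rewrite -[z q i j](subrK (Z i j)) addrC (le_trans (ler_normD _ _)) //.
    apply: lerD; last exact: Kz.
    rewrite (bigD1 i) //= (bigD1 j) //= -addrA lerDl addr_ge0 ?sumr_ge0 // => l _.
    exact: sumr_ge0.
  exists L => // i j; apply: (ucv_le UU (u := fun q => z q i j - Z i j)).
    by apply: (ucvB UU); [apply: zL | apply: ucv_cst].
  by apply: filterE => q; apply: Kz.
have hz q : exists2 z, K z & forall z', K z' -> wdist (w q) z <= wdist (w q) z'.
  apply: (minimizer UU KZ (wdist_ge0 (w q)) Kcpt) Uoo => z z'; exact: ucv_wdist.
have [z zP] := choice (fun q => let: ex_intro2 z a b := hz q in ex_intro _ z (conj a b)).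
have zK q : K (z q) by case: (zP q).
have wcv : pcv U w (wr Z).
  move=> i; apply: ucv_of_inv_succ; apply: filterE => q; case: (wP q) => szw wi _.
  have [lt_i|le_i] := ltnP i N; first exact/ltW/wi.
  rewrite -coefB nth_default ?(leq_trans szw) // normr0 ltW //; exact: inv_succ_gt0.
have sz_wz q : (size (w q - wr (z q))%R <= N)%N by case: (wP q) => szq _ _; apply: size_sub_wr_trans szq.
have dist0 : ucv U (fun q => wdist (w q) (z q)) 0.
  have dZ0 : ucv U (fun q => wdist (w q) Z) 0.
    have -> : 0 = \sum_(i < N) `|(wr Z)`_i - (wr Z)`_i|.
      by rewrite big1 // => i _; rewrite subrr normr0.
    apply: (ucv_sum UU) => i; apply: ucv_norm; apply: (ucvB UU); first exact: ucv_cst.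
    exact: wcv.
  by apply: (ucv_squeeze0 UU _ _ dZ0) => q; [apply: wdist_ge0 | case: (zP q) => _; apply].
have wzcv : pcv U (fun q => wr (z q)) (wr Z).
  move=> i; apply: (sub0_ucv UU (u := fun q => (wr (z q))`_i)).
  have d1 : ucv U (fun q => (wr (z q))`_i - (w q)`_i) 0.
    move=> e /dist0; apply: filterS => q; rewrite !subr0 ger0_norm ?wdist_ge0 //.
    apply: le_lt_trans; have [lt_i|le_i] := ltnP i N.
      by rewrite /wdist (bigD1 (Ordinal lt_i)) //= lerDl sumr_ge0.
    rewrite distrC -coefB nth_default ?(leq_trans (sz_wz q)) // normr0; exact: wdist_ge0.
  have := ucvD UU d1 (ucv_sub0 UU (wcv i)); rewrite addr0.
  apply: (ucv_eqU UU); apply: filterE => q; by rewrite addrA subrK.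
have [Z' zZ' wZ'] := wr_proper UU wzcv.
have Z'Z : Z' = Z.
  apply: iso wZ' => i j; apply: le_trans r'r1.
  apply: (ucv_le UU (u := fun q => z q i j - Z i j)).
    by apply: (ucvB UU); [apply: zZ' | apply: ucv_cst].
  by apply: filterE => q; apply: zK.
rewrite Z'Z in zZ'.
have near : U (fun q => forall i j, `|z q i j - Z i j| < r').
  have h ij : U (fun q => `|z q ij.1 ij.2 - Z ij.1 ij.2| < r') := zZ' ij.1 ij.2 _ r'0.
  by apply: filterS (ultra_all UU (fun ij : 'I_k * 'I_m => h ij)) => q hq i j; apply: (hq (i, j)).
have [q [rzq nearq]] := ultra_ex UU (filterI (regular_limit UU zZ' rZ) near).
case: (wP q) => _ _; apply; exists (z q); split.
  by move=> i j; apply: lt_le_trans (nearq i j) r'r.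
by apply: (descent r'0 rzq (sz_wz q) nearq); case: (zP q).
Qed.
End Local.

Section Lift.
Variables (R : realType) (k m : nat).
Local Notation C := R[i].
Implicit Types (Z H : 'M[C]_(k, m)) (w : {poly C}).
Let N := (k * m)%N.
Variables (U : set_system nat) (UU : UltraFilter U) (Uoo : forall N, U (fun q => (N <= q)%N)).

Lemma normc_real (x : R) : `|x%:C%C| = `|x|%:C%C :> C.
Proof. by rewrite normc_def /= expr0n /= addr0 sqrtr_sqr. Qed.

Lemma ucv_real_inv_succ (u : nat -> R) l : (forall q, `|u q - l| <= (q.+1%:R)^-1) ->
  ucv U (fun q => (u q)%:C%C : C) l%:C%C.
Proof.
move=> ul; apply: (ucv_of_inv_succ UU Uoo); apply: filterE => q.
by rewrite -rmorphB normc_real /inv_succ -(rmorph_nat (real_complex R)) -fmorphV lecR.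
Qed.

(** Only the set of parameters with a point in [V] above them is followed, not a continuous lift.
    Properness and closedness of [V] show that its supremum is attained; local surjectivity at a
    regular point of [V] pushes it further. Regularity is asked before the endpoint 1 only, and of
    some point of [V] in the fibre. *)
Lemma path_lift (g : R -> {poly C}) (V : 'M[C]_(k, m) -> Prop) :
  (forall (u : nat -> R) l, ucv U (fun q => (u q)%:C%C : C) l%:C%C ->
     pcv U (fun q => g (u q)) (g l)) ->
  (forall u Z, (size (g u - wr Z)%R <= N)%N) ->
  (forall Z, V Z -> exists2 r : C, 0 < r &
     forall Z' : 'M[C]_(k, m), (forall i j, `|Z' i j - Z i j| < r) -> V Z') ->
  (forall (u : nat -> R) (z : nat -> 'M[C]_(k, m)) l Z, 0 <= l <= 1 ->
     (forall q, 0 <= u q <= 1 /\ V (z q) /\ wr (z q) = g (u q)) ->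
     ucv U (fun q => (u q)%:C%C : C) l%:C%C -> mcv U z Z -> V Z) ->
  (forall u, 0 <= u < 1 -> (exists Z, V Z /\ wr Z = g u) ->
     exists Z, [/\ V Z, wr Z = g u & regular Z]) ->
  (exists Z, V Z /\ wr Z = g 0) -> exists Z, V Z /\ wr Z = g 1.
Proof.
move=> g_cont g_size Vopen Vclosed Vreg [Z0 [VZ0 Z0E]].
pose S : set R := fun u => 0 <= u <= 1 /\ exists Z, V Z /\ wr Z = g u.
have S0 : S 0 by split; [rewrite lexx ler01 | exists Z0].
have hS : has_sup S by split; [exists 0 | exists 1 => u [/andP[]]].
pose s := sup S.
have s01 : 0 <= s <= 1.
  rewrite (sup_upper_bound hS S0) /=; apply: ge_sup; first by exists 0.
  by move=> u [/andP[]].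
have hu (q : nat) : exists u, S u /\ s - (q.+1%:R)^-1 < u.
  have e0 : 0 < (q.+1%:R)^-1 :> R by rewrite invr_gt0 ltr0n.
  by have [u Su lt_u] := sup_adherent e0 hS; exists u.
have [u uP] := choice hu.
have us : ucv U (fun q => (u q)%:C%C : C) s%:C%C.
  apply: ucv_real_inv_succ => q; have [Su lt_u] := uP q.
  have le_us : u q <= s by apply: (sup_upper_bound hS).
  by rewrite distrC ger0_norm ?subr_ge0 // lerBlDr -lerBlDl ltW.
have hz q : exists Z, V Z /\ wr Z = g (u q) by case: (uP q) => -[].
have [z zP] := choice hz.
have [Z zZ ZE] : exists2 Z, mcv U z Z & wr Z = g s.
  apply: (wr_proper UU); apply: pcv_eqU (g_cont _ _ us); apply: filterE => q.
  by case: (zP q).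
have VZ : V Z.
  apply: (Vclosed u z s Z) => // q; split; last exact: zP.
  by case: (uP q) => -[].
have /andP[s0 s1] := s01.
move: s1; rewrite le_eqVlt => /orP[/eqP s1|s1]; first by exists Z; rewrite -s1.
have [Z1 [VZ1 Z1E Z1r]] := Vreg s ltac:(by rewrite s0 s1) (ex_intro _ Z (conj VZ ZE)).
have [r r0 rP] := Vopen _ VZ1.
have [dl dl0 dlP] := local_surj UU Uoo Z1r r0.
pose v (q : nat) := s + (1 - s) / q.+1%:R.
have vs : ucv U (fun q => (v q)%:C%C : C) s%:C%C.
  apply: ucv_real_inv_succ => q; rewrite /v addrC addKr.
  rewrite normrM ger0_norm ?subr_ge0 ?(ltW s1) // ger0_norm ?invr_ge0 ?ler0n //.
  by rewrite ler_piMl ?invr_ge0 ?ler0n // gerBl.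
have near : U (fun q => forall i : 'I_N, `|(g (v q))`_i - (g s)`_i| < dl).
  by apply: (ultra_all UU) => i; apply: g_cont dl0.
have [q qP] := ultra_ex UU near.
have [|i lt_i|Z2 [Z2Z1 Z2E]] := dlP (g (v q)); first exact: g_size.
  by have := qP (Ordinal lt_i); rewrite Z1E.
have q0 : 0 < (q.+1%:R)^-1 :> R by rewrite invr_gt0 ltr0n.
have lt_sv : s < v q by rewrite /v ltrDl mulr_gt0 // subr_gt0.
have Sv : S (v q).
  split; last by exists Z2; split=> //; apply: rP.
  rewrite (ltW (le_lt_trans s0 lt_sv)) /= /v -lerBrDl ler_piMr ?subr_ge0 ?(ltW s1) //.
  by rewrite invf_le1 ?ltr0n // ler1n.
by have := sup_upper_bound hS Sv; rewrite leNgt lt_sv.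
Qed.
End Lift.

(** * Deforming non-real points *)

Section Transport.
Variables (R : realType) (k m : nat).
Local Notation C := R[i].
Local Notation cj := (map_mx (@conjc R)).
Implicit Types (Z H : 'M[C]_(k, m)) (w : {poly C}) (T : nat -> R).
Let N := (k * m)%N.

Definition target T : {poly C} := topcoef R k m *: rootpoly N T.

Definition increasing T := forall i j, (i < j)%N -> (j < N)%N -> T i < T j.

Hypothesis Hreg : forall T, increasing T -> forall Z, wr Z = target T -> regular Z.

Lemma topcoef_conj : conjc (topcoef R k m) = topcoef R k m.
Proof.
rewrite /topcoef !omega_sum rmorph_sum; apply: eq_bigr => s _.
rewrite /permcoef !rmorphM /= rmorphXn rmorphN1; congr (_ * (_ * _)).
  by rewrite rmorph_prod; apply: eq_bigr => r _; rewrite mxE rmorph_nat.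
by rewrite rmorph_prod; apply: eq_bigr => r _; rewrite rmorph_nat.
Qed.

Lemma target_conj T : map_poly (@conjc R) (target T) = target T.
Proof. by rewrite map_polyZ /= conj_rootpoly topcoef_conj. Qed.

Lemma size_target T : size (target T) = N.+1.
Proof. by rewrite size_scale ?size_rootpoly // topcoef_neq0. Qed.

Lemma lead_target T : (target T)`_N = topcoef R k m.
Proof. by rewrite coefZ lead_rootpoly mulr1. Qed.

Lemma size_sub_wr w Z : (size w <= N.+1)%N -> w`_N = topcoef R k m -> (size (w - wr Z)%R <= N)%N.
Proof.
move=> szw wN; have : (size (w - wr Z)%R <= N.+1)%N.
  by rewrite (leq_trans (size_polyD _ _)) // size_polyN size_wr geq_max szw leqnn.
rewrite leq_eqVlt => /orP[/eqP sz|]; last by rewrite ltnS.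
have : lead_coef (w - wr Z) = 0 by rewrite /lead_coef sz /= coefB wN lead_wr subrr.
by move/eqP; rewrite lead_coef_eq0 => /eqP->; rewrite size_poly0.
Qed.

Lemma nonreal_entry Z : cj Z <> Z -> exists i j, conjc (Z i j) != Z i j.
Proof.
move=> nr; apply: contrapT => nex; apply: nr; apply/matrixP => i j; rewrite mxE; apply/eqP.
by apply: contrapT => /negP h; apply: nex; exists i, j.
Qed.

Lemma nonreal_near (y z : C) : `|z - y| < `|conjc y - y| / 2%:R -> conjc z <> z.
Proof.
move=> lt_r zreal; have : `|conjc y - y| < `|conjc y - y|; last by rewrite ltxx.
rewrite -{1}(subrK z (conjc y)) -addrA (le_lt_trans (ler_normD _ _)) //.
rewrite -{1}zreal -rmorphB normcJ distrC.
rewrite -[X in _ < X](divfK (_ : 2%:R != 0)) ?pnatr_eq0 // mulr_natr mulr2n.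
by rewrite ltrD.
Qed.

Lemma nonreal_open Z : cj Z <> Z -> exists2 r : C, 0 < r &
  forall Z' : 'M[C]_(k, m), (forall i j, `|Z' i j - Z i j| < r) -> cj Z' <> Z'.
Proof.
move=> /nonreal_entry[i [j zij]].
exists (`|conjc (Z i j) - Z i j| / 2%:R); first by rewrite divr_gt0 // normr_gt0 subr_eq0.
move=> Z' near /matrixP/(_ i j); rewrite mxE; exact/nonreal_near/near.
Qed.

Section Ultra.
Variables (U : set_system nat) (UU : UltraFilter U) (Uoo : forall N, U (fun q => (N <= q)%N)).

Lemma pcv_target (T : nat -> nat -> R) T' :
  (forall i, (i < N)%N -> ucv U (fun q => (T q i)%:C%C : C) (T' i)%:C%C) ->
  pcv U (fun q => target (T q)) (target T').
Proof.
move=> TT; rewrite /target -mul_polyC.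
apply: (pcv_eqU UU (P := fun q => (topcoef R k m)%:P * rootpoly N (T q))).
  by apply: filterE => q; rewrite mul_polyC.
apply: (pcvM UU); first exact: pcv_cst.
apply: (pcv_prod UU) => i.
have := pcvD UU (pcv_cst UU 'X) (pcvM UU (pcv_cst UU (-1)) (pcvC UU (TT i (ltn_ord i)))).
rewrite mulN1r; apply: (pcv_eqU UU); apply: filterE => q; by rewrite mulN1r.
Qed.

Lemma real_limit_false (z : nat -> 'M[C]_(k, m)) Z : mcv U z Z -> regular Z -> cj Z = Z ->
  (forall q, cj (z q) <> z q) -> (forall q, map_poly (@conjc R) (wr (z q)) = wr (z q)) -> False.
Proof.
move=> zZ rZ realZ nr realw.
have czZ : mcv U (fun q => cj (z q)) Z by rewrite -realZ; apply: mcv_conj.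
have : U (fun q => cj (z q) = z q).
  apply: (local_inj_limit UU czZ zZ rZ); apply: filterE => q.
  by rewrite conj_wr realw.
by move=> /(ultra_ex UU)[q]; apply: nr.
Qed.

Lemma transport_nonreal T0 T1 : increasing T0 -> increasing T1 ->
  (exists Z, cj Z <> Z /\ wr Z = target T0) -> exists Z, cj Z <> Z /\ wr Z = target T1.
Proof.
move=> inc0 inc1 [Z0 [nr0 Z0E]].
(* Convex combinations of increasing sequences are increasing, so the roots stay real and distinct
   along the path. *)
pose T u i := (1 - u) * T0 i + u * T1 i.
have incT u : 0 <= u <= 1 -> increasing (T u).
  move=> /andP[u0 u1] i j ij jN; rewrite /T.
  have := inc0 i j ij jN; have := inc1 i j ij jN; move: u0; rewrite le_eqVlt => /orP[/eqP<-|u0] lt1 lt0.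
    by rewrite !mul0r subr0 !mul1r !addr0.
  by apply: ler_ltD; rewrite ?ltr_pM2l // ler_wpM2l ?subr_ge0 // ltW.
have TE0 : target (T 0) = target T0.
  by congr (_ *: _); apply: eq_rootpoly => i _; rewrite /T subr0 mul1r mul0r addr0.
have TE1 : target (T 1) = target T1.
  by congr (_ *: _); apply: eq_rootpoly => i _; rewrite /T subrr mul1r mul0r add0r.
have g_cont (u : nat -> R) l : ucv U (fun q => (u q)%:C%C : C) l%:C%C ->
    pcv U (fun q => target (T (u q))) (target (T l)).
  move=> ul; apply: pcv_target => i _.
  have := ucvD UU (ucvM UU (ucvB UU (ucv_cst UU 1) ul) (ucv_cst UU (T0 i)%:C%C)) (ucvM UU ul (ucv_cst UU (T1 i)%:C%C)).
  rewrite /T rmorphD !rmorphM rmorphB; apply: (ucv_eqU UU); apply: filterE => q.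
  by rewrite [RHS]rmorphD !rmorphM rmorphB.
rewrite -TE1.
apply: (path_lift UU Uoo (g := fun u => target (T u)) (V := fun Z => cj Z <> Z)) => //.
- by move=> u Z; apply: size_sub_wr; rewrite ?size_target ?lead_target.
- exact: nonreal_open.
- move=> u z l Z l01 uz ul zZ realZ.
  have wZ : wr Z = target (T l).
    apply: (pcv_uniq UU (pcv_wr UU zZ)); apply: (pcv_eqU UU) (g_cont _ _ ul).
    by apply: filterE => q; case: (uz q) => _ [].
  apply: (real_limit_false zZ (Hreg (incT _ l01) wZ) realZ) => q; case: (uz q) => _ [] // _ ->.
  exact: target_conj.
- move=> u /andP[u0 u1] [Z [nr wZ]]; exists Z; split=> //.
  by apply: Hreg wZ; apply: incT; rewrite u0 ltW.
- by exists Z0; rewrite TE0.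
Qed.
End Ultra.
End Transport.

(** * Splitting multiple real roots without losing a non-real point *)

Lemma avoid_finite (T : eqType) (f : nat -> T) (s : seq T) : injective f -> exists q, f q \notin s.
Proof.
move=> inj_f; apply: contrapT => nex.
have sub : {subset map f (iota 0 (size s).+1) <= s}.
  by move=> _ /mapP[q _ ->]; apply: contrapT => /negP h; apply: nex; exists q.
have := uniq_leq_size _ sub; rewrite size_map size_iota ltnn map_inj_uniq // iota_uniq.
by move=> /(_ isT).
Qed.

Lemma mul_cancel (F : fieldType) (c u v : F) : u != 0 -> v != 0 -> c = c * u * v / (u * v).
Proof. by move=> u0 v0; rewrite -[c * u * v]mulrA mulfK // mulf_neq0. Qed.

Section Split.
Variables (R : realType) (k m : nat).
Local Notation C := R[i].
Local Notation cj := (map_mx (@conjc R)).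
Implicit Types (Z H : 'M[C]_(k, m)) (w : {poly C}) (T : nat -> R).
Let N := (k * m)%N.
Local Notation target := (target k m).
Local Notation increasing := (increasing k m).

Lemma poly_roots (p : {poly C}) : p != 0 -> exists s : seq C, forall x, p.[x] = 0 -> x \in s.
Proof.
move=> p0; have [s sP] := closed_field_poly_normal p; exists s => x px.
rewrite -root_prod_XsubC -(rootZ _ _ (_ : lead_coef p != 0)) ?lead_coef_eq0 // -sP.
exact/rootP.
Qed.

Variables (U : set_system nat) (UU : UltraFilter U) (Uoo : forall N, U (fun q => (N <= q)%N)).

Lemma ultra_not_root (p : {poly C}) (u : nat -> C) : p != 0 -> injective u -> U (fun q => p.[u q] != 0).
Proof.
move=> p0 inj_u; apply: contrapT => /(ultra_not UU) Up.
have [s sP] := poly_roots p0.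
have [i Ui] : exists i : 'I_(size s), U (fun q => u q = s`_i).
  apply: (ultra_fin UU); apply: filterS Up => q /negP; rewrite negbK => /eqP/sP us.
  have lt_i : (index (u q) s < size s)%N by rewrite index_mem.
  by exists (Ordinal lt_i); rewrite /= nth_index.
have [q uq] := ultra_ex UU Ui.
have [q' [uq' lt_q]] := ultra_ex UU (filterI Ui (Uoo q.+1)).
have /inj_u qq : u q = u q' by rewrite uq uq'.
by rewrite qq ltnn in lt_q.
Qed.

Lemma inj_inv_succ : injective (inv_succ R).
Proof. by move=> q q' /invr_inj/eqP; rewrite eqr_nat => /eqP[]. Qed.

(** An injective sequence leaves the finite set of roots of [p], so its failures determine the
    generic truth value. *)
Lemma nongeneric_false (P : C -> Prop) (p : {poly C}) (b : bool) (u : nat -> C) : p != 0 ->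
  (forall x, p.[x] != 0 -> (P x <-> b)) -> injective u -> U (fun q => ~ P (u q)) ->
  forall x, p.[x] != 0 -> ~ P x.
Proof.
move=> p0 pP inj_u nP x /pP ->.
have [q [pq nPq]] := ultra_ex UU (filterI (ultra_not_root p0 inj_u) nP).
by move=> bT; apply: nPq; apply/(pP _ pq).
Qed.

(* A definable bounded subset of the complex numbers is finite. *)
Lemma fiber_entry_finite w i j : exists s : seq C, forall Z, wr Z = w -> Z i j \in s.
Proof.
have [p [b [p0 pP]]] := fiber_generic w i j.
have [s sP] := poly_roots p0; exists s => Z wZ; apply: sP; apply/eqP; apply: contrapT => /negP nz.
(* The integers serve as the test sequence: fibre points with entry [q] for almost all [q] would be
   unbounded, against properness. *)
have inj_nat : injective (fun q : nat => q%:R : C) by move=> q q' /eqP; rewrite eqr_nat => /eqP.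
apply: (nongeneric_false p0 pP inj_nat _ nz); last by exists Z.
apply: contrapT => /(ultra_not UU) Uz.
have hex q : exists Z', (exists Z, wr Z = w /\ Z i j = q%:R) -> wr Z' = w /\ Z' i j = q%:R.
  by have [[Z' ?]|nex] := pselect (exists Z, wr Z = w /\ Z i j = q%:R); [exists Z' | exists 0].
have [z zP] := choice hex.
have zU : U (fun q => wr (z q) = w /\ z q i j = q%:R).
  apply: filterS Uz => q h; apply: zP; exact: contrapT.
have [|Z' zZ' _] := @wr_proper R k m U UU z w.
  by apply: pcv_eqU (pcv_cst UU w); apply: filterS zU => q [->].
have bnd := ucv_bounded UU (zZ' i j).
pose B := `|Z' i j| + 1; have BE : B = (complex.Re B)%:C%C by rewrite RRe_real // ger0_real // addr_ge0.
have [q [[[_ zq] ltB] leq]] := ultra_ex UU (filterI (filterI zU bnd) (Uoo (Num.truncn (complex.Re B)).+1)).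
have : B < B; last by rewrite ltxx.
apply: le_lt_trans ltB; rewrite zq normr_nat BE -(rmorph_nat (real_complex R)) lecR.
by rewrite ltW // (lt_le_trans (truncnS_gt _)) // ler_nat.
Qed.

Lemma split_roots T0 (Z0 Zs : 'M[C]_(k, m)) : (forall T, increasing T -> forall Z : 'M[C]_(k, m), wr Z = target T -> regular Z) ->
  (forall i j, (i < j)%N -> (j < N)%N -> T0 i <= T0 j) ->
  cj Z0 <> Z0 -> wr Z0 = target T0 -> regular Zs ->
  exists2 T1, increasing T1 & exists Z, cj Z <> Z /\ wr Z = target T1.
Proof.
move=> Hreg inc0 nr0 wZ0 rZs; set w0 := target T0 in wZ0.
have [i [j zij]] := nonreal_entry nr0.
set y0 := Z0 i j in zij.
pose rho : C := `|conjc y0 - y0| / 2%:R.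
have rho0 : 0 < rho by rewrite divr_gt0 // normr_gt0 subr_eq0.
have [s sP] := fiber_entry_finite w0 i j.
(* The entry takes finitely many values on the fibre, so some circle around [y0], small enough to
   enclose non-real numbers only, meets none of them. By properness the same holds over all
   polynomials within [dl] of [w0], and a lifted path cannot cross the circle. *)
have [r [r0 r_rho r_s]] : exists r : C, [/\ 0 < r, r <= rho & r \notin [seq `|v - y0| | v <- s]].
  have [|q qP] := @avoid_finite C (fun q => rho * inv_succ R q) [seq `|v - y0| | v <- s].
    by move=> q q' /(mulfI (lt0r_neq0 rho0))/inj_inv_succ.
  by exists (rho * inv_succ R q); rewrite mulr_gt0 ?inv_succ_gt0 // ler_piMr ?inv_succ_le1 // ltW.
have [dl dl0 dlP] : exists2 dl : C, 0 < dl & forall Z,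
    (forall l, (l < N)%N -> `|(wr Z)`_l - w0`_l| < dl) -> `|Z i j - y0| != r.
  apply: contrapT => nex.
  have bad q : exists Z, (forall l, (l < N)%N -> `|(wr Z)`_l - w0`_l| < inv_succ R q) /\ `|Z i j - y0| = r.
    apply: contrapT => nb; apply: nex; exists (inv_succ R q); first exact: inv_succ_gt0.
    by move=> Z hZ; apply/eqP => eqr; apply: nb; exists Z.
  have [z zP] := choice bad.
  have wcv : pcv U (fun q => wr (z q)) w0.
    move=> l; apply: (ucv_of_inv_succ UU Uoo); apply: filterE => q.
    have [lt_l|le_l] := ltnP l N; first by apply/ltW; case: (zP q) => + _; apply.
    rewrite -wZ0 -coefB nth_default ?normr0 ?(ltW (inv_succ_gt0 _ _)) //.
    by apply: leq_trans le_l; rewrite wr_sub size_dwr.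
  have [Z zZ wZ] := wr_proper UU wcv.
  have : `|Z i j - y0| = r.
    apply: (ucv_uniq UU (u := fun q => `|z q i j - y0|)).
      apply: (ucv_norm UU); apply: (ucvB UU); [exact: zZ | exact: ucv_cst].
    by apply: ucv_eqU (ucv_cst UU r); apply: filterE => q; case: (zP q).
  by move/eqP; apply/negP; apply: contra r_s => /eqP <-; apply/map_f/sP.
(* Along the path below, both endpoints enter with coefficients of modulus at most 2, whence the
   quarter. *)
pose d4 := dl / 4%:R; have d40 : 0 < d4 by rewrite divr_gt0.
have cv0 : mcv U (fun q => Z0 + inv_succ R q *: (Zs - Z0)) Z0.
  have := mcvD UU (mcv_cst UU Z0) (mcvZ UU (ucv_inv_succ UU Uoo) (mcv_cst UU (Zs - Z0))).
  by rewrite scale0r addr0.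
(* [Z0] itself may be singular. On the line from [Z0] to [Zs] the points near [Zs] are regular, so
   all but finitely many are, including some close to [Z0]. *)
have [Z1 [rZ1 near1 Z1r]] : exists Z1, [/\ regular Z1,
    forall l, (l < N)%N -> `|(wr Z1)`_l - w0`_l| < d4 & `|Z1 i j - y0| < r].
  have [p [b [p0 pP]]] := line_singular_generic Z0 Zs.
  have inj1 : injective (fun q => 1 - inv_succ R q).
    by move=> q q' /addrI/oppr_inj/inj_inv_succ.
  have cv1 : mcv U (fun q => Z0 + (1 - inv_succ R q) *: (Zs - Z0)) Zs.
    have := mcvD UU (mcv_cst UU Z0) (mcvZ UU (ucvB UU (ucv_cst UU 1) (ucv_inv_succ UU Uoo)) (mcv_cst UU (Zs - Z0))).
    by rewrite subr0 scale1r (addrC Z0 (Zs - Z0)) subrK.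
  have nsing := nongeneric_false p0 pP inj1.
  have {}nsing x : p.[x] != 0 -> regular (Z0 + x *: (Zs - Z0)).
    move=> px; apply: contrapT; apply: (nsing _ x px).
    by apply: filterS (regular_limit UU cv1 rZs) => q rq nrq.
  have h1 := ultra_not_root p0 inj_inv_succ.
  have h2 : U (fun q => forall l : 'I_N, `|(wr (Z0 + inv_succ R q *: (Zs - Z0)))`_l - w0`_l| < d4).
    by apply: (ultra_all UU) => l; rewrite -wZ0; apply: (pcv_wr UU cv0).
  have h3 := cv0 i j r r0.
  have [q [[pq n2] n3]] := ultra_ex UU (filterI (filterI h1 h2) h3).
  exists (Z0 + inv_succ R q *: (Zs - Z0)); split=> // [|l lt_l]; first exact: nsing.
  exact: (n2 (Ordinal lt_l)).
(* Adding a small multiple of the index separates coinciding roots and keeps their order. *)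
pose Tq (q : nat) l := T0 l + (q.+1%:R)^-1 * l%:R.
have incT q : increasing (Tq q).
  move=> l l' ll' l'N; rewrite /Tq ler_ltD //; first exact: inc0.
  by rewrite ltr_pM2l ?ltr_nat // invr_gt0 ltr0n.
have Tcv : pcv U (fun q => target (Tq q)) w0.
  apply: (pcv_target UU) => l _.
  have := ucvD UU (ucv_cst UU (T0 l)%:C%C) (ucvM UU (ucv_inv_succ UU Uoo) (ucv_cst UU (l%:R : R)%:C%C)).
  rewrite mul0r addr0; apply: (ucv_eqU UU); apply: filterE => q.
  by rewrite /Tq /inv_succ rmorphD rmorphM fmorphV !rmorph_nat.
have [q near'] : exists q, forall l : 'I_N, `|(target (Tq q))`_l - w0`_l| < d4.
  by apply: (ultra_ex UU); apply: (ultra_all UU) => l; apply: Tcv.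
pose T1 := Tq q; pose w1 := wr Z1; pose w' := target T1.
have inc1 : increasing T1 := incT q.
exists T1 => //.
have [p [b [p0 pP]]] := critical_generic k m w1 (w' - w1).
have inj1 : injective (fun q => 1 - inv_succ R q).
  by move=> q1 q2 /addrI/oppr_inj/inj_inv_succ.
(* Singular points over parameters tending to 1 would converge to a point over [w'], which is
   regular because [T1] is increasing. *)
have noncrit x : p.[x] != 0 -> ~ exists Z, ~ regular Z /\ wr Z = w1 + x *: (w' - w1).
  apply: (nongeneric_false p0 pP inj1); apply: contrapT => /(ultra_not UU) Uz.
  have hex n : exists Z, (exists Z, ~ regular Z /\ wr Z = w1 + (1 - inv_succ R n) *: (w' - w1)) ->
      ~ regular Z /\ wr Z = w1 + (1 - inv_succ R n) *: (w' - w1).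
    by have [[Z' ?]|nex] := pselect (exists Z, ~ regular Z /\ wr Z = w1 + (1 - inv_succ R n) *: (w' - w1));
      [exists Z' | exists 0].
  have [z zP] := choice hex.
  have zU : U (fun n => ~ regular (z n) /\ wr (z n) = w1 + (1 - inv_succ R n) *: (w' - w1)).
    apply: filterS Uz => n h; apply: zP; exact: contrapT.
  have wcv : pcv U (fun n => wr (z n)) w'.
    have := pcvD UU (pcv_cst UU w1) (pcvM UU (pcvC UU (ucvB UU (ucv_cst UU 1) (ucv_inv_succ UU Uoo))) (pcv_cst UU (w' - w1))).
    rewrite subr0 mul1r (addrC w1 (w' - w1)) subrK; apply: (pcv_eqU UU); apply: filterS zU => n [_ ->].
    by rewrite mul_polyC.
  have [Z zZ wZ] := wr_proper UU wcv.
  have [n [rn []]] := ultra_ex UU (filterI (regular_limit UU zZ (Hreg _ inc1 _ wZ)) zU).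
  by [].
have [sp spP] := poly_roots p0.
(* The arcs [u + c u (1 - u) i] join 0 to 1 in the complex line. A parameter [v] lies in the
   interior of such an arc only for [c = Im v / (Re v (1 - Re v))], so some [c] avoids all
   exceptional parameters. *)
have [qc qcP] := @avoid_finite _ (fun q : nat => (q.+1%:R)^-1 : R)
    [seq complex.Im v / (complex.Re v * (1 - complex.Re v)) | v <- sp]
    (fun q1 q2 e => succn_inj (eqP (etrans (esym (eqr_nat R _ _)) (introT eqP (invr_inj e))))).
pose c : R := (qc.+1%:R)^-1.
have c0 : 0 < c by rewrite invr_gt0 ltr0n.
have c1 : c <= 1 by rewrite invf_le1 ?ltr0n // ler1n.
pose tau (x : C) : C := x + c%:C%C * x * (1 - x) * 'i%C.
pose g (u : R) := w1 + tau u%:C%C *: (w' - w1).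
have normi : `|'i%C| = 1 :> C by rewrite normc_def /= expr0n expr1n /= add0r sqrtr1.
have tau_bnd u : 0 <= u <= 1 -> `|tau u%:C%C| <= 2%:R /\ `|1 - tau u%:C%C| <= 2%:R.
  move=> /andP[u0 u1].
  have b1 : `|c%:C%C * u%:C%C * (1 - u%:C%C) * 'i%C| <= 1 :> C.
    rewrite !normrM normi mulr1 -[1 - u%:C%C]/(1 - (real_complex R) u).
    rewrite -(rmorph1 (real_complex R)) -rmorphB !normc_real -!rmorphM lecR.
    rewrite (ger0_norm (ltW c0)) (ger0_norm u0) ger0_norm ?subr_ge0 //.
    rewrite -[X in _ <= X]mulr1 -[X in _ <= X * _]mulr1 !ler_pM ?mulr_ge0 ?subr_ge0 ?(ltW c0) //.
    by rewrite gerBl.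
  have b2 : `|u%:C%C| <= 1 :> C by rewrite normc_real ger0_norm // -(rmorph1 (real_complex R)) lecR.
  have b3 : `|1 - u%:C%C| <= 1 :> C.
    rewrite -(rmorph1 (real_complex R)) -rmorphB normc_real lecR ger0_norm ?subr_ge0 // gerBl //.
  split; rewrite /tau ?opprD ?addrA (le_trans (ler_normD _ _)) // ?normrN -[2%:R]/(1 + 1) lerD //.
have close u : 0 <= u <= 1 -> forall l, (l < N)%N -> `|(g u)`_l - w0`_l| < dl.
  move=> /tau_bnd[t1 t2] l lt_l.
  have -> : (g u)`_l - w0`_l = (1 - tau u%:C%C) * (w1`_l - w0`_l) + tau u%:C%C * (w'`_l - w0`_l).
    by rewrite /g coefD coefZ coefB; ring.
  rewrite (le_lt_trans (ler_normD _ _)) // !normrM.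
  have : 2%:R * `|w1`_l - w0`_l| + 2%:R * `|w'`_l - w0`_l| < dl.
    have -> : dl = 2%:R * d4 + 2%:R * d4 by rewrite /d4; field.
    by rewrite ltrD // ltr_pM2l ?ltr0n //; [apply: near1 | apply: (near' (Ordinal lt_l))].
  by apply: le_lt_trans; rewrite lerD // ler_wpM2r.
have tau0 : tau 0 = 0 by rewrite /tau mulr0 !mul0r addr0.
have tau1 : tau 1 = 1 by rewrite /tau subrr mulr0 mul0r addr0.
have sz1 : size w1 = N.+1 := size_wr Z1.
have sz' : size w' = N.+1 := size_target k m T1.
have gcont (u : nat -> R) l : ucv U (fun n => (u n)%:C%C : C) l%:C%C -> pcv U (fun n => g (u n)) (g l).
  move=> ul; rewrite /g -mul_polyC.
  have tcv : ucv U (fun n => tau (u n)%:C%C) (tau l%:C%C).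
    apply: (ucvD UU ul); apply: (ucvM UU) (ucv_cst UU _).
    by apply: (ucvM UU); [apply: (ucvM UU) ul; apply: ucv_cst | apply: (ucvB UU) ul; apply: ucv_cst].
  have := pcvD UU (pcv_cst UU w1) (pcvM UU (pcvC UU tcv) (pcv_cst UU (w' - w1))).
  by apply: (pcv_eqU UU); apply: filterE => n; rewrite mul_polyC.
have [|||||Z [VZ wZ]] := path_lift UU Uoo (V := fun Z => `|Z i j - y0| < r) gcont.
- move=> u Z; apply: size_sub_wr.
    rewrite (leq_trans (size_polyD _ _)) // sz1 geq_max leqnn /=.
    rewrite (leq_trans (size_scale_leq _ _)) // (leq_trans (size_polyD _ _)) //.
    by rewrite size_polyN sz1 sz' maxnn.
  by rewrite coefD coefZ coefB lead_target lead_wr subrr mulr0 addr0.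
- move=> Z VZ; exists (r - `|Z i j - y0|); first by rewrite subr_gt0.
  move=> Z' /(_ i j); rewrite ltrBrDr; apply: le_lt_trans.
  by rewrite -{1}(subrK (Z i j) (Z' i j)) -addrA ler_normD.
- move=> u z l Z l01 uz ul zZ.
  have wZ : wr Z = g l.
    apply: (pcv_uniq UU (pcv_wr UU zZ)); apply: (pcv_eqU UU) (gcont _ _ ul).
    by apply: filterE => n; case: (uz n) => _ [].
  (* The limit satisfies the weak inequality, and equality is ruled out by the choice of [r] and
     [dl]. *)
  rewrite lt_neqAle dlP ?(ucv_le UU (u := fun n => z n i j - y0)) //.
  + by apply: (ucvB UU); [apply: zZ | apply: ucv_cst].
  + by apply: filterE => n; case: (uz n) => _ [/ltW].
  + by move=> n lt_n; rewrite wZ; apply: close.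
- move=> u /andP[u0 u1] [Z [VZ wZ]].
  (* The choice of [c] concerns [0 < u < 1]; at [u = 0] the regular point is [Z1]. *)
  move: u0; rewrite le_eqVlt => /orP[/eqP u0|u0].
    by exists Z1; split=> //; rewrite /g -u0 tau0 scale0r addr0.
  exists Z; split; [exact: VZ | exact: wZ |]; apply: contrapT => nr.
  apply: (noncrit (tau u%:C%C)); last exact: (ex_intro _ Z (conj nr wZ)).
  apply/negP => /eqP/spP tu; move/negP: qcP; apply.
  apply/mapP; exists (tau u%:C%C); first exact: tu.
  have -> : tau u%:C%C = (u +i* (c * u * (1 - u)))%C.
    by rewrite /tau; simpc; rewrite ?mulr0 ?subr0.
  by apply: mul_cancel; rewrite ?subr_eq0 ?gt_eqF.
- by exists Z1; rewrite /g tau0 scale0r addr0.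
exists Z; split; last by rewrite wZ /g tau1 scale1r addrC subrK.
move/matrixP/(_ i j); rewrite mxE; apply/nonreal_near.
exact: lt_le_trans VZ r_rho.
Qed.
End Split.

(** * A regular point *)

Section Alternation.
Variable R : rcfType.
Implicit Types (P Q : {poly R}) (s : nat -> R).

Definition alternates p P s :=
  [/\ forall i, (i < p)%N -> s i < s i.+1,
      forall i, (i < p)%N -> P.[s i] * P.[s i.+1] < 0 & P.[s p] != 0].

Lemma alternates_neq0 p P s i : alternates p P s -> (i <= p)%N -> P.[s i] != 0.
Proof.
move=> [_ alt nz]; rewrite leq_eqVlt => /orP[/eqP->//|/alt]; apply: contraTneq => ->.
by rewrite mul0r ltxx.
Qed.

(* Adding a small term of degree [p.+1] with the right sign keeps the existing
   sign changes and creates a new one near infinity. *)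
Lemma alternates_perturb p P Q s : alternates p P s ->
  (size P <= p.+1)%N -> (size Q <= p.+2)%N -> Q`_p.+1 != 0 ->
  exists u s', u != 0 /\ alternates p.+1 (P + u *: Q) s'.
Proof.
move=> alt szP szQ Q0; have nz i := @alternates_neq0 p P s i alt.
have [incr sgn _] := alt.
(* This size of [u] keeps [1 + u Q / P] positive at all nodes, and the sign chosen below makes the
   leading coefficient of the sum opposite to the sign of [P] at the last node. *)
pose u0 := (1 + \sum_(i < p.+1) `|Q.[s i] / P.[s i]|)^-1.
have den0 : 0 < 1 + \sum_(i < p.+1) `|Q.[s i] / P.[s i]| by rewrite ltr_wpDr // sumr_ge0.
have u00 : 0 < u0 by rewrite invr_gt0.
pose sg := Num.sg (P.[s p] * Q`_p.+1); pose u := - sg * u0.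
have sg1 : `|sg| = 1 by rewrite normr_sg mulf_neq0 ?nz.
have nu : `|u| = u0 by rewrite normrM normrN sg1 mul1r gtr0_norm.
have small i : (i <= p)%N -> `|u * (Q.[s i] / P.[s i])| < 1.
  move=> le_i; rewrite normrM nu mulrC ltr_pdivrMr // mul1r.
  by rewrite (bigD1 (Ordinal (le_i : i < p.+1)%N)) //= addrCA ltrDl ltr_wpDr // sumr_ge0.
pose f i := 1 + u * (Q.[s i] / P.[s i]).
have f0 i : (i <= p)%N -> 0 < f i.
  by move=> /small; rewrite /f ltr_norml => /andP[lt_u _]; rewrite addrC -subr_gt0 opprK in lt_u *.
have fE i : (i <= p)%N -> (P + u *: Q).[s i] = P.[s i] * f i.
  by move=> le_i; rewrite hornerD hornerZ /f; field; apply: nz.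
set P' := P + u *: Q in fE *.
have P'lead : P'`_p.+1 = u * Q`_p.+1 by rewrite coefD coefZ nth_default // add0r.
have u_neq0 : u != 0 by rewrite -normr_eq0 nu gt_eqF.
have szP' : size P' = p.+2.
  apply/eqP; rewrite eqn_leq; apply/andP; split.
    rewrite (leq_trans (size_polyD _ _)) // geq_max (leq_trans szP) //=.
    by rewrite (leq_trans (size_scale_leq _ _)).
  rewrite ltnNge; apply/negP => /leq_sizeP/(_ _ (leqnn _))/eqP.
  by rewrite P'lead mulf_eq0 (negPf u_neq0) (negPf Q0).
pose P2 := - P.[s p] *: P'.
have lead2 : 0 < lead_coef P2.
  rewrite lead_coefZ /lead_coef szP' /= P'lead /u.
  have -> : - P.[s p] * (- sg * u0 * Q`_p.+1) = u0 * (sg * (P.[s p] * Q`_p.+1)) by ring.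
  by rewrite mulr_gt0 // /sg -normrEsg normr_gt0 mulf_neq0 ?nz.
have [y yP] := polyrcf.poly_pinfty_gt_lc lead2.
pose x := Num.max y (s p + 1).
have xP : P.[s p] * P'.[x] < 0.
  have := lt_le_trans lead2 (yP x _); rewrite le_max lexx => /(_ isT).
  by rewrite /P2 hornerZ mulNr oppr_gt0.
exists u, (fun i => if (i <= p)%N then s i else x); split=> //; split.
- move=> i; rewrite ltnS => le_i; rewrite le_i; move: le_i; rewrite leq_eqVlt => /orP[/eqP->|lt_i].
    by rewrite ltnn /x lt_max [X in _ || X]ltrDl ltr01 orbT.
  by rewrite lt_i incr.
- move=> i; rewrite ltnS => le_i; rewrite le_i fE //; move: le_i; rewrite leq_eqVlt => /orP[/eqP->|lt_i].
    by rewrite ltnn mulrAC pmulr_llt0 // f0.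
  rewrite lt_i fE // mulrACA pmulr_llt0 ?sgn //.
  by rewrite mulr_gt0 ?f0 // ltnW.
- by rewrite ltnn; apply: contraTneq xP => ->; rewrite mulr0 ltxx.
Qed.

Lemma sign_change_root P a b : a < b -> P.[a] * P.[b] < 0 -> exists x, a < x < b /\ root P x.
Proof.
move=> ab sgn.
have [x /andP[ax xb] rx] : exists2 x, a <= x <= b & root P x.
  have [le0|gt0] := lerP P.[a] 0.
    apply: poly_ivt; rewrite ?(ltW ab) // le0 /=.
    by rewrite leNgt; apply: contraTN sgn => lt0; rewrite -leNgt mulr_le0 // ltW.
  have [|x axb] := @poly_ivt R (- P) a b (ltW ab).
    rewrite !hornerN oppr_le0 (ltW gt0) oppr_ge0 leNgt; apply: contraTN sgn => lt0.
    by rewrite -leNgt mulr_ge0 // ltW.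
  by rewrite rootN; exists x.
exists x; split=> //; rewrite !lt_neqAle ax xb !andbT; apply/andP; split.
  by apply: contraTneq sgn => ->; rewrite (rootP rx) mul0r ltxx.
by apply: contraTneq sgn => <-; rewrite (rootP rx) mulr0 ltxx.
Qed.

Lemma alternates_roots p P s : alternates p P s ->
  exists T : nat -> R, (forall i j, (i < j)%N -> (j < p)%N -> T i < T j) /\
    forall i, (i < p)%N -> root P (T i).
Proof.
move=> [incr sgn _].
have h i : exists x, (i < p)%N -> s i < x < s i.+1 /\ root P x.
  have [lt_i|] := ltnP i p; last by exists 0.
  by have [x xP] := sign_change_root (incr i lt_i) (sgn i lt_i); exists x.
have [T TP] := choice h; exists T; split=> [i j ij jp|i /TP[]//].
have [/andP[lt1 _] _] := TP j jp; have [/andP[_ lt2] _] := TP i (ltn_trans ij jp).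
apply: (lt_le_trans lt2); apply: le_trans (ltW lt1).
elim: j ij jp {lt1} => // j IH; rewrite ltnS leq_eqVlt => /orP[/eqP->//|ij] jp.
by rewrite (le_trans (IH ij (ltnW jp))) // ltW // incr // ltnW.
Qed.
End Alternation.

(** * Subspaces whose Wronski polynomial has maximal degree *)

Section ToChart.
Variables (F : numFieldType) (k m : nat).

Lemma wronski_neq0_rank (M : 'M[F]_(k, k + m)) x : (wronski M).[x] != 0 -> \rank M = k.
Proof.
rewrite /wronski -[_.[x]]/(horner_eval x _) -det_map_mx map_col_mx => nz.
set O := map_mx _ (oscp F k m) in nz.
have ME : map_mx (horner_eval x) (map_mx polyC M) = M.
  by apply/matrixP => i j; rewrite !mxE /= /horner_eval hornerC.
rewrite ME -unitfE -unitmxE -row_full_unit in nz.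
have := nz; rewrite /row_full -addsmxE => /eqP rk.
have := (mxrank_adds_leqif M O).1; rewrite rk => le_r.
apply/eqP; rewrite eqn_leq rank_leq_row -(leq_add2r m) (leq_trans le_r) // leq_add2l.
exact: rank_leq_row.
Qed.

Lemma size_wronski_mulmx (g : 'M[F]_k) (M : 'M[F]_(k, k + m)) : g \in unitmx ->
  size (wronski (g *m M)) = size (wronski M).
Proof. by rewrite unitmxE unitfE => g0; rewrite wronski_mulmx mul_polyC size_scale. Qed.

Lemma size_wronski_rank (M : 'M[F]_(k, k + m)) : \rank M = k -> (size (wronski M) <= (k * m).+1)%N.
Proof.
move=> rM; have [d [g [gu dM]]] := exists_echelon rM.
rewrite -(size_wronski_mulmx _ gu) (echelon_size dM) ltnS leq_subLR -topexp_lshift addnC leq_add2r.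
exact/sum_inj_ge/(colsub1_inj dM.1).
Qed.

(** Degree [k * m] forces the least possible pivot sum, so the pivots are the first [k] columns in
    some order. *)
Lemma exists_chart (M : 'M[F]_(k, k + m)) : \rank M = k -> size (wronski M) = (k * m).+1 ->
  exists (g : 'M[F]_k) Z, g \in unitmx /\ g *m M = row_mx 1%:M Z.
Proof.
move=> rM szW; have [d [h [hu dM]]] := exists_echelon rM.
have inj_d := colsub1_inj dM.1.
have szE : size (wronski (h *m M)) = (k * m).+1.
  by rewrite size_wronski_mulmx.
have sumd : (\sum_(r < k) d r = \sum_(r < k) r)%N.
  have := echelon_size dM; rewrite szE => /succn_inj eqN.
  apply/eqP; rewrite -(eqn_add2l (k * m)) {1}eqN (echelon_sum dM) topexp_lshift.
  exact: eqxx.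
have lt_d r := min_inj_sum r inj_d sumd.
pose s r : 'I_k := Ordinal (lt_d r).
have sE r : lshift m (s r) = d r by apply: val_inj.
have inj_s : injective s by move=> i j e; apply: inj_d; rewrite -!sE e.
pose N := row_perm (perm inj_s)^-1 (h *m M).
have lN : lsubmx N = 1%:M.
  apply/matrixP => i j; rewrite !mxE.
  have -> : lshift m j = d ((perm inj_s)^-1%g j) by rewrite -sE -(permE inj_s) permKV.
  have := echelon_entry ((perm inj_s)^-1%g i) ((perm inj_s)^-1%g j) dM.
  by rewrite mxE (inj_eq perm_inj).
exists (perm_mx (perm inj_s)^-1 *m h), (rsubmx N).
rewrite unitmx_mul unitmx_perm hu; split=> //.
by rewrite -lN hsubmxK /N row_permE mulmxA.
Qed.
End ToChart.

(** * Real subspaces whose Wronski polynomial has distinct real roots *)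

Section Existence.
Variables (R : realType) (k m : nat).
Let N := (k * m)%N.
Implicit Types d : 'I_k -> 'I_(k + m).

Definition alternating d := exists p (M : 'M[R]_(k, k + m)) s,
  [/\ (p + \sum_(r < k) d r = topexp k m)%N,
      forall i (c : 'I_(k + m)), (c < d i)%N -> M i c = 0,
      forall i, M i (d i) != 0 & alternates p (wronski M) s].

(** Adding [u] times the unit vector of column [d j] to row [j] moves [M] into the larger cell. By
    multilinearity its Wronski polynomial becomes [P + u Q] with [Q] of degree one more, and one
    sign change is gained. *)
Lemma alternating_step d d' j : injective d ->
  (forall i, i != j -> d i = d' i) -> (d j).+1 = d' j :> nat ->
  alternating d' -> alternating d.
Proof.
move=> inj_d dd' dj [p [M [s [pE M0 Md alt]]]].
have pE1 : (p.+1 + \sum_(r < k) d r = topexp k m)%N.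
  rewrite -pE (bigD1 j) // [in RHS](bigD1 j) //= -dj.
  rewrite (eq_bigr (fun r => nat_of_ord (d' r))) => [|r /dd'->//]; lia.
pose E : 'M[R]_(k, k + m) := rowpat R d; pose Q := wronski (mix j M E M).
have mixE r c : mix j M E M r c = if r == j then (c == d j)%:R else M r c.
  by rewrite mix_diag; case: eqP => [->|]//; rewrite mxE.
have mix0 r (c : 'I_(k + m)) : (c < d r)%N -> mix j M E M r c = 0.
  rewrite mixE; case: eqP => [->|/eqP rj] lt_c; first by rewrite -val_eqE /= ltn_eqF.
  by apply: M0; rewrite -dd'.
have szQ := size_wronski_le pE1 mix0.
have Qlead : Q`_p.+1 != 0.
  rewrite /Q (coef_wronski_top pE1 mix0) mulf_neq0 ?omega_neq0 //; apply/prodf_neq0 => r _.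
  by rewrite mixE; have [->|rj] := eqVneq r j; rewrite ?eqxx ?oner_neq0 // dd'.
have [u [s' [u0 alt']]] := alternates_perturb alt (size_wronski_le pE M0) szQ Qlead.
exists p.+1, (mix j M (1 *: M + u *: E) M), s'; split=> //.
- move=> i c lt_c; rewrite mix_diag; have [ij|ij] := eqVneq i j; last by rewrite M0 // -dd'.
  rewrite ij in lt_c *; rewrite mxE [X in X + _]mxE M0; last by rewrite -dj ltnW.
  by rewrite mxE mxE -val_eqE /= ltn_eqF // !mulr0 addr0.
- move=> i; rewrite mix_diag; have [->|ij] := eqVneq i j; last by rewrite dd'.
  rewrite mxE [X in X + _]mxE M0; last by rewrite -dj.
  by rewrite mxE mxE eqxx mulr1 mulr0 add0r.
- rewrite wronski_mix_lin scale1r; suff -> : mix j M M M = M by [].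
  by apply/matrixP => r c; rewrite mix_diag; case: eqP => [->|].
Qed.

(** From the zero-dimensional cell, pivots can be lowered one column at a time into any free
    position. An alternating cell of least pivot sum therefore has the first [k] columns as pivots,
    which gives [N] sign changes. *)
Lemma exists_alternating : exists (M : 'M[R]_(k, k + m)) s,
  alternates N (wronski M) s /\ (size (wronski M) <= N.+1)%N.
Proof.
pose d0 : {ffun 'I_k -> 'I_(k + m)} := [ffun i => cast_ord (addnC m k) (rshift m i)].
have d0E i : d0 i = (m + i)%N :> nat by rewrite ffunE.
have inj_d0 : injective d0 by move=> i j e; apply/val_inj/(@addnI m); rewrite -!d0E e.
have sum0 : (\sum_(r < k) d0 r = topexp k m)%N by apply: eq_bigr => i _; rewrite d0E.
have good0 : `[< injective d0 /\ alternating d0 >].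
  apply/asboolP; split=> //; exists 0%N, (rowpat R d0), (fun=> 0); split=> //.
  - by move=> i c lt_c; rewrite mxE -val_eqE /= ltn_eqF.
  - by move=> i; rewrite mxE eqxx oner_neq0.
  split=> //; have pE : (0 + \sum_(r < k) d0 r = topexp k m)%N by rewrite add0n.
  have Y0 i (c : 'I_(k + m)) : (c < d0 i)%N -> rowpat R d0 i c = 0.
    by move=> lt_c; rewrite mxE -val_eqE /= ltn_eqF.
  rewrite (size1_polyC (size_wronski_le pE Y0)) hornerC (coef_wronski_top pE Y0).
  by rewrite mulf_neq0 ?omega_neq0 //; apply/prodf_neq0 => r _; rewrite mxE eqxx oner_neq0.
case: (arg_minnP (P := fun d : {ffun 'I_k -> 'I_(k + m)} => `[< injective d /\ alternating d >])
                 (fun d : {ffun 'I_k -> 'I_(k + m)} => \sum_(r < k) d r)%N good0).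
move=> d /asboolP[inj_d [p [M [s [pE M0 Md alt]]]]] d_min.
have alt_d : alternating d by exists p, M, s.
have down (c : 'I_(k + m)) i : (c < d i)%N -> c.+1 = d i :> nat -> c \in codom d.
  move=> lt_c cE; apply: contraT => nc.
  have inj_f := inj_fupd (i := i) inj_d nc.
  have : alternating (fupd d i c).
    by apply: (alternating_step (d' := d) (j := i) inj_f) alt_d => [l /negPf|]; rewrite /fupd ?eqxx // => ->.
  move=> alt_f; have := d_min (finfun (fupd d i c)).
  have fE : (finfun (fupd d i c) : _ -> _) = fupd d i c by apply: funext => r; rewrite ffunE.
  rewrite fE => /(_ (introT (asboolP _) (conj inj_f alt_f))).
  by rewrite -(leq_add2r (d i)) sum_fupd leq_add2l leqNgt lt_c.
have down_all v (c : 'I_(k + m)) i : (c + v = d i)%N -> c \in codom d.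
  elim: v c => [|v IH] c cv; first by rewrite (_ : c = d i) ?codom_f //; apply: val_inj; rewrite /= -cv addn0.
  have lt_c1 : (c.+1 < k + m)%N by apply: leq_ltn_trans (ltn_ord (d i)); rewrite -cv addnS ltnS leq_addr.
  have /codomP[l lE] := IH (Ordinal lt_c1) (etrans (addSnnS c v) cv).
  by apply: (down c l); rewrite -lE.
have lt_d i : (d i < k)%N.
  pose f (r : 'I_(d i).+1) : 'I_(k + m) := widen_ord (ltn_ord (d i)) r.
  have inj_f : injective f by move=> r r' /(congr1 val)/= /val_inj.
  have /subset_leq_card : codom f \subset codom d.
    apply/fintype.subsetP => _ /codomP[r ->]; apply: (down_all (d i - r)%N _ i) => /=.
    by rewrite subnKC // -ltnS.
  by rewrite !card_codom // !card_ord.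
pose e i := Ordinal (lt_d i).
have inj_e : injective e by move=> i j /(congr1 val)/= /val_inj/inj_d.
have sumd : (\sum_(r < k) d r = \sum_(r < k) r)%N by rewrite [RHS](reindex_inj inj_e).
have pN : p = N by apply/eqP; rewrite -(eqn_add2r (\sum_(r < k) d r)) pE sumd topexp_lshift.
by exists M, s; rewrite -pN; split=> //; apply: size_wronski_le pE M0.
Qed.

Lemma exists_distinct_real_roots : exists (T : nat -> R) (Z : 'M[R[i]]_(k, m)),
  increasing k m T /\ wr Z = target k m T.
Proof.
have [M [s [alt szle]]] := exists_alternating.
have [T [incT rT]] := alternates_roots alt.
have [_ _ nz] := alt.
have W0 : wronski M != 0 by apply: contraNneq nz => ->; rewrite horner0.
pose rs := [seq T i | i <- iota 0 N].
have rs_root : all (root (wronski M)) rs.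
  by apply/allP => _ /mapP[i + ->]; rewrite mem_iota => /andP[_ lt_i]; apply: rT.
have rs_uniq : uniq rs.
  rewrite map_inj_in_uniq ?iota_uniq // => i j; rewrite !mem_iota /= !add0n => lt_i lt_j e.
  by case: (ltngtP i j) => // lt_ij; [have := incT _ _ lt_ij lt_j | have := incT _ _ lt_ij lt_i]; rewrite e ltxx.
have szW : size (wronski M) = N.+1.
  apply/eqP; rewrite eqn_leq szle /=.
  by have := max_poly_roots W0 rs_root rs_uniq; rewrite size_map size_iota.
have WE : wronski M = lead_coef (wronski M) *: \prod_(z <- rs) ('X - z%:P).
  by apply: all_roots_prod_XsubC; rewrite ?uniq_rootsE // size_map size_iota.
have [g [Zr [gu gM]]] := exists_chart (wronski_neq0_rank nz) szW.
exists T, (map_mx (real_complex R) Zr); split=> //.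
have wE : wr (map_mx (real_complex R) Zr) = (\det g * lead_coef (wronski M))%:C%C *: rootpoly N T.
  have -> : wr (map_mx (real_complex R) Zr) = map_poly (real_complex R) (wronski (g *m M)).
    by rewrite gM -map_wronski map_row_mx map_mx1.
  rewrite wronski_mulmx mul_polyC WE scalerA map_polyZ /=; congr (_ *: _).
    by rewrite lead_coefZ (monicP (monic_prod_XsubC _ _ _)) mulr1.
  rewrite rmorph_prod /rootpoly big_map -(big_mkord xpredT (fun i => 'X - (T i)%:C%C%:P)) /index_iota subn0.
  by apply: eq_bigr => i _; rewrite rmorphB /= map_polyX map_polyC.
rewrite wE /target; congr (_ *: _).
by rewrite -(lead_wr (map_mx (real_complex R) Zr)) wE coefZ lead_rootpoly mulr1.
Qed.
End Existence.

(** * Schubert conditions and roots of the Wronski polynomial *)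

Section Translation.
Variables (F : numFieldType) (k m : nat).
Let n := (k + m)%N.
Implicit Types (M : 'M[F]_(k, n)) (t : F).

(** The substitution of ['X + t] for ['X] on monomials. It carries the osculating flag at 0 to the
    one at [t], which reduces Schubert conditions at [t] to coordinate conditions. *)
Definition shift_mx t : 'M[F]_n := \matrix_(i, j) ('C(j, i)%:R * t ^+ (j - i)).

Lemma shift_mx_unit t : shift_mx t \in unitmx.
Proof.
rewrite -unitmx_tr unitmxE det_trig.
  by rewrite big1 ?unitr1 // => i _; rewrite !mxE binn subnn expr0 mulr1.
by apply/is_trig_mxP => i j lt_ij; rewrite !mxE bin_small // mul0r.
Qed.

Lemma det_shift_mx t : \det (shift_mx t) = 1.
Proof.
rewrite -det_tr det_trig; first by rewrite big1 // => i _; rewrite !mxE binn subnn expr0 mulr1.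
by apply/is_trig_mxP => i j lt_ij; rewrite !mxE bin_small // mul0r.
Qed.

Lemma oscp_derivn (r : 'I_m) (j : 'I_n) : oscp F k m r j = ('X^j)^`(r).
Proof. by rewrite mxE derivnXn scaler_nat. Qed.

Lemma derivn_comp_shift (p : {poly F}) t r : (p \Po ('X + t%:P))^`(r) = p^`(r) \Po ('X + t%:P).
Proof.
elim: r => [|r IH]; first by rewrite !derivn0.
by rewrite !derivnS IH deriv_comp derivD derivX derivC addr0 mulr1.
Qed.

Lemma shift_Xn t (j : 'I_n) : 'X^j \Po ('X + t%:P) = \sum_(i < n) shift_mx t i j *: 'X^i.
Proof.
rewrite comp_Xn_poly addrC exprDn; have lt_j := ltn_ord j.
rewrite (big_ord_widen_cond n xpredT (fun i => (t%:P ^+ (j - i) * 'X^i) *+ 'C(j, i))) //=.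
rewrite big_mkcond /=; apply: eq_bigr => i _.
rewrite mxE; case: ltnP => [_|lt_ji]; last by rewrite bin_small // mul0r scale0r.
have -> : t%:P ^+ (j - i) = (t ^+ (j - i))%:P by rewrite rmorphXn.
transitivity (t ^+ (j - i) *: 'X^i *+ 'C(j, i)).
  by congr (_ *+ _); apply: mul_polyC.
by rewrite scalerMnl mulr_natl.
Qed.

Lemma oscp_shift t : map_mx (fun p => p \Po ('X + t%:P)) (oscp F k m)
  = oscp F k m *m map_mx polyC (shift_mx t).
Proof.
apply/matrixP => r j; rewrite mxE oscp_derivn -derivn_comp_shift shift_Xn mxE linear_sum /=.
apply: eq_bigr => i _; rewrite oscp_derivn derivnZ [X in _ = _ * X]mxE.
by rewrite mulrC mul_polyC.
Qed.

Lemma wronski_shift M t : wronski M \Po ('X + t%:P) = wronski (M *m invmx (shift_mx t)).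
Proof.
transitivity (\det (map_mx (comp_poly ('X + t%:P)) (col_mx (map_mx polyC M) (oscp F k m)))).
  by rewrite det_map_mx.
rewrite map_col_mx.
have -> : map_mx (comp_poly ('X + t%:P)) (map_mx polyC M) =
    map_mx polyC (M *m invmx (shift_mx t)) *m map_mx polyC (shift_mx t).
  rewrite -map_mxM mulmxKV ?shift_mx_unit //.
  by apply/matrixP => i j; rewrite !mxE comp_polyC.
have -> : map_mx (comp_poly ('X + t%:P)) (oscp F k m) = oscp F k m *m map_mx polyC (shift_mx t).
  exact: oscp_shift.
by rewrite -mul_col_mx det_mulmx det_map_mx det_shift_mx !mulr1.
Qed.
End Translation.

Lemma sum_layers (I : finType) (f : I -> nat) L : (forall i, f i <= L)%N ->
  (\sum_i f i = \sum_(v < L) #|[pred i | v < f i]|)%N.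
Proof.
move=> fL; transitivity (\sum_i \sum_(v < L) (v < f i))%N.
  apply: eq_bigr => i _; rewrite -[LHS]card_ord -sum1_card.
  rewrite (big_ord_widen_cond L xpredT (fun=> 1%N)) ?fL // big_mkcond /=.
  by apply: eq_bigr => v _; case: ifP.
rewrite exchange_big /=; apply: eq_bigr => v _.
by rewrite -sum1_card [RHS]big_mkcond; apply: eq_bigr => i _; rewrite inE; case: ifP.
Qed.

(* Compare the numbers of terms above each level [v]. *)
Lemma sum_dominated k (a f : 'I_k -> nat) :
  (forall i j : 'I_k, (i < j)%N -> (a i < a j)%N) ->
  (forall j : 'I_k, k - j <= #|[pred i | a j <= f i]|)%N -> (\sum_j a j <= \sum_i f i)%N.
Proof.
move=> a_incr af; pose L := (\sum_j a j + \sum_i f i)%N.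
have aL j : (a j <= L)%N by rewrite /L (bigD1 j) //= -addnA leq_addr.
have fL j : (f j <= L)%N by rewrite /L [X in (_ + X)%N](bigD1 j) //= addnCA leq_addr.
rewrite (sum_layers aL) (sum_layers fL); apply: leq_sum => v _.
have [->//|] := posnP (#|[pred i : 'I_k | (v < a i)%N]|).
move=> /card_gt0P[j1 vj1].
case: (arg_minnP (P := [pred i : 'I_k | (v < a i)%N]) (fun i : 'I_k => nat_of_ord i) vj1) => j vj j_min.
have le_k : (#|[pred i : 'I_k | (v < a i)%N]| <= k - j)%N.
  have lt_jk := ltn_ord j.
  have -> : #|[pred i : 'I_k | (v < a i)%N]| = #|[pred i : 'I_k | (v < a i)%N & (j <= i)%N]|.
    by apply: eq_card => i; rewrite !inE; case: (boolP (v < a i)%N) => //= vi; rewrite j_min.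
  rewrite -(size_iota j (k - j)) cardE -(size_map val).
  apply: uniq_leq_size; first by rewrite map_inj_uniq ?enum_uniq //; apply: val_inj.
  move=> _ /mapP[i + ->]; rewrite mem_enum inE mem_iota => /andP[_ ->] /=.
  by rewrite subnKC // ltnW.
rewrite (leq_trans le_k) // (leq_trans (af j)) //; apply/subset_leq_card/fintype.subsetP => i.
by rewrite !inE; apply: leq_trans.
Qed.

Lemma rank_col_support (F : fieldType) p q (x : 'M[F]_(p, q)) (A : {pred 'I_q}) :
  (forall r i, i \notin A -> x r i = 0) -> (\rank x <= #|A|)%N.
Proof.
move=> xA; pose e (l : 'I_#|A|) : 'I_q := enum_val l.
have -> : x = colsub e x *m rowsub e 1%:M.
  apply/matrixP => r c; rewrite mxE; have [cA|/[dup] nc /xA->] := boolP (c \in A).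
    rewrite (bigD1 (enum_rank_in cA c)) //= !mxE /e enum_rankK_in // eqxx mulr1.
    rewrite big1 ?addr0 // => l lc; rewrite !mxE; case: eqP => [lE|]; rewrite ?mulr0 //.
    by case/eqP: lc; apply: enum_val_inj; rewrite enum_rankK_in.
  rewrite big1 // => l _; rewrite !mxE; case: eqP => [lE|]; rewrite ?mulr0 //.
  by rewrite -lE /e enum_valP in nc.
by rewrite (leq_trans (mxrankM_maxl _ _)) // rank_leq_col.
Qed.

(** * Osculating flags and orders of vanishing *)

Section Flags.
Variables (F : numFieldType) (k m : nat).
Local Notation n := (k + m)%N.
Implicit Types (M : 'M[F]_(k, k + m)) (t : F).

Definition oscn b t : 'M[F]_(b, k + m) := \matrix_(r, j) ((j ^_ r)%:R * t ^+ (j - r)).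

Definition coord_mx b : 'M[F]_(b, k + m) := \matrix_(r, i) ((r`!)%:R * (i == r :> nat)%:R).

Lemma oscn_shift b t : (b <= n)%N -> oscn b t = coord_mx b *m shift_mx k m t.
Proof.
move=> le_b; apply/matrixP => r j; rewrite !mxE.
have lt_r : (r < n)%N by apply: leq_trans (ltn_ord r) le_b.
rewrite (bigD1 (Ordinal lt_r)) //= big1 ?addr0 => [|i ir]; last first.
  by rewrite mxE (_ : (i == r :> nat) = false) ?mulr0 ?mul0r //; apply: negPf; rewrite -val_eqE in ir.
by rewrite !mxE eqxx mulr1 mulrA -natrM mulnC bin_ffact.
Qed.

Lemma wronski_horner M t : (wronski M).[t] = \det (col_mx M (oscn m t)).
Proof.
rewrite /wronski -[_.[t]]/(horner_eval t _) -det_map_mx map_col_mx; congr (\det (col_mx _ _)).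
  by apply/matrixP => i j; rewrite !mxE /= /horner_eval hornerC.
by apply/matrixP => i j; rewrite !mxE /= /horner_eval hornerZ hornerXn.
Qed.

Lemma dwronski_horner M X t :
  (dwronski M M X).[t] = \tr (col_mx X 0 *m \adj (col_mx M (oscn m t))).
Proof.
rewrite dwronski_trace -[_.[t]]/(horner_eval t _) /mxtrace rmorph_sum; apply: eq_bigr => i _.
rewrite !mxE rmorph_sum; apply: eq_bigr => l _; rewrite rmorphM; congr (_ * _).
  rewrite !mxE; case: splitP => r _; rewrite ?mxE ?rmorph0 //.
  by rewrite /= /horner_eval hornerC.
rewrite !mxE /cofactor rmorphM rmorphXn rmorphN1 -det_map_mx; congr (_ * \det _).
apply/matrixP => r c; rewrite !mxE; case: splitP => s _; rewrite !mxE /= /horner_eval.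
  by rewrite hornerC.
by rewrite hornerZ hornerXn.
Qed.

Lemma rank_oscn b t : (b <= n)%N -> \rank (oscn b t) = b.
Proof.
move=> le_b; rewrite oscn_shift // mxrankMfree ?row_free_unit ?shift_mx_unit //.
apply/eqP; rewrite eqn_leq rank_leq_row.
pose w (r : 'I_b) : 'I_n := widen_ord le_b r.
pose D : 'M[F]_b := colsub w (coord_mx b).
have Du : D \in unitmx.
  rewrite unitmxE det_trig.
    apply/unitr_prodP => i _; rewrite !mxE /= eqxx mulr1 unitfE pnatr_eq0.
    by rewrite -lt0n fact_gt0.
  apply/is_trig_mxP => i j lt_ij; rewrite !mxE /= (_ : (j == i :> nat) = false) ?mulr0 //.
  by rewrite gtn_eqF.
have rD : \rank D = b by rewrite mxrank_unit.
by rewrite -{1}rD /D -[X in colsub w X]mulmx1 colsub_mulmx mxrankM_maxl.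
Qed.

(** After translation to 0 the flag consists of the first coordinates, so the columns are reversed
    to make pivots mark the last nonzero entries. A vector of the intersection has no component
    along a row whose last entry lies beyond column [b]. *)
Lemma rank_cap_oscn b t M (g : 'M[F]_k) (d : 'I_k -> 'I_(k + m)) : (b <= n)%N -> g \in unitmx ->
  echelon d (g *m colsub (@rev_ord n) (M *m invmx (shift_mx k m t))) ->
  (\rank (M :&: oscn b t)%MS <= #|[pred i | n - b <= d i]%N|)%N.
Proof.
move=> le_b gu dM; set S := (M :&: oscn b t)%MS.
have su := shift_mx_unit (F := F) k m t.
have [Y SY] : exists Y, S = Y *m M by apply/submxP; apply: capmxSl.
have [Q SQ] : exists Q, S = Q *m oscn b t by apply/submxP; apply: capmxSr.
set M' := M *m _ in dM.
have S1 : S *m invmx (shift_mx k m t) = (Y *m invmx g) *m (g *m M').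
  by rewrite -mulmxA (mulmxA (invmx g)) mulVmx // mul1mx /M' mulmxA -SY.
have S2 : S *m invmx (shift_mx k m t) = Q *m coord_mx b.
  by rewrite SQ oscn_shift // -!mulmxA mulmxV // mulmx1.
have -> : \rank S = \rank (S *m invmx (shift_mx k m t)).
  by rewrite mxrankMfree // row_free_unit unitmx_inv.
rewrite S1 (leq_trans (mxrankM_maxl _ _)) //; apply: rank_col_support => r i.
rewrite inE -ltnNge => lt_d; set x := Y *m _.
have xE : (x *m (g *m M')) r (rev_ord (d i)) = x r i.
  rewrite mxE (bigD1 i) //= big1 ?addr0 => [|l li].
    have := echelon_entry i i dM; rewrite -colsub_mulmx mxE eqxx => ->; exact: mulr1.
  have := echelon_entry l i dM; rewrite -colsub_mulmx mxE (negPf li) => ->; exact: mulr0.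
rewrite -xE -S1 S2 mxE big1 // => l _; rewrite mxE (_ : (_ == _ :> nat) = false) ?mulr0 //.
by apply/eqP => /=; have := ltn_ord l; have := ltn_ord (d i); move: lt_d; lia.
Qed.

(** The Schubert conditions bound from below the number of reversed pivots above each [a j], hence
    their sum. In the original order the rows then end early, which forces a high power of ['X] into
    the translated Wronski polynomial. *)
Lemma schubert_dvd (a : 'I_k -> nat) t M : \rank M = k ->
  (forall i j : 'I_k, (i < j)%N -> (a i < a j)%N) -> (forall j, (a j < n)%N) ->
  (forall j : 'I_k, k - j <= \rank (M :&: oscn (n - a j) t)%MS)%N ->
  ('X - t%:P) ^+ (\sum_(j < k) (a j - j)) %| wronski M.
Proof.
move=> rM a_incr a_lt schub; have su := shift_mx_unit (F := F) k m t.
pose M' := M *m invmx (shift_mx k m t).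
have rM' : \rank (colsub (@rev_ord n) M') = k.
  have -> : colsub (@rev_ord n) M' = col_perm (perm (@rev_ord_inj n)) M'.
    by apply/matrixP => i j; rewrite !mxE permE.
  rewrite col_permE mxrankMfree ?row_free_unit ?unitmx_perm //.
  by rewrite mxrankMfree // row_free_unit unitmx_inv.
have [d [g [gu dM]]] := exists_echelon rM'.
have count (j : 'I_k) : (k - j <= #|[pred i | a j <= d i]%N|)%N.
  rewrite (leq_trans (schub j)) // (leq_trans (rank_cap_oscn (leq_subr _ _) gu dM)) //.
  by rewrite subKn // ltnW.
have sum_ad := sum_dominated a_incr count.
have N0 i (c : 'I_(k + m)) : (rev_ord (d i) < c)%N -> (g *m M') i c = 0.
  move=> lt_c; have := dM.2 i (rev_ord c); rewrite -colsub_mulmx mxE rev_ordK; apply.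
  by move: lt_c => /=; have := ltn_ord (d i); have := ltn_ord c; lia.
have [q qE] := wronski_dvd_Xn N0.
have a_ge (j : 'I_k) : (j <= a j)%N.
  case: j => j; elim: j => // j IH lt_j; have lt_j' := ltnW lt_j.
  by apply: leq_ltn_trans (IH lt_j') (a_incr (Ordinal lt_j') (Ordinal lt_j) _).
have exp_ge : (\sum_(j < k) (a j - j) <= topexp k m - \sum_(r < k) rev_ord (d r))%N.
  have e1 : (\sum_(j < k) (a j - j) + \sum_(j < k) j = \sum_(j < k) a j)%N.
    by rewrite -big_split; apply: eq_bigr => j _ /=; rewrite subnK.
  have e2 : (\sum_(r < k) rev_ord (d r) + \sum_(r < k) d r = \sum_(r < k) n.-1)%N.
    by rewrite -big_split; apply: eq_bigr => r _ /=; have := ltn_ord (d r); lia.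
  have e3 : (topexp k m + \sum_(r < k) r = \sum_(r < k) n.-1)%N.
    rewrite /topexp [X in (_ + X)%N](reindex_inj rev_ord_inj) -big_split.
    by apply: eq_bigr => r _ /=; have := ltn_ord r; lia.
  move: e1 e2 e3 sum_ad; set s1 := (\sum_(j < k) (a j - j))%N; set s2 := (\sum_(j < k) j)%N.
  set s3 := (\sum_(j < k) a j)%N; set s4 := (\sum_(r < k) rev_ord (d r))%N.
  set s5 := (\sum_(i < k) d i)%N; set s6 := (\sum_(r < k) n.-1)%N; lia.
have dvdX : 'X^(\sum_(j < k) (a j - j)) %| wronski M'.
  have : 'X^(\sum_(j < k) (a j - j)) %| wronski (g *m M').
    by rewrite qE dvdp_mull // dvdp_exp2l.
  by rewrite wronski_mulmx mul_polyC dvdpZr //; move: gu; rewrite unitmxE unitfE.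
have : ('X^(\sum_(j < k) (a j - j)) \Po ('X - t%:P)) %| (wronski M' \Po ('X - t%:P)).
  by case/dvdpP: dvdX => p ->; rewrite comp_polyM dvdp_mull.
rewrite -wronski_shift comp_Xn_poly -comp_polyA comp_polyD comp_polyX comp_polyC.
by rewrite subrK comp_polyXr.
Qed.
End Flags.

(** * Conclusion *)

Section Final.
Variables (R : realType) (k m : nat).
Local Notation C := R[i].
Local Notation cj := (map_mx (@conjc R)).
Local Notation N := (k * m)%N.

Lemma osc_oscn i t : osc (k + m) i t = oscn k m i (t%:C%C : C).
Proof. by apply/matrixP => r j; rewrite !mxE. Qed.

Lemma rank_cap_det (M : 'M[C]_(k, k + m)) t : \rank M = k -> (wronski M).[t] = 0 ->
  (0 < \rank (M :&: oscn k m m t)%MS)%N.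
Proof.
move=> rM W0; have := mxrank_sum_cap M (oscn k m m t).
rewrite rM rank_oscn ?leq_addl // => rk; rewrite lt0n; apply/negP => /eqP r0.
move: W0; rewrite wronski_horner => /eqP; apply/negP; rewrite -unitfE -unitmxE -row_full_unit.
by rewrite r0 addn0 in rk; rewrite /row_full -addsmxE; apply/eqP.
Qed.

(** For every index but the last, the condition follows from a dimension count; the last one says
    that [M] meets the [m]-plane of the flag, which is the vanishing of the determinant. *)
Lemma divisor_in_schub (M : 'M[C]_(k, k + m)) t : \rank M = k -> (wronski M).[t%:C%C] = 0 ->
  in_schub (alpha_div (k := k)) t M.
Proof.
move=> rM W0 j; rewrite osc_oscn /alpha_div; case: eqP => [jk|jk].
  rewrite addKn (leq_trans _ (rank_cap_det rM W0)) // jk.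
  by have := ltn_ord j; lia.
have lt_j := ltn_ord j; have le_n : (k + m - j <= k + m)%N by apply: leq_subr.
have := mxrank_sum_cap M (oscn k m (k + m - j) t%:C%C).
rewrite rM rank_oscn //; have := rank_leq_col (M + oscn k m (k + m - j) t%:C%C)%MS.
by move: (\rank _) (\rank _) => r1 r2; lia.
Qed.

Hypothesis transverse : forall T : 'I_(k * m) -> R, injective T -> divisors_transverse T.

(* The Jacobian is onto [C^(k m)] and kills the directions tangent to the fibres
   of the Stiefel parametrization, so it is injective on the [k m] chart directions. *)
Lemma regular_of_transverse T : increasing k m T -> forall Z : 'M[C]_(k, m), wr Z = target k m T -> regular Z.
Proof.
move=> incT Z wZ H dH; pose T' (i : 'I_N) := T i.
have inj_T : injective T'.
  move=> i j e; apply: val_inj; case: (ltngtP i j) => // lt_ij.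
    by have := incT _ _ lt_ij (ltn_ord j); rewrite -[T i]/(T' i) e ltxx.
  by have := incT _ _ lt_ij (ltn_ord i); rewrite -[T i]/(T' i) e ltxx.
have root_T (i : 'I_N) : (wr Z).[(T' i)%:C%C] = 0.
  rewrite wZ hornerZ horner_prod (bigD1 i) //= hornerXsubC subrr mul0r mulr0 //.
have := transverse inj_T (rank_chart Z) (fun i => divisor_in_schub (rank_chart Z) (root_T i)).
move=> surj.
pose f (h : 'rV[C]_N) : 'rV[C]_N := \row_i (dwr Z Z (vec_mx h)).[(T' i)%:C%C].
have fE h i : f h 0 i = (dwr Z Z (vec_mx h)).[(T' i)%:C%C] by rewrite mxE.
have f_lin : linear f.
  move=> a h1 h2; have := dwr_lin Z Z (vec_mx h1) (vec_mx h2) a 1; rewrite !scale1r => E.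
  apply/rowP => i; rewrite fE [RHS]mxE [in RHS]mxE !fE -hornerZ -hornerD -E.
  by rewrite (linearP (@vec_mx C k m)).
pose fL := GRing.isLinear.Build _ _ _ _ f f_lin.
pose A := lin1_mx (HB.pack f fL : {linear _ -> _}).
have fA h : h *m A = f h by rewrite mul_rV_lin1.
have Afull : row_full A.
  rewrite -sub1mx; apply/row_subP => i0; set v := row i0 _.
  have [X XP] := surj v.
  (* Any direction is a change of basis plus a chart direction. The first part contributes a
     multiple of [wr Z], which vanishes at the roots [T' i]. *)
  have XE : X = lsubmx X *m chart Z + row_mx 0 (rsubmx X - lsubmx X *m Z).
    by rewrite mul_mx_row mulmx1 add_row_mx addr0 addrC subrK hsubmxK.
  apply/submxP; exists (mxvec (rsubmx X - lsubmx X *m Z)); rewrite fA.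
  apply/rowP => i; rewrite -XP mxE mxvecK /ddet ddet_trace osc_oscn -dwronski_horner.
  have -> : dwronski (chart Z) (chart Z) X = dwronski (chart Z) (chart Z) (lsubmx X *m chart Z)
      + dwr Z Z (rsubmx X - lsubmx X *m Z) by rewrite -dwronskiD -XE.
  by rewrite dwronski_mull hornerD hornerZ -/(wr Z) root_T mulr0 add0r.
have Au : A \in unitmx by rewrite -row_full_unit.
have : mxvec H *m A = 0.
  by rewrite fA; apply/rowP => i; rewrite !mxE mxvecK dH horner0.
move/(congr1 (mulmx^~ (invmx A))); rewrite mulmxK // mul0mx => H0.
by rewrite -[H]mxvecK H0 linear0.
Qed.

Lemma chart_real (T0 : nat -> R) (Z : 'M[C]_(k, m)) :
  (forall i j, (i < j)%N -> (j < N)%N -> T0 i <= T0 j) -> wr Z = target k m T0 -> cj Z = Z.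
Proof.
move=> incT0 wZ; apply: contrapT => nr.
have [U UU Uoo] := exists_ultra.
have [Ts [Zs [incs wZs]]] := exists_distinct_real_roots R k m.
have [T1 inc1 nr1] := split_roots UU Uoo regular_of_transverse incT0 nr wZ (regular_of_transverse incs wZs).
have [Tg real_g inc_g] := exists_all_real R k m N.
have [Zg [nrg wZg]] := transport_nonreal regular_of_transverse UU Uoo inc1 inc_g nr1.
have := real_g _ (@lshift_inj k m) (topexp_lshift k m) _ (echelon_chart Zg) wZg.
case=> realZ _; apply: nrg; move: realZ; rewrite conj_chart => /(congr1 rsubmx).
by rewrite !row_mxKr.
Qed.
End Final.

Lemma coprime_prod_dvdp (F : fieldType) (I : finType) (t : I -> F) (e : I -> nat) (p : {poly F}) :
  injective t -> (forall l, ('X - (t l)%:P) ^+ e l %| p) -> \prod_l ('X - (t l)%:P) ^+ e l %| p.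
Proof.
move=> inj_t dvd; suff : forall s, uniq s -> \prod_(l <- s) ('X - (t l)%:P) ^+ e l %| p.
  by move=> /(_ (index_enum I) (index_enum_uniq I)).
elim=> [|l s IH] /=; first by rewrite big_nil dvd1p.
case/andP=> ls us; rewrite big_cons Gauss_dvdp ?dvd ?IH //.
rewrite coprimep_sym; elim: s ls {us IH} => [|l' s IH]; first by rewrite big_nil coprime1p.
rewrite inE negb_or big_cons => /andP[ll' ls]; rewrite coprimepMl IH // andbT.
apply: coprimep_expl; apply: coprimep_expr; rewrite coprimep_XsubC root_XsubC.
by rewrite (inj_eq inj_t).
Qed.

Theorem mainTheorem7 (R : realType) (k m : nat) (hk : (0 < k)%N) (hm : (0 < m)%N) :
  (forall T : 'I_(k * m) -> R, injective T -> divisors_transverse T) ->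
  forall (s : nat) (a : 'I_s -> 'I_k -> nat) (T : 'I_s -> R),
    (forall l, schub_index (k + m) (a l)) ->
    (\sum_(l < s) schub_size (a l))%N = (k * m)%N ->
    injective T ->
    forall M : 'M[R[i]]_(k, k + m), \rank M = k ->
      (forall l, in_schub (a l) (T l) M) ->
      real_point M.
Proof.
move=> transverse s a T sch_a sum_a inj_T M rM MP.
pose rs := flatten [seq nseq (schub_size (a l)) (T l) | l <- index_enum 'I_s].
have rs_size : size rs = (k * m)%N.
  rewrite size_flatten /shape -map_comp sumnE big_map -sum_a.
  by apply: eq_bigr => l _; rewrite /= size_nseq.
pose P : {poly R[i]} := \prod_l ('X - (T l)%:C%C%:P) ^+ schub_size (a l).
have PE : P = \prod_(z <- rs) ('X - z%:C%C%:P).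
  rewrite /rs big_flatten big_map; apply: eq_bigr => l _.
  by rewrite big_nseq iter_mulr_1.
have dvdP : P %| wronski M.
  apply: coprime_prod_dvdp => [l l' /complexI/inj_T//|l].
  have [incr lt_n] := sch_a l; apply: schubert_dvd => // j.
  by rewrite -osc_oscn; apply: MP.
(* Roots are listed with multiplicity in weakly increasing order, as the splitting of multiple roots
   requires. *)
pose T0 i := nth 0 (sort <=%R rs) i.
have rootP : rootpoly (k * m) T0 = P.
  have perm_rs : perm_eq (sort <=%R rs) rs by rewrite perm_sort.
  rewrite PE -(perm_big _ perm_rs) /= (big_nth 0) size_sort rs_size big_mkord.
  by [].
have szW : size (wronski M) = (k * m).+1.
  apply/eqP; rewrite eqn_leq (size_wronski_rank rM).
  by rewrite -(size_rootpoly (k * m) T0) rootP (dvdp_leq (wronski_neq0 rM) dvdP).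
have [g [Z [gu gM]]] := exists_chart rM szW.
have wZ : wr Z = target k m T0.
  have [q qE] := dvdpP _ _ dvdP.
  have q0 : q != 0 by apply: contraNneq (wronski_neq0 rM) => z; rewrite qE z mul0r.
  (* The prescribed roots already account for the full degree [k * m], so [wronski M] is a constant
     multiple of their product. *)
  have szq : size q = 1%N.
    have := szW; rewrite qE -rootP size_Mmonic ?rootpoly_monic // size_rootpoly addnS /=.
    by rewrite -add1n => /addIn.
  have wE : wr Z = (\det g * q`_0) *: rootpoly (k * m) T0.
    rewrite /wr -[chart Z]gM wronski_mulmx qE (size1_polyC (eq_leq szq)) -rootP.
    by rewrite -mul_polyC polyCM coefC mulrA.
  rewrite wE /target; congr (_ *: _).
  by rewrite -(lead_wr Z) wE coefZ lead_rootpoly mulr1.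
have incT0 i j : (i < j)%N -> (j < k * m)%N -> T0 i <= T0 j.
  move=> lt_ij lt_j; rewrite /T0; apply: (sorted_leq_nth (@le_trans _ _) (@le_refl _ _)).
  - by apply: sort_sorted; apply: le_total.
  - by rewrite inE size_sort rs_size (ltn_trans lt_ij).
  - by rewrite inE size_sort rs_size.
  - exact: ltnW.
have realZ := chart_real transverse incT0 wZ.
exists (row_mx 1%:M (map_mx (@complex.Re R) Z)).
have -> : map_mx (fun x => x%:C%C) (row_mx 1%:M (map_mx (@complex.Re R) Z)) = g *m M.
  rewrite gM map_row_mx; congr row_mx; first by rewrite (map_mx1 (real_complex R)).
  apply/matrixP => i j; rewrite !mxE; move/matrixP/(_ i j): realZ; rewrite mxE.
  by case: (Z i j) => x y /= [/eqP]; rewrite eq_sym -addr_eq0 -mulr2n mulrn_eq0 /= => /eqP->.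
by apply/eqmxP/eqmxMfull; rewrite row_full_unit.
Qed.
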